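(* Let $(X_t)_{t\ge 0}$ be a positively curved diffusion on a probability space $(E,\mathcal{E},\mu)$, with curvature $\kappa>0$, starting from a deterministic point $x\in E$. Then for every $\varepsilon\in\left(0,\frac12\right)$, $$\mathrm{w}_{\mathrm{mix}}(\varepsilon)\ \le\ \frac{3}{\kappa\varepsilon^2}.$$ In particular, if for each $n\in\mathbb{N}$, $(X^{(n)}_t)_{t\ge 0}$ is a positively curved diffusion (with state space, generator and deterministic initial state possibly depending on $n$) with curvature $\kappa_n>0$ and mixing times $\mathrm{t}_{\mathrm{mix}}^{(n)}(\cdot)$, and if for some $\varepsilon_0\in(0,1)$ $$\kappa_n\times\mathrm{t}_{\mathrm{mix}}^{(n)}(\varepsilon_0)\ \xrightarrow[n\to\infty]{}\ +\infty,$$ then cutoff occurs, i.e. for all $\varepsilon\in(0,1)$, $\ \mathrm{t}_{\mathrm{mix}}^{(n)}(1-\varepsilon)/\mathrm{t}_{\mathrm{mix}}^{(n)}(\varepsilon)\to 1$ as $n\to\infty$.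
   Context: Setting. Let $(E,\mathcal{E},\mu)$ be a probability space and $(P_t)_{t\ge 0}$ a strongly continuous Markov semigroup of self-adjoint operators on $L^2(\mu)$. Its infinitesimal generator is $Lf:=\lim_{t\to 0}\frac{P_tf-f}{t}$, defined for all $f\in L^2(\mu)$ such that the limit exists in $L^2(\mu)$; the set of such $f$ is $\mathrm{Dom}(L)$. The carré du champ operator is $\Gamma(f,g):=\frac12\left(L(fg)-fLg-gLf\right)$ for $f,g\in L^2(\mu)$ with $f,g,fg\in\mathrm{Dom}(L)$, and $\Gamma f:=\Gamma(f,f)$. Positively curved diffusion. Let $x\in E$ be an arbitrary point and let $(X_t)_{t\ge 0}$ be a Markov process with generator $L$ (i.e. with transition semigroup $(P_t)_{t\ge0}$, $P_tf(y)=\mathbb{E}[f(X_t)\mid X_0=y]$) starting from $X_0=x$. It is called a positively curved diffusion with curvature $\kappa>0$ if: for each $t>0$, $X_t$ admits a density $f_t$ with respect to $\mu$; both $f_t$ and $\log f_t$ are in $\mathrm{Dom}(L)$, as well as their squares and their product; and the following two conditions hold when $f=f_t$, $g=\log f_t$ and $\phi=\log$, for each $t>0$: (i) chain rule: $\Gamma(\phi(f),g)=\phi'(f)\,\Gamma(f,g)$; (ii) the $\mathrm{CD}(\kappa,\infty)$ criterion: $\Gamma P_s g\le e^{-2\kappa s}P_s\Gamma g$ for all $s\ge 0$ (the expressions involved being understood to be well defined). Mixing times. For an $E$-valued random variable $X$, $\mathrm{TV}(X):=\sup_{A\in\mathcal{E}}|\mathbb{P}(X\in A)-\mu(A)|$.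 For $\varepsilon\in(0,1)$, $\mathrm{t}_{\mathrm{mix}}(\varepsilon):=\inf\{t>0:\mathrm{TV}(X_t)\le\varepsilon\}$. For $\varepsilon\in(0,1/2)$, the width of the mixing window is $\mathrm{w}_{\mathrm{mix}}(\varepsilon):=\mathrm{t}_{\mathrm{mix}}(\varepsilon)-\mathrm{t}_{\mathrm{mix}}(1-\varepsilon)$. Standard fact recalled in the paper: the spectral gap $\lambda$ (the largest $\lambda\ge0$ such that $\|P_tf\|_2\le e^{-\lambda t}\|f\|_2$ for all $t\ge0$ and all $f\in L^2(\mu)$ with $\int_E f\,\mathrm{d}\mu=0$) satisfies $\lambda\ge\kappa$ under positive curvature $\kappa$.
   Formalization: The Markov property of the process is required with respect to the right-continuous filtration, which gives a zero-one law at time 0; otherwise a null starting point x could branch at once into two far-apart points and the window bound would fail. *)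

(* Defs.v *)
(* MathComp-Analysis: all real numbers live in an abstract [R : realType]. *)
From mathcomp Require Import all_boot all_order all_algebra.
From mathcomp Require Import all_classical all_reals all_analysis.

Set Implicit Arguments.
Unset Strict Implicit.
Unset Printing Implicit Defensive.
Import Order.TTheory GRing.Theory Num.Theory.
Import numFieldNormedType.Exports.

Local Open Scope classical_set_scope.
Local Open Scope ring_scope.

(* Elements of L^2(mu) are represented by functions in [Lfun mu 2%:E], and
   identities and inequalities between them are stated mu-almost everywhere. *)

Section semigroup.
Context d (E : measurableType d) (R : realType).
Variables (mu : probability E R) (P : R -> R.-pker E ~> E).
Implicit Types (f g h : E -> R) (s t : R).

(* P_t f (y) = E[f(X_t) | X_0 = y].  For f in L^1(mu) the integral converges for
   mu-almost every y only; elsewhere the value is irrelevant. *)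
Definition sgop t f : E -> R := fun y => \int[P t y]_z f z.

(* Positivity and P_t 1 = 1 hold because the P_t are probability kernels.  Only
   the indices t >= 0 are meaningful. *)
Record markov_semigroup : Prop := MarkovSemigroup {
  sgop_L2 : forall t f, 0 <= t -> f \in Lfun mu 2%:E ->
    sgop t f \in Lfun mu 2%:E ;
  sgop0 : forall f, f \in Lfun mu 2%:E -> sgop 0 f = f %[ae mu] ;
  sgopD : forall s t f, 0 <= s -> 0 <= t -> f \in Lfun mu 2%:E ->
    sgop (s + t) f = sgop s (sgop t f) %[ae mu] ;
  sgop_selfadjoint : forall t f g, 0 <= t ->
    f \in Lfun mu 2%:E -> g \in Lfun mu 2%:E ->
    \int[mu]_y (f y * sgop t g y) = \int[mu]_y (sgop t f y * g y) ;
  sgop_continuous : forall f, f \in Lfun mu 2%:E ->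
    'N[mu]_2%:E[EFin \o (sgop t f \- f)%R]%E @[t --> 0^'+] --> 0%E }.

Definition is_generator f h : Prop :=
  [/\ f \in Lfun mu 2%:E, h \in Lfun mu 2%:E &
   'N[mu]_2%:E[EFin \o (fun y => t^-1 * (sgop t f y - f y) - h y)%R]%E
     @[t --> 0^'+] --> 0%E].

Definition Dom f : Prop := exists h, is_generator f h.

(* A representative of the L^2-limit; [cst 0] outside of [Dom]. *)
Definition generator f : E -> R := xget (cst 0) [set h | is_generator f h].

Definition Gamma_defined f g : Prop := [/\ Dom f, Dom g & Dom (f \* g)].

Definition Gamma f g : E -> R := fun y =>
  2^-1 * (generator (f \* g) y - f y * generator g y - g y * generator f y).

Definition chain_rule (phi : R -> R) f g : Prop :=
  {ae mu, forall y, Gamma (phi \o f) g y = derive1 phi (f y) * Gamma f g y}.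

Definition curvature_criterion (kappa : R) g : Prop := forall s, 0 <= s ->
  Gamma_defined (sgop s g) (sgop s g) /\
  {ae mu, forall y, Gamma (sgop s g) (sgop s g) y
                    <= expR (- (2 * kappa * s)) * sgop s (Gamma g g) y}.

End semigroup.

Section process.
Context d (E : measurableType d) (R : realType).
Context d' (Omega : measurableType d') (Pr : probability Omega R).
Variable X : R -> {RV Pr >-> E}.

Definition past (s : R) : set (set Omega) :=
  <<s [set A | exists r B, [/\ 0 <= r, r <= s, measurable B & A = X r @^-1` B]]>>.

Definition right_past (s : R) : set (set Omega) :=
  [set A | forall r, s < r -> past r A].

(* As usual for diffusions, the Markov property refers to the right-continuous
   filtration.  Compared with the natural filtration this only matters at time
   0, where it gives Blumenthal's zero-one law.  Without it an exceptional
   initial state x with mu {x} = 0 could branch at once into a random position,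
   and X would behave like a process with a random initial state. *)
Definition markov_process (P : R -> R.-pker E ~> E) : Prop :=
  forall s t (A : set Omega) (B : set E), 0 <= s -> 0 <= t ->
    right_past s A -> measurable B ->
    Pr (A `&` X (s + t) @^-1` B) = (\int[Pr]_(w in A) P t (X s w) B)%E.

Definition TV (mu : probability E R) (Y : {RV Pr >-> E}) : \bar R :=
  ereal_sup [set `|distribution Pr Y A - mu A|%E | A in measurable].

(* The density is required to be positive almost everywhere wherever its
   logarithm is used, because [ln] is total. *)
Definition has_density (mu : probability E R) (Y : {RV Pr >-> E})
    (f : E -> R) : Prop :=
  [/\ measurable_fun setT f, (forall y, 0 <= f y) &
   forall A, measurable A ->
     distribution Pr Y A = (\int[mu]_(y in A) (f y)%:E)%E].

End process.

(* The indices t < 0 of [pcd_P] and [pcd_X] play no role. *)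
Record positively_curved_diffusion (R : realType) := PositivelyCurvedDiffusion {
  pcd_disp : measure_display ;
  pcd_E : measurableType pcd_disp ;
  pcd_mu : probability pcd_E R ;
  pcd_P : R -> R.-pker pcd_E ~> pcd_E ;
  pcd_semigroup : markov_semigroup pcd_mu pcd_P ;
  pcd_disp' : measure_display ;
  pcd_Omega : measurableType pcd_disp' ;
  pcd_Pr : probability pcd_Omega R ;
  pcd_X : R -> {RV pcd_Pr >-> pcd_E} ;
  pcd_markov : markov_process pcd_X pcd_P ;
  pcd_x : pcd_E ;
  pcd_start : {ae pcd_Pr, forall w, pcd_X 0 w = pcd_x} ;
  pcd_kappa : R ;
  pcd_kappa_gt0 : 0 < pcd_kappa ;
  pcd_curved : forall t, 0 < t -> exists f : pcd_E -> R,
    let g := @ln R \o f in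
    [/\ has_density pcd_mu (pcd_X t) f,
        {ae pcd_mu, forall y, 0 < f y},
        [/\ Dom pcd_mu pcd_P f, Dom pcd_mu pcd_P g,
            Dom pcd_mu pcd_P (f \* f), Dom pcd_mu pcd_P (g \* g) &
            Dom pcd_mu pcd_P (f \* g)],
        chain_rule pcd_mu pcd_P (@ln R) f g &
        curvature_criterion pcd_mu pcd_P pcd_kappa g] }.

Section mixing.
Context (R : realType) (D : positively_curved_diffusion R).
Local Open Scope ereal_scope.

Definition t_mix (eps : R) : \bar R :=
  ereal_inf [set t%:E | t in
    [set t : R | (0 < t)%R /\ TV (pcd_mu D) (pcd_X D t) <= eps%:E]].

Definition w_mix (eps : R) : \bar R := t_mix eps - t_mix (1 - eps)%R.

End mixing.

(* Main.v *)
Require Import Defs.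
From HB Require Import structures.
From mathcomp Require Import all_boot all_order all_algebra.
From mathcomp Require Import all_classical all_reals all_analysis.
From mathcomp Require Import measurable_realfun ring lra.
Set Implicit Arguments.
Unset Strict Implicit.
Unset Printing Implicit Defensive.
Import Order.TTheory GRing.Theory Num.Theory.
Import numFieldNormedType.Exports.
Local Open Scope classical_set_scope.
Local Open Scope ring_scope.

(* Let f_t be the density of X_t, H(t) its relative entropy, I(t) its Fisher
   information and V(t) the variance of ln f_t under f_t mu. Curvature makes I
   decay like e^(-2 kappa t), and H(s) - H(t) >= (t - s) I(t) for s <= t. The
   local Poincare inequality bounds the mean of the conditional variance of
   ln f_t (X_t) given X_s, as s decreases to 0, by I(t) / kappa; since the
   germ field at time 0 is trivial, this gives V <= I / kappa. The same zero-one
   law forces f_t -> 1, so that H <= I / (2 kappa). As long as TV <= 1 - eps, the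
   overlap of the two measures gives eps H <= 1 + sqrt V, so u = eps H - 1
   satisfies the Riccati inequality u' <= - kappa eps u^2 and drops to 1 within
   time 2 / (kappa eps). From there on, exponential decay of H and Pinsker's
   inequality bring TV below eps. *)

(** * Integrals and L^2 *)

(** The chain rule and the curvature criterion are given for f_t and ln f_t alone, so the decay of I
    is not obtained by differentiating I. It comes from duality: I(s + t) is the pairing of - L f_t
    with P_s ln f_(s+t), and comparing the logarithmic with the arithmetic mean bounds this pairing
    by energies weighted by f_t, an inequality valid for every symmetric Markov kernel. The chain
    rule only serves to identify I(t) with the integral of f_t Gamma(ln f_t). Regularity in time is
    the other obstacle: neither H(t) nor the pairing of f_(t-s) with (P_s ln f_t)^2 is known to be
    differentiable. Convexity bounds their increments from one side by pairings with the generator,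
    and Dini derivatives integrate these bounds. Fourth moments, which come from the squares being
    in the domain, give a meaning to the products involved. No density is given at time 0, so the
    initial point enters only through the limit of a martingale as time decreases to 0. *)

Definition intg d (T : measurableType d) (R : realType)
  (m : {measure set T -> \bar R}) (u : T -> R) := m.-integrable setT (EFin \o u).

Section real_integrals.
Context d (T : measurableType d) (R : realType).
Variable m : {measure set T -> \bar R}.
Implicit Types u v : T -> R.

Lemma intg_meas u : intg m u -> measurable_fun setT u.
Proof. by move=> /measurable_int/measurable_EFinP. Qed.

Lemma intgD u v : intg m u -> intg m v -> intg m (fun x => u x + v x).
Proof.
move=> iu iv; rewrite /intg (_ : _ \o _ = (EFin \o u) \+ (EFin \o v))%E //.
exact: integrableD.
Qed.

Lemma intgZ c u : intg m u -> intg m (fun x => c * u x).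
Proof.
move=> iu; rewrite /intg (_ : _ \o _ = (fun x => c%:E * (EFin \o u) x))%E //.
exact: integrableZl.
Qed.

Lemma intgB u v : intg m u -> intg m v -> intg m (fun x => u x - v x).
Proof.
move=> iu iv; rewrite /intg (_ : _ \o _ = (EFin \o u) \- (EFin \o v))%E //.
exact: integrableB.
Qed.

Lemma le_intg u v : measurable_fun setT u -> (forall x, `|u x| <= v x) ->
  intg m v -> intg m u.
Proof.
move=> mu uv; apply: le_integrable => //; first exact/measurable_EFinP.
by move=> x _ /=; rewrite lee_fin (le_trans (uv x))// ler_norm.
Qed.

Lemma intg_norm u : intg m u -> intg m (fun x => `|u x|).
Proof. exact: integrable_norm. Qed.

Lemma RintD u v : intg m u -> intg m v ->
  \int[m]_x (u x + v x) = \int[m]_x u x + \int[m]_x v x.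
Proof. by move=> *; rewrite RintegralD. Qed.

Lemma RintB u v : intg m u -> intg m v ->
  \int[m]_x (u x - v x) = \int[m]_x u x - \int[m]_x v x.
Proof. by move=> *; rewrite RintegralB. Qed.

Lemma RintZ c u : intg m u -> \int[m]_x (c * u x) = c * \int[m]_x u x.
Proof. by move=> *; rewrite RintegralZl. Qed.

Lemma EFin_Rint u : intg m u -> (\int[m]_x u x)%:E = (\int[m]_x (u x)%:E)%E.
Proof. by move=> iu; rewrite /Rintegral fineK// integrable_fin_num. Qed.

Lemma ae_Rint_eq u v : measurable_fun setT u -> measurable_fun setT v ->
  u = v %[ae m] -> \int[m]_x u x = \int[m]_x v x.
Proof.
move=> mu mv uv; congr fine; apply: ae_eq_integral => //.
- exact/measurable_EFinP.
- exact/measurable_EFinP.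
- exact: ae_eq_comp.
Qed.

Lemma ae_intg u v : measurable_fun setT v -> u = v %[ae m] ->
  intg m u -> intg m v.
Proof.
move=> mv uv /integrableP[/measurable_EFinP mu iu]; apply/integrableP; split.
  exact/measurable_EFinP.
rewrite -(ge0_ae_eq_integral (f := abse \o (EFin \o u)))//.
- by do 2! apply: measurableT_comp => //.
- by do 2! apply: measurableT_comp => //.
- by move=> x _; exact: abse_ge0.
- by apply: ae_eq_comp; exact: ae_eq_comp uv.
Qed.

Lemma ae_Rint_ge0 u : measurable_fun setT u ->
  {ae m, forall x, 0 <= u x} -> 0 <= \int[m]_x u x.
Proof.
move=> mu u0; rewrite (@ae_Rint_eq u (fun x => `|u x|))//.
- by apply: Rintegral_ge0.
- exact: measurableT_comp.
- by apply: filterS u0 => x /= u0 _; rewrite ger0_norm.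
Qed.

Lemma ae_Rint_le u v : intg m u -> intg m v ->
  {ae m, forall x, u x <= v x} -> \int[m]_x u x <= \int[m]_x v x.
Proof.
move=> iu iv uv; rewrite -subr_ge0 -RintB//; apply: ae_Rint_ge0.
  exact: intg_meas (intgB iv iu).
by apply: filterS uv => x; rewrite subr_ge0.
Qed.

Lemma Rint_le u v : intg m u -> intg m v ->
  (forall x, u x <= v x) -> \int[m]_x u x <= \int[m]_x v x.
Proof. by move=> iu iv uv; apply: ae_Rint_le => //; apply: aeW. Qed.

(** A list of pairs (coefficient, function) encodes a linear combination: a pointwise inequality
    with many terms is then integrated in one step, the side conditions being the integrability of
    each term. *)
Definition all_intg (s : seq (R * (T -> R))) :=
  foldr (fun p P => intg m p.2 /\ P) True s.

Lemma intg_lin s : all_intg s -> intg m (fun x => \sum_(p <- s) p.1 * p.2 x).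
Proof.
elim: s => [_|[c u] s ih /= [iu /ih {}ih]].
  under [X in intg m X]eq_fun do rewrite big_nil.
  exact: integrable0.
under [X in intg m X]eq_fun do rewrite big_cons.
by apply: intgD => //; apply: intgZ.
Qed.

Lemma Rint_lin s : all_intg s ->
  \int[m]_x (\sum_(p <- s) p.1 * p.2 x) = \sum_(p <- s) p.1 * \int[m]_x p.2 x.
Proof.
elim: s => [_|[c u] s ih /= [iu /[dup] /intg_lin is' /ih {}ih]].
  rewrite big_nil; under eq_Rintegral do rewrite big_nil.
  by rewrite Rintegral_cst// mul0r.
rewrite big_cons; under eq_Rintegral do rewrite big_cons.
by rewrite RintD ?RintZ ?ih//=; exact: intgZ.
Qed.

Lemma Rint_lin_ge0 s : all_intg s ->
  {ae m, forall x, 0 <= \sum_(p <- s) p.1 * p.2 x} ->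
  0 <= \sum_(p <- s) p.1 * \int[m]_x p.2 x.
Proof.
move=> is' s0; rewrite -Rint_lin//; apply: ae_Rint_ge0 => //.
exact: intg_meas (intg_lin is').
Qed.

Lemma Rint_eq0 u : measurable_fun setT u -> (forall x, 0 <= u x) ->
  intg m u -> \int[m]_x u x = 0 -> u = cst 0 %[ae m].
Proof.
move=> mu u0 iu iu0; have h : (\int[m]_x `|(u x)%:E|)%E = 0%E.
  under eq_integral do rewrite gee0_abs ?lee_fin//.
  by rewrite -EFin_Rint// iu0.
have mu' : measurable_fun setT (EFin \o u) by exact/measurable_EFinP.
have := (ae_eq_integral_abs m measurableT mu').1 h.
by apply: filterS => x /= + _ => /(_ Logic.I) [].
Qed.

Lemma Rint_indic_ae u v : intg m u -> intg m v ->
  (forall A, measurable A ->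
    \int[m]_x (\1_A x * u x) = \int[m]_x (\1_A x * v x)) -> u = v %[ae m].
Proof.
move=> iu iv uv.
have h : ae_eq m setT (EFin \o u) (EFin \o v).
  apply: integral_ae_eq => //.
    by apply/measurable_EFinP/intg_meas.
  move=> A _ mA.
  have e w : intg m w -> (\int[m]_(x in A) (EFin \o w) x)%E =
      (\int[m]_x (\1_A x * w x))%:E.
    move=> iw; have : intg m (fun x => \1_A x * w x).
      apply: (le_intg _ _ (intg_norm iw)).
        by apply: measurable_funM => //; exact: intg_meas.
      move=> x; rewrite normrM indicE; case: (_ \in _) => /=.
        by rewrite normr1 mul1r.
      by rewrite normr0 mul0r.
    move=> /EFin_Rint ->; rewrite integral_mkcond; apply: eq_integral => x _.
    rewrite patchE indicE; case: (_ \in _) => /=; first by rewrite mul1r.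
    by rewrite mul0r.
  by rewrite !e// uv.
by apply: filterS h => x /= + _ => /(_ Logic.I) [].
Qed.

Lemma Rint_indic_ge0 u : intg m u ->
  (forall A, measurable A -> 0 <= \int[m]_x (\1_A x * u x)) ->
  {ae m, forall x, 0 <= u x}.
Proof.
move=> iu u0.
(* On this set the hypothesis forces the integral of the negative part [v] of [u] to vanish. *)
pose A := [set x | u x < 0].
have mA : measurable A.
  rewrite (_ : A = u @^-1` `]-oo, 0[).
    by rewrite -[X in measurable X]setTI; apply: (intg_meas iu).
  by apply/seteqP; split => x; rewrite /A/= in_itv/=.
pose v x := - (\1_A x * u x).
have v0 x : 0 <= v x.
  rewrite /v indicE; case: (boolP (_ \in _)) => /=.
    by rewrite inE /A /= => ux; rewrite mul1r oppr_ge0 ltW.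
  by rewrite mul0r oppr0.
have iv : intg m v.
  apply: (le_intg _ _ (intg_norm iu)).
    apply: measurableT_comp => //.
    by apply: measurable_funM => //; exact: intg_meas.
  move=> x; rewrite normrN normrM indicE; case: (_ \in _) => /=.
    by rewrite normr1 mul1r.
  by rewrite normr0 mul0r.
have iv0 : \int[m]_x v x = 0.
  apply/eqP; rewrite eq_le Rintegral_ge0// andbT.
  rewrite -oppr_ge0 -mulN1r -RintZ//.
  rewrite (_ : (fun x => _) = (fun x => \1_A x * u x)); first exact: u0.
  by apply/funext => x; rewrite mulN1r /v opprK.
have := Rint_eq0 (intg_meas iv) v0 iv iv0.
apply: filterS => x /= /(_ Logic.I); rewrite /v indicE.
case: (boolP (_ \in _)) => /=; last by rewrite notin_setE /A /= => /negP; rewrite -leNgt.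
by rewrite mul1r => _ /eqP; rewrite oppr_eq0 => /eqP ->.
Qed.

End real_integrals.

Section L2.
Context d (T : measurableType d) (R : realType).
Variable m : probability T R.
Implicit Types u v w : T -> R.

Notation L2 := (Lfun m 2%:E).

Definition ip u v := \int[m]_x (u x * v x).
Definition nrm u := Num.sqrt (ip u u).

Lemma intg_cst (c : R) : intg m (fun=> c).
Proof. exact: finite_measure_integrable_cst. Qed.

Lemma Rint_cst (c : R) : \int[m]_x c = c.
Proof. by rewrite Rintegral_cst//= -[X in fine X]/(m setT) probability_setT mulr1. Qed.

Lemma L2_meas u : u \in L2 -> measurable_fun setT u.
Proof. by rewrite inE => /andP[]; rewrite inE. Qed.

Lemma L2P u : u \in L2 <-> measurable_fun setT u /\ intg m (fun x => u x * u x).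
Proof.
split => [uL|[mu iu]].
  split; first exact: L2_meas.
  by have := Lfun2_integrable_sqr uL.
rewrite inE; apply/andP; split; first by rewrite inE.
rewrite inE/= /finite_norm unlock poweR_lty//.
under eq_integral => x _ do rewrite /= powR_mulrn// ?normr_ge0//=.
under eq_integral => x _ do rewrite real_normK ?num_real// expr2.
exact: integrable_lty.
Qed.

Lemma Lnorm2 u : u \in L2 -> 'N[m]_2%:E[EFin \o u]%E = (nrm u)%:E.
Proof.
move=> /L2P[mu iu]; rewrite unlock /=.
under eq_integral => x _ do rewrite /= powR_mulrn// ?normr_ge0//=.
under eq_integral => x _ do rewrite real_normK ?num_real// expr2.
by rewrite -EFin_Rint//= /nrm powR12_sqrt//; apply: Rintegral_ge0 => x _; rewrite -expr2 sqr_ge0.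
Qed.

Lemma L2_intgM u v : u \in L2 -> v \in L2 -> intg m (fun x => u x * v x).
Proof. by move=> uL vL; apply/Lfun1_integrable; exact: Lfun2_mul_Lfun1. Qed.

Lemma L2_cst (c : R) : (fun=> c) \in L2.
Proof. exact: (@Lfun_cst _ _ _ m c 2). Qed.

Lemma L2_intg u : u \in L2 -> intg m u.
Proof.
move=> uL; have := L2_intgM uL (L2_cst 1).
by under [X in intg m X]eq_fun do rewrite mulr1.
Qed.

Lemma L2_lin (c : R) u v : u \in L2 -> v \in L2 -> (fun x => c * u x + v x) \in L2.
Proof. by have [_ h] := Lfun_submod_closed m (lee1n 2); exact: h. Qed.

Lemma L2D u v : u \in L2 -> v \in L2 -> (fun x => u x + v x) \in L2.
Proof.
move=> uL vL; have := L2_lin 1 uL vL.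
by under [X in X \in _]eq_fun do rewrite mul1r.
Qed.

Lemma L2Z (c : R) u : u \in L2 -> (fun x => c * u x) \in L2.
Proof.
move=> uL; have := L2_lin c uL (L2_cst 0).
by under [X in X \in _]eq_fun do rewrite addr0.
Qed.

Lemma L2B u v : u \in L2 -> v \in L2 -> (fun x => u x - v x) \in L2.
Proof.
move=> uL vL; have := L2_lin (-1) vL uL.
by under [X in X \in _]eq_fun do rewrite mulN1r addrC.
Qed.

Lemma L2_le u v : measurable_fun setT u -> (forall x, `|u x| <= `|v x|) ->
  v \in L2 -> u \in L2.
Proof.
move=> mu uv /L2P[mv iv]; apply/L2P; split => //.
apply: (le_intg _ _ iv); first exact: measurable_funM.
by move=> x; rewrite -!expr2 -(real_normK (num_real (v x))) normrX lerXn2r// nnegrE.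
Qed.

Lemma L2_bndM (c : R) u v : measurable_fun setT u -> (forall x, `|u x| <= c) ->
  v \in L2 -> (fun x => u x * v x) \in L2.
Proof.
move=> mu uc vL; apply: (L2_le _ _ (L2Z c vL)).
  by apply: measurable_funM => //; exact: L2_meas.
move=> x; rewrite !normrM ler_wpM2r//.
by rewrite (le_trans (uc x))// ler_norm.
Qed.

Lemma L2_bnd (c : R) u : measurable_fun setT u -> (forall x, `|u x| <= c) ->
  u \in L2.
Proof.
move=> mu uc; have := L2_bndM mu uc (L2_cst 1).
by under [X in X \in _]eq_fun do rewrite mulr1.
Qed.

Lemma L2_indic A : measurable A -> \1_A \in L2.
Proof.
move=> mA; apply: (@L2_bnd 1) => // x; rewrite indicE.
by case: (_ \in _); rewrite ?normr1 ?normr0.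
Qed.

Lemma L2_indicM A u : measurable A -> u \in L2 -> (fun x => \1_A x * u x) \in L2.
Proof.
move=> mA; apply: (@L2_bndM 1) => // x; rewrite indicE.
by case: (_ \in _); rewrite ?normr1 ?normr0.
Qed.

Lemma L2_ae u v : measurable_fun setT v -> u = v %[ae m] -> u \in L2 -> v \in L2.
Proof.
move=> mv uv /L2P[mu iu]; apply/L2P; split => //.
apply: (ae_intg _ _ iu); first exact: measurable_funM.
by apply: filterS uv => x /= + _ => /(_ Logic.I) ->.
Qed.

(** From [|u v| <= u^2 + v^2]. Finite fourth moments replace boundedness when a product has to be in
    L^2. *)
Lemma L2_prod u v : measurable_fun setT u -> measurable_fun setT v ->
  (fun x => u x * u x) \in L2 -> (fun x => v x * v x) \in L2 ->
  (fun x => u x * v x) \in L2.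
Proof.
move=> mu mv uL vL; apply: (L2_le _ _ (L2D uL vL)).
  exact: measurable_funM.
move=> x; rewrite [leRHS]ger0_norm; last by rewrite addr_ge0// -expr2 sqr_ge0.
rewrite ler_norml; apply/andP; split; nra.
Qed.

Lemma ip_ge0 u : 0 <= ip u u.
Proof. by apply: Rintegral_ge0 => x _; rewrite -expr2 sqr_ge0. Qed.

Lemma nrm_ge0 u : 0 <= nrm u.
Proof. exact: sqrtr_ge0. Qed.

Lemma nrm_sqr u : nrm u ^+ 2 = ip u u.
Proof. by rewrite sqr_sqrtr// ip_ge0. Qed.

Lemma ipC u v : ip u v = ip v u.
Proof. by apply: eq_Rintegral => x _; rewrite mulrC. Qed.

Lemma ipDl u v w : u \in L2 -> v \in L2 -> w \in L2 ->
  ip (fun x => u x + v x) w = ip u w + ip v w.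
Proof.
move=> uL vL wL; rewrite -RintD; try exact: L2_intgM.
by apply: eq_Rintegral => x _; rewrite mulrDl.
Qed.

Lemma ipBl u v w : u \in L2 -> v \in L2 -> w \in L2 ->
  ip (fun x => u x - v x) w = ip u w - ip v w.
Proof.
move=> uL vL wL; rewrite -RintB; try exact: L2_intgM.
by apply: eq_Rintegral => x _; rewrite mulrBl.
Qed.

Lemma ipZl c u w : u \in L2 -> w \in L2 ->
  ip (fun x => c * u x) w = c * ip u w.
Proof.
move=> uL wL; rewrite -RintZ; last exact: L2_intgM.
by apply: eq_Rintegral => x _; rewrite mulrA.
Qed.

Lemma ipDr u v w : u \in L2 -> v \in L2 -> w \in L2 ->
  ip w (fun x => u x + v x) = ip w u + ip w v.
Proof. by move=> *; rewrite ipC ipDl// !(ipC w). Qed.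

Lemma ipBr u v w : u \in L2 -> v \in L2 -> w \in L2 ->
  ip w (fun x => u x - v x) = ip w u - ip w v.
Proof. by move=> *; rewrite ipC ipBl// !(ipC w). Qed.

Lemma ipZr c u w : u \in L2 -> w \in L2 ->
  ip w (fun x => c * u x) = c * ip w u.
Proof. by move=> *; rewrite ipC ipZl// !(ipC w). Qed.

Lemma ip_ae u u' v v' : u \in L2 -> u' \in L2 -> v \in L2 -> v' \in L2 ->
  u = u' %[ae m] -> v = v' %[ae m] -> ip u v = ip u' v'.
Proof.
move=> uL u'L vL v'L uu' vv'; apply: ae_Rint_eq.
- by apply: measurable_funM; exact: L2_meas.
- by apply: measurable_funM; exact: L2_meas.
by apply: filterS2 uu' vv' => x /= uu' vv' I; rewrite uu' ?vv'.
Qed.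

Lemma ip_ael u u' v : u \in L2 -> u' \in L2 -> v \in L2 ->
  u = u' %[ae m] -> ip u v = ip u' v.
Proof. by move=> uL u'L vL uu'; apply: ip_ae => //; exact: aeW. Qed.

Lemma nrm_ae u v : u \in L2 -> v \in L2 -> u = v %[ae m] -> nrm u = nrm v.
Proof. by move=> uL vL uv; rewrite /nrm (ip_ae uL vL uL vL). Qed.

Lemma CS u v : u \in L2 -> v \in L2 -> `|ip u v| <= nrm u * nrm v.
Proof.
move=> uL vL; set a := ip u u; set b := ip u v; set c := ip v v.
have q t : 0 <= a + 2 * t * b + t ^+ 2 * c.
  have := ip_ge0 (fun x => u x + t * v x).
  rewrite ipDl ?ipDr ?ipZl ?ipZr//; try by rewrite ?L2D ?L2Z.
  rewrite (ipC v u) -/a -/b -/c; nra.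
have ha : 0 <= a := ip_ge0 u. have hc : 0 <= c := ip_ge0 v.
have : b ^+ 2 <= a * c.
  have [c0|c0] := eqVneq c 0.
    have [b0|b0] := eqVneq b 0; first by rewrite b0 c0 expr0n/= mulr0.
    (* For [c = 0] the polynomial is affine in [t], and this [t] gives it the value -1. *)
    have := q (- (a + 1) / (2 * b)).
    rewrite c0 mulr0 addr0.
    have -> : 2 * (- (a + 1) / (2 * b)) * b = - (a + 1) by field.
    lra.
  have := q (- b / c).
  have -> : a + 2 * (- b / c) * b + (- b / c) ^+ 2 * c = (a * c - b ^+ 2) / c.
    by field.
  by rewrite pmulr_lge0 ?invr_gt0 ?lt_def ?c0// subr_ge0.
by move=> h; rewrite -sqrtr_sqr -sqrtrM// ler_wsqrtr.
Qed.

Lemma nrmZ c u : u \in L2 -> nrm (fun x => c * u x) = `|c| * nrm u.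
Proof.
move=> uL; rewrite /nrm ipZl ?ipZr ?L2Z// mulrA -expr2 sqrtrM ?sqr_ge0//.
by rewrite sqrtr_sqr.
Qed.

Lemma nrmD u v : u \in L2 -> v \in L2 -> nrm (fun x => u x + v x) <= nrm u + nrm v.
Proof.
move=> uL vL; rewrite -(@ler_pXn2r _ 2)// ?nnegrE ?addr_ge0 ?nrm_ge0//.
rewrite sqrrD !nrm_sqr ipDl ?ipDr ?L2D//.
have := CS uL vL; rewrite ler_norml (ipC v u) => /andP[_]; lra.
Qed.

Lemma nrm_subrr u : nrm (fun x => u x - u x) = 0.
Proof.
rewrite /nrm /ip; under eq_Rintegral do rewrite subrr mulr0.
by rewrite Rint_cst sqrtr0.
Qed.

Lemma nrmBC u v : nrm (fun x => u x - v x) = nrm (fun x => v x - u x).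
Proof.
by congr Num.sqrt; apply: eq_Rintegral => x _; rewrite -[LHS]mulrNN !opprB.
Qed.

Lemma nrmB u v : u \in L2 -> v \in L2 -> nrm (fun x => u x - v x) <= nrm u + nrm v.
Proof.
move=> uL vL; have := nrmD uL (L2Z (-1) vL).
rewrite nrmZ// normrN1 mul1r.
by under [X in nrm X]eq_fun do rewrite mulN1r.
Qed.

Lemma nrm_tri u v w : u \in L2 -> v \in L2 -> w \in L2 ->
  nrm (fun x => u x - w x) <= nrm (fun x => u x - v x) + nrm (fun x => v x - w x).
Proof.
move=> uL vL wL; have := nrmD (L2B uL vL) (L2B vL wL).
by under [X in nrm X <= _]eq_fun do rewrite addrA subrK.
Qed.

Lemma nrm1 : nrm (fun=> 1) = 1.
Proof. by rewrite /nrm /ip Rint_cst mulr1 sqrtr1. Qed.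

Lemma Rint_norm_le_nrm u : u \in L2 -> \int[m]_x `|u x| <= nrm u.
Proof.
move=> uL; have nL : (fun x => `|u x|) \in L2.
  apply: (L2_le _ _ uL); first by apply: measurableT_comp => //; exact: L2_meas.
  by move=> x; rewrite normr_id.
have := CS nL (L2_cst 1); rewrite nrm1 mulr1.
have -> : nrm (fun x => `|u x|) = nrm u.
  by congr Num.sqrt; apply: eq_Rintegral => x _; rewrite -normrM ger0_norm// -expr2 sqr_ge0.
apply: le_trans; rewrite /ip; under [X in `|X|]eq_Rintegral do rewrite mulr1.
exact: ler_norm.
Qed.

Lemma nrm_le u v : u \in L2 -> v \in L2 -> {ae m, forall x, `|u x| <= `|v x|} ->
  nrm u <= nrm v.
Proof.
move=> uL vL uv; apply: ler_wsqrtr; apply: ae_Rint_le; try exact: L2_intgM.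
apply: filterS uv => x uv; rewrite -!expr2 -[leLHS]real_normK ?num_real//.
by rewrite -[leRHS]real_normK ?num_real// lerXn2r// nnegrE.
Qed.

Lemma Rint_norm_prod u v : u \in L2 -> v \in L2 ->
  \int[m]_x `|u x * v x| <= nrm u * nrm v.
Proof.
move=> uL vL.
have aL w : w \in L2 -> (fun x => `|w x|) \in L2.
  move=> wL; apply: (L2_le _ _ wL) => [|x]; last by rewrite normr_id.
  by apply: measurableT_comp => //; exact: L2_meas wL.
have na w : nrm (fun x => `|w x|) = nrm w.
  by congr Num.sqrt; apply: eq_Rintegral => x _; rewrite -normrM ger0_norm// -expr2 sqr_ge0.
have := CS (aL _ uL) (aL _ vL); rewrite !na; apply: le_trans.
under eq_Rintegral do rewrite normrM.
exact: ler_norm.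
Qed.

Lemma nrm_prod u v : measurable_fun setT u -> measurable_fun setT v ->
  (fun x => u x * u x) \in L2 -> (fun x => v x * v x) \in L2 ->
  nrm (fun x => u x * v x) <=
  Num.sqrt (nrm (fun x => u x * u x) * nrm (fun x => v x * v x)).
Proof.
move=> mu mv u2 v2; apply: ler_wsqrtr.
have -> : ip (fun x => u x * v x) (fun x => u x * v x) =
    ip (fun x => u x * u x) (fun x => v x * v x).
  by apply: eq_Rintegral => x _; rewrite mulrACA.
by apply: le_trans (CS u2 v2); exact: ler_norm.
Qed.

End L2.

(** * Monotone convergence and integration against mixtures of kernels *)

Lemma mct_cvg d (X : measurableType d) (R : realType) (m : {measure set X -> \bar R})
    (g : (X -> \bar R)^nat) (f : X -> \bar R) :
  (forall n, measurable_fun setT (g n)) -> (forall n x, (0 <= g n x)%E) ->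
  (forall x, {homo g ^~ x : a b / (a <= b)%N >-> (a <= b)%E}) ->
  (forall x, g n x @[n --> \oo] --> f x) ->
  (\int[m]_x g n x)%E @[n --> \oo] --> (\int[m]_x f x)%E.
Proof.
move=> mg g0 ndg gf.
have -> : f = fun x => limn (g ^~ x).
  by apply/funext => x; apply/esym/cvg_lim.
by apply: cvg_monotone_convergence => // x _; exact: ndg.
Qed.

Section mixture.
Local Open Scope ereal_scope.
Context d (X : measurableType d) d' (Y : measurableType d') (R : realType).
Variables (l : {measure set X -> \bar R}) (k : X -> {measure set Y -> \bar R}).
Variables (rho : X -> R) (nu : {measure set Y -> \bar R}).
Hypothesis mk : forall U, measurable U -> measurable_fun setT (k ^~ U).
Hypothesis rho0 : forall x, (0 <= rho x)%R.
Hypothesis mrho : measurable_fun setT rho.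
Hypothesis nuE : forall U, measurable U -> nu U = \int[l]_x ((rho x)%:E * k x U).

Import HBNNSimple.

Let ge0_integral_mixture_nnsfun (f : {nnsfun Y >-> R}) :
  \int[nu]_z (f z)%:E = \int[l]_x ((rho x)%:E * \int[k x]_z (f z)%:E).
Proof.
have mrho' : measurable_fun setT (EFin \o rho) by exact/measurable_EFinP.
under [in LHS]eq_integral do rewrite fimfunE -fsumEFin//.
rewrite ge0_integral_fsum//; last 2 first.
  - by move=> r; exact/measurable_EFinP/measurableT_comp.
  - by move=> r z _; rewrite EFinM nnfun_muleindic_ge0.
under [in RHS]eq_integral.
  move=> y _.
  under eq_integral.
    by move=> z _; rewrite fimfunE -fsumEFin//; over.
  rewrite /= ge0_integral_fsum//; last 2 first.
    - by move=> r; exact/measurable_EFinP/measurableT_comp.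
    - by move=> r z _; rewrite EFinM nnfun_muleindic_ge0.
  rewrite ge0_mule_fsumr; last first.
    move=> r; apply: integral_ge0 => z _; rewrite EFinM.
    exact: nnfun_muleindic_ge0.
  under eq_fsbigr.
    move=> r _.
    rewrite (integralZl_indic _ (fun r => f @^-1` [set r]))//; last first.
      by move=> r0; rewrite preimage_nnfun0.
    rewrite integral_indic// setIT muleCA.
    over.
  over.
rewrite /= ge0_integral_fsum//; last 2 first.
  - move=> r; apply: measurable_funeM; apply: emeasurable_funM => //.
    exact: mk.
  - move=> n y _; rewrite muleCA mule_ge0 ?lee_fin//.
    have := mulemu_ge0 (fun n => f @^-1` [set n]).
    by apply; exact: preimage_nnfun0.
apply: eq_fsbigr => r _.
rewrite (integralZl_indic _ (fun r => f @^-1` [set r]))//; last first.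
  exact: preimage_nnfun0.
rewrite /= integral_indic// setIT.
have [r0|r0] := leP 0%R r.
  rewrite ge0_integralZl//.
  - by rewrite nuE.
  - by apply: emeasurable_funM => //; exact: mk.
  - by move=> x _; rewrite mule_ge0 ?lee_fin.
rewrite integral0_eq.
  by rewrite preimage_nnfun0// measure0 mule0.
by move=> y _; rewrite preimage_nnfun0// measure0 !mule0.
Qed.

(** Simple functions first, then monotone convergence. This one formula covers invariance
    ([k = P_t]), densities and independence at time 0 (Dirac masses), and the joint law at two times
    (image measures). *)
Lemma ge0_integral_mixture (f : Y -> \bar R) : (forall z, 0 <= f z) ->
  measurable_fun setT f ->
  \int[nu]_z f z = \int[l]_x ((rho x)%:E * \int[k x]_z f z).
Proof.
move=> f0 mf.
have mrho' : measurable_fun setT (EFin \o rho) by exact/measurable_EFinP.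
pose f_ := nnsfun_approx measurableT mf.
have ndf_ z : {homo (fun n => (f_ n z)%:E) : a b / (a <= b)%N >-> a <= b}.
  by move=> a b ab; rewrite lee_fin; exact/lefP/nd_nnsfun_approx.
have cf_ x : \int[k x]_z (f_ n z)%:E @[n --> \oo] --> \int[k x]_z f z.
  apply: mct_cvg => //.
  - by move=> n; exact/measurable_EFinP.
  - by move=> n z; rewrite lee_fin.
  - by move=> z; exact: cvg_nnsfun_approx.
have ndk x : {homo (fun n => \int[k x]_z (f_ n z)%:E) : a b / (a <= b)%N >-> a <= b}.
  move=> a b ab; apply: ge0_le_integral => //.
  - by move=> z _; rewrite lee_fin.
  - exact/measurable_EFinP.
  - exact/measurable_EFinP.
  - by move=> z _; exact: ndf_.
apply: (@cvg_unique _ _ (\int[nu]_z (f_ n z)%:E @[n --> \oo])) => //.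
  apply: mct_cvg => //.
  - by move=> n; exact/measurable_EFinP.
  - by move=> n z; rewrite lee_fin.
  - by move=> z; exact: cvg_nnsfun_approx.
rewrite (_ : (fun n => _) = fun n => \int[l]_x ((rho x)%:E * \int[k x]_z (f_ n z)%:E)); last first.
  by apply/funext => n; exact: ge0_integral_mixture_nnsfun.
apply: mct_cvg => //.
- move=> n; apply: emeasurable_funM => //.
  apply: measurable_fun_integral_kernel => //.
    by move=> z; rewrite lee_fin.
  exact/measurable_EFinP.
- by move=> n x; rewrite mule_ge0 ?lee_fin// integral_ge0// => z _; rewrite lee_fin.
- by move=> x a b ab; rewrite lee_wpmul2l ?lee_fin// ndk.
- by move=> x; apply: cvgeZl.
Qed.

End mixture.

Section density.
Local Open Scope ereal_scope.
Context d (X : measurableType d) (R : realType).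
Variables (l nu : {measure set X -> \bar R}) (f : X -> R).
Hypothesis f0 : forall x, (0 <= f x)%R.
Hypothesis mf : measurable_fun setT f.
Hypothesis nuE : forall U, measurable U -> nu U = \int[l]_(x in U) (f x)%:E.

Lemma ge0_integral_density (u : X -> \bar R) : (forall z, 0 <= u z) ->
  measurable_fun setT u -> \int[nu]_z u z = \int[l]_x ((f x)%:E * u x).
Proof.
move=> u0 mu.
rewrite (@ge0_integral_mixture _ _ _ _ _ l (fun x => \d_x : {measure set X -> \bar R}) f nu)//.
- by apply: eq_integral => x _; rewrite integral_dirac// diracT mul1e.
- by move=> U mU; apply/measurable_EFinP; apply: measurable_indic.
- move=> U mU; rewrite nuE// integral_mkcond; apply: eq_integral => x _.
  rewrite patchE /= /dirac indicE; case: (_ \in _); first by rewrite mule1.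
  by rewrite mule0.
Qed.

End density.

(** * Symmetric Markov semigroups *)

Section semigroup.
Context d (E : measurableType d) (R : realType).
Variables (mu : probability E R) (P : R -> R.-pker E ~> E).
Hypothesis hP : markov_semigroup mu P.
Implicit Types (u v w f g : E -> R) (t r : R).

Notation L2 := (Lfun mu 2%:E).
Notation ip := (ip mu).
Notation nrm := (nrm mu).

Lemma sgop_meas t u : measurable_fun setT u -> measurable_fun setT (sgop P t u).
Proof.
move=> mu'; apply: measurableT_comp => //.
under [X in measurable_fun _ X]eq_fun do rewrite integralE.
by apply: emeasurable_funB; apply: measurable_fun_integral_kernel => //;
  first [exact: measurable_kernel | apply: measurable_funepos; exact/measurable_EFinP
  | apply: measurable_funeneg; exact/measurable_EFinP].
Qed.

Lemma sgop_indic t A y : measurable A -> sgop P t \1_A y = fine (P t y A).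
Proof. by move=> mA; rewrite /sgop /Rintegral integral_indic// setIT. Qed.

Lemma P_setT t y : P t y setT = 1%E.
Proof. exact: prob_kernel. Qed.

Lemma sgop_cst t c : sgop P t (fun=> c) = fun=> c.
Proof.
apply/funext => y; rewrite /sgop Rintegral_cst//.
by rewrite -[X in fine X]/(P t y setT) P_setT mulr1.
Qed.

Lemma P_intg_cst t y c : intg (P t y) (fun=> c).
Proof.
apply/integrableP; split; first exact: measurable_cst.
by under eq_integral do rewrite /=; rewrite integral_cst// -[X in (_ * X)%E]/(P t y setT) P_setT mule1 ltry.
Qed.

Lemma P_fin t y A : measurable A -> P t y A \is a fin_num.
Proof.
move=> mA; rewrite ge0_fin_numE// (le_lt_trans (y := 1%E)) ?ltry//.
by rewrite -(P_setT t y) le_measure ?inE.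
Qed.

(** Self-adjointness tested against the constant 1, together with [P_t 1 = 1], makes [mu]
    invariant. *)
Lemma inv_meas t A : 0 <= t -> measurable A -> (\int[mu]_y P t y A)%E = mu A.
Proof.
move=> t0 mA.
have := sgop_selfadjoint hP t0 (L2_cst mu 1) (L2_indic mu mA).
rewrite sgop_cst; under eq_Rintegral do rewrite mul1r sgop_indic//.
under [RHS]eq_Rintegral do rewrite mul1r.
move=> h; transitivity (\int[mu]_y fine (P t y A))%:E.
  rewrite EFin_Rint.
    by apply: eq_integral => y _; rewrite fineK// P_fin.
  apply: L2_intg; apply: (@L2_bnd _ _ _ _ 1).
    by apply: measurableT_comp => //; exact: measurable_kernel.
  move=> y; rewrite ger0_norm ?fine_ge0// -lee_fin fineK ?P_fin//.
  by rewrite -(P_setT t y) le_measure ?inE.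
rewrite h EFin_Rint; last by apply: L2_intg; exact: L2_indic.
by rewrite integral_indic// setIT.
Qed.

Lemma inv_ge0 t (F : E -> \bar R) : 0 <= t -> (forall y, 0 <= F y)%E ->
  measurable_fun setT F -> (\int[mu]_y \int[P t y]_z F z = \int[mu]_y F y)%E.
Proof.
move=> t0 F0 mF.
rewrite [RHS](@ge0_integral_mixture _ _ _ _ _ mu (fun y => P t y) (cst 1))//.
- by apply: eq_integral => y _; rewrite mul1e.
- by move=> U mU; exact: measurable_kernel.
- move=> U mU; transitivity (\int[mu]_y P t y U)%E; first exact/esym/inv_meas.
  by apply: eq_integral => y _; rewrite mul1e.
Qed.

(** A null set of [mu] may be charged by [P_t(y, .)] for exceptional [y]; by invariance these [y]
    form a null set. *)
Lemma ae_push t (Q : E -> Prop) : 0 <= t -> {ae mu, forall z, Q z} ->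
  {ae mu, forall y, {ae P t y, forall z, Q z}}.
Proof.
move=> t0 [N [mN N0 QN]].
have : (\int[mu]_y `|P t y N|)%E = 0%E.
  rewrite -N0 -(inv_meas t0 mN); apply: eq_integral => y _.
  by rewrite gee0_abs.
move/(ae_eq_integral_abs mu measurableT (measurable_kernel (P t) _ mN)).1.
by apply: filterS => y /= /(_ Logic.I) yN; exists N.
Qed.

Lemma ae_intgP t u : 0 <= t -> intg mu u -> {ae mu, forall y, intg (P t y) u}.
Proof.
move=> t0 /integrableP[mu' iu].
have mu2 : measurable_fun setT (fun z => `|(EFin \o u) z|%E).
  exact: measurableT_comp.
have : mu.-integrable setT (fun y => \int[P t y]_z `|(EFin \o u) z|)%E.
  apply/integrableP; split.
    by apply: measurable_fun_integral_kernel => // U mU; exact: measurable_kernel.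
  under eq_integral do rewrite gee0_abs ?integral_ge0//.
  by rewrite inv_ge0.
move/integrable_ae => /(_ measurableT); apply: filterS => y /= /(_ Logic.I) fy.
by apply/integrableP; split => //; rewrite -ge0_fin_numE// integral_ge0.
Qed.

Lemma intg_sgop t u : 0 <= t -> intg mu u -> intg mu (sgop P t u).
Proof.
move=> t0 iu; have /integrableP[mu' iu'] := iu.
have mu2 : measurable_fun setT (fun z => `|(EFin \o u) z|%E).
  exact: measurableT_comp.
apply/integrableP; split.
  by apply/measurable_EFinP; apply: sgop_meas; exact: intg_meas iu.
apply: le_lt_trans iu'; rewrite -[leRHS](inv_ge0 t0)//.
have mk : measurable_fun setT (fun y => \int[P t y]_z `|(EFin \o u) z|)%E.
  by apply: measurable_fun_integral_kernel => // U mU; exact: measurable_kernel.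
apply: ae_ge0_le_integral => //.
- by apply: measurableT_comp => //; apply/measurable_EFinP/sgop_meas/intg_meas/iu.
- by move=> y _; exact: integral_ge0.
apply: filterS (ae_intgP t0 iu) => y iy _ /=.
by rewrite -/(sgop P t u y) /sgop -abse_EFin EFin_Rint//; apply: le_abse_integral => //.
Qed.

Definition all_intg2 (s : seq ((E -> R) * (E -> R))) :=
  foldr (fun p Q => intg mu p.2 /\ Q) True s.

Let freeze y (s : seq ((E -> R) * (E -> R))) := [seq (p.1 y, p.2) | p <- s].

Let ae_all_intg t s : 0 <= t -> all_intg2 s ->
  {ae mu, forall y, all_intg (P t y) (freeze y s)}.
Proof.
move=> t0; elim: s => [_|[a u] s ih [iu /ih {}ih]]; first exact: aeW.
by apply: filterS2 (ae_intgP t0 iu) ih => y.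
Qed.

(* The list s stands for the sum of the products u(y) v(z), (u, v) in s; a
   pointwise inequality between such sums is integrated against P_t(y, dz). *)
Lemma sgop_ge0 t (Q : E -> Prop) (s : seq ((E -> R) * (E -> R))) :
  0 <= t -> {ae mu, forall z, Q z} -> all_intg2 s ->
  (forall y z, Q y -> Q z -> 0 <= \sum_(p <- s) p.1 y * p.2 z) ->
  {ae mu, forall y, 0 <= \sum_(p <- s) p.1 y * sgop P t p.2 y}.
Proof.
move=> t0 hQ is' pos.
apply: filterS3 hQ (ae_push t0 hQ) (ae_all_intg t0 is') => y Qy Qz iy.
have := Rint_lin_ge0 iy; rewrite big_map; apply.
by apply: filterS Qz => z Qz; rewrite big_map; exact: pos.
Qed.

Lemma sgop_le t u v : 0 <= t -> intg mu u -> intg mu v ->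
  {ae mu, forall z, u z <= v z} -> {ae mu, forall y, sgop P t u y <= sgop P t v y}.
Proof.
move=> t0 iu iv uv.
have := @sgop_ge0 t _ [:: (fun=> 1, v); (fun=> -1, u)] t0 uv.
move=> /(_ (conj iv (conj iu Logic.I))) h.
apply: filterS (h _).
  by move=> y; rewrite !big_cons big_nil/=; lra.
by move=> y z _ uvz; rewrite !big_cons big_nil/=; lra.
Qed.

Lemma sgop_ae t u v : 0 <= t -> intg mu u -> intg mu v ->
  u = v %[ae mu] -> sgop P t u = sgop P t v %[ae mu].
Proof.
move=> t0 iu iv uv.
have h1 : {ae mu, forall y, sgop P t u y <= sgop P t v y}.
  by apply: sgop_le => //; apply: filterS uv => y /(_ Logic.I) ->.
have h2 : {ae mu, forall y, sgop P t v y <= sgop P t u y}.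
  by apply: sgop_le => //; apply: filterS uv => y /(_ Logic.I) ->.
by apply: filterS2 h1 h2 => y a b _; apply/eqP; rewrite eq_le a b.
Qed.

Lemma sgopB t u v : 0 <= t -> intg mu u -> intg mu v ->
  sgop P t (fun x => u x - v x) =
  (fun x => sgop P t u x - sgop P t v x) %[ae mu].
Proof.
move=> t0 iu iv; apply: filterS2 (ae_intgP t0 iu) (ae_intgP t0 iv) => y iuy ivy _.
by rewrite /sgop RintB.
Qed.

Let Rint_sgop_ge0 t u : 0 <= t -> intg mu u -> (forall y, 0 <= u y) ->
  \int[mu]_y sgop P t u y = \int[mu]_y u y.
Proof.
move=> t0 iu u0; apply: EFin_inj; rewrite !EFin_Rint//; last exact: intg_sgop.
have mu' : measurable_fun setT (EFin \o u) by apply/measurable_EFinP; exact: intg_meas iu.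
rewrite -[RHS](@inv_ge0 t)//.
apply: ae_eq_integral => //.
- by apply/measurable_EFinP/sgop_meas/intg_meas/iu.
- apply: measurable_fun_integral_kernel => //.
  by move=> U mU; exact: measurable_kernel.
- by apply: filterS (ae_intgP t0 iu) => y iy _; rewrite /sgop EFin_Rint.
Qed.

Lemma Rint_sgop t u : 0 <= t -> intg mu u ->
  \int[mu]_y sgop P t u y = \int[mu]_y u y.
Proof.
move=> t0 iu; have inu := intg_norm iu; have iv := intgD iu inu.
have v0 y : 0 <= u y + `|u y| by rewrite -lerBlDl sub0r -normrN ler_norm.
have -> : sgop P t u = sgop P t (fun y => (u y + `|u y|) - `|u y|).
  by congr sgop; apply/funext => y; rewrite addrK.
transitivity (\int[mu]_y (sgop P t (fun y => (u y + `|u y|)) y - sgop P t (fun y => `|u y|) y)).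
  apply: ae_Rint_eq.
  - by apply: sgop_meas; exact: intg_meas (intgB iv inu).
  - by apply: measurable_funB; apply: sgop_meas; [exact: intg_meas iv|exact: intg_meas inu].
  - exact: sgopB.
rewrite RintB ?Rint_sgop_ge0//; try exact: intg_sgop.
by rewrite RintD// addrK.
Qed.

Lemma L2_sgop t u : 0 <= t -> u \in L2 -> sgop P t u \in L2.
Proof. exact: (sgop_L2 hP). Qed.

Lemma sgop_sqr t u : 0 <= t -> u \in L2 -> {ae mu, forall y,
  sgop P t u y * sgop P t u y <= sgop P t (fun z => u z * u z) y}.
Proof.
move=> t0 uL; have i2 : intg mu (fun z => u z * u z) by exact: L2_intgM.
(* Jensen's inequality: the list expands the square of [u z - P_t u y]. *)
have := @sgop_ge0 t (fun=> True) [:: (fun=> 1, fun z => u z * u z);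
  ((fun y => -2 * sgop P t u y), u); ((fun y => sgop P t u y * sgop P t u y), fun=> 1)].
move=> /(_ t0 (aeW _ (fun=> Logic.I))).
move=> /(_ (conj i2 (conj (L2_intg uL) (conj (intg_cst mu 1) Logic.I)))) h.
apply: filterS (h _).
  by move=> y; rewrite !big_cons big_nil/= sgop_cst; nra.
move=> y z _ _; rewrite !big_cons big_nil/=; have := sqr_ge0 (u z - sgop P t u y).
nra.
Qed.

Lemma nrm_sgop t u : 0 <= t -> u \in L2 -> nrm (sgop P t u) <= nrm u.
Proof.
move=> t0 uL; apply: ler_wsqrtr.
rewrite /ip -(Rint_sgop t0 (L2_intgM uL uL)); apply: ae_Rint_le.
- by apply: L2_intgM; exact: L2_sgop.
- by apply: intg_sgop => //; exact: L2_intgM.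
- exact: sgop_sqr.
Qed.

Lemma ip_sgop t u v : 0 <= t -> u \in L2 -> v \in L2 ->
  ip (sgop P t u) v = ip u (sgop P t v).
Proof. by move=> t0 uL vL; rewrite /ip (sgop_selfadjoint hP). Qed.

(** Contraction in L^4, written with squares: [(P_t u)^2 <= P_t (u^2)] reduces it to the contraction
    in L^2. *)
Lemma L4_sgop t u : 0 <= t -> u \in L2 -> (fun y => u y * u y) \in L2 ->
  (fun y => sgop P t u y * sgop P t u y) \in L2 /\
  nrm (fun y => sgop P t u y * sgop P t u y) <= nrm (fun y => u y * u y).
Proof.
move=> t0 uL u2L; set v := sgop P t u.
have mv : measurable_fun setT v by apply: sgop_meas; exact: L2_meas uL.
have wL : sgop P t (fun y => u y * u y) \in L2 by exact: L2_sgop.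
have vw : {ae mu, forall y, `|v y * v y| <= `|sgop P t (fun y => u y * u y) y|}.
  apply: filterS (sgop_sqr t0 uL) => y; rewrite -/v => vw.
  by rewrite ger0_norm -?expr2 ?sqr_ge0// expr2 (le_trans vw)// ler_norm.
have v2L : (fun y => v y * v y) \in L2.
  (* [L2_le] asks for a bound at every point, Jensen's holds almost everywhere: [v'] is a version of
     [v^2] that is bounded everywhere. *)
  pose v' y := Num.min (v y * v y) `|sgop P t (fun y => u y * u y) y|.
  have mv' : measurable_fun setT v'.
    apply: measurable_minr; first exact: measurable_funM.
    by apply: measurableT_comp => //; exact: L2_meas wL.
  apply: (@L2_ae _ _ _ _ v'); first exact: measurable_funM.
    apply: filterS vw => y vw _; rewrite /v'; apply/min_idPl.
    by rewrite (le_trans _ vw)// ler_norm.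
  apply: (L2_le _ _ wL) => // y; rewrite /v' ger0_norm ?ge_min ?lexx ?orbT//.
  by rewrite le_min normr_ge0 andbT -expr2 sqr_ge0.
split=> //; apply: le_trans (nrm_sgop t0 u2L).
exact: nrm_le.
Qed.

Lemma sgop_cont u : u \in L2 ->
  nrm (fun y => sgop P t u y - u y) @[t --> 0^'+] --> 0.
Proof.
move=> uL; have := sgop_continuous hP uL.
have e : \forall t \near 0^'+,
  'N[mu]_2%:E[EFin \o (sgop P t u \- u)%R]%E = (nrm (fun y => sgop P t u y - u y))%:E.
  apply: filterS (nbhs_right_gt (0 : R)) => t /ltW t0.
  by apply: Lnorm2; apply: L2B => //; exact: L2_sgop.
move=> /(cvg_trans _) H.
have /fine_cvg : (nrm (fun y => sgop P t u y - u y))%:E @[t --> 0^'+] --> 0%:E.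
  by apply: H; apply: near_eq_cvg; apply: filterS e => t ->.
by [].
Qed.

Lemma generatorP f : Dom mu P f -> is_generator mu P f (generator mu P f).
Proof. by move=> [h hf]; exact: (xgetI (cst 0) hf). Qed.

Lemma gen_cvg f h : is_generator mu P f h ->
  nrm (fun y => t^-1 * (sgop P t f y - f y) - h y) @[t --> 0^'+] --> 0.
Proof.
move=> [fL hL]; have e : \forall t \near 0^'+,
  'N[mu]_2%:E[EFin \o (fun y => t^-1 * (sgop P t f y - f y) - h y)%R]%E =
  (nrm (fun y => t^-1 * (sgop P t f y - f y) - h y))%:E.
  apply: filterS (nbhs_right_gt (0 : R)) => t /ltW t0.
  by apply: Lnorm2; apply: L2B => //; apply: L2Z; apply: L2B => //; exact: L2_sgop.
move=> /(cvg_trans _) H.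
have /fine_cvg : (nrm (fun y => t^-1 * (sgop P t f y - f y) - h y))%:E @[t --> 0^'+] --> 0%:E.
  by apply: H; apply: near_eq_cvg; apply: filterS e => t ->.
by [].
Qed.

End semigroup.

(** * Strong and weak limits in L^2 *)

Section L2_limits.
Context d (E : measurableType d) (R : realType).
Variable mu : probability E R.
Notation L2 := (Lfun mu 2%:E).
Notation ip := (ip mu).
Notation nrm := (nrm mu).

Lemma ip_cvg (I : Type) (F : set_system I) (FF : Filter F)
    (a c : I -> E -> R) (b e : E -> R) :
  (\forall i \near F, a i \in L2) -> (\forall i \near F, c i \in L2) ->
  b \in L2 -> e \in L2 ->
  nrm (fun x => a i x - b x) @[i --> F] --> 0 ->
  nrm (fun x => c i x - e x) @[i --> F] --> 0 ->
  ip (a i) (c i) @[i --> F] --> ip b e.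
Proof.
move=> aL cL bL eL ab ce.
have h : \forall i \near F, `|ip (a i) (c i) - ip b e| <=
    nrm (fun x => a i x - b x) * nrm (fun x => c i x - e x) +
    nrm (fun x => a i x - b x) * nrm e + nrm b * nrm (fun x => c i x - e x).
  apply: filterS2 aL cL => i aL cL.
  have -> : ip (a i) (c i) - ip b e =
      ip (fun x => a i x - b x) (fun x => c i x - e x) +
      ip (fun x => a i x - b x) e + ip b (fun x => c i x - e x).
    by rewrite !(ipBl, ipBr)//; [ring|exact: L2B].
  by rewrite (le_trans (ler_normD _ _))// lerD ?CS ?L2B// (le_trans (ler_normD _ _))// lerD ?CS ?L2B.
have z : nrm (fun x => a i x - b x) * nrm (fun x => c i x - e x) +
    nrm (fun x => a i x - b x) * nrm e + nrm b * nrm (fun x => c i x - e x)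
    @[i --> F] --> 0.
  have -> : (0 : R) = 0 * 0 + 0 * nrm e + nrm b * 0 by rewrite !(mul0r, mulr0) !addr0.
  apply: cvgD; first apply: cvgD; apply: cvgM => //; exact: cvg_cst.
apply/cvgrPdist_le => eps e0.
have /cvgrPdist_le/(_ _ e0) := z; apply: filterS2 h => i h.
rewrite sub0r normrN distrC => k; apply: (le_trans h); apply: le_trans k.
exact: ler_norm.
Qed.

Lemma nrm_tail u : u \in L2 ->
  nrm (fun x => \1_[set x | k%:R < `|u x|] x * u x) @[k --> \oo] --> 0.
Proof.
move=> uL; have [mu' iu] := (L2P mu u).1 uL.
pose A (k : nat) := [set x | k%:R < `|u x|].
have mA k : measurable (A k).
  rewrite (_ : A k = (fun x => `|u x|) @^-1` `]k%:R, +oo[).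
    rewrite -[X in measurable X]setTI.
    have mn : measurable_fun setT (fun x => `|u x|) by exact: measurableT_comp.
    exact: mn.
  by apply/seteqP; split => x; rewrite /A /= in_itv/= andbT.
pose h k x := (\1_(A k) x * u x) * (\1_(A k) x * u x).
have hle k x : 0 <= h k x <= u x * u x.
  rewrite /h indicE; case: (_ \in _); rewrite ?mul1r ?mul0r -?expr2 ?sqr_ge0 ?lexx// expr0n lexx sqr_ge0.
have ih k : intg mu (h k).
  apply: L2_intgM; exact: L2_indicM.
have cx x : (h k x)%:E @[k --> \oo] --> 0%E.
  apply: cvg_near_cst; near=> k; rewrite /h indicE.
  suff -> : (x \in A k) = false by rewrite mul0r mulr0.
  apply/negbTE; rewrite notin_setE /A /= => /ltW; apply/negP; rewrite -ltNge.
  by near: k; exact: nbhs_infty_gtr.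
have hb x k : (`|(h k x)%:E| <= (u x * u x)%:E)%E.
  by have /andP[h0 hu] := hle k x; rewrite lee_fin ger0_norm.
have [_ _ H] := @dominated_convergence _ _ _ mu setT measurableT
  (fun k => EFin \o h k) (cst 0%E) (EFin \o (fun x => u x * u x))
  (fun k => measurable_int _ (ih k)) (measurable_cst _)
  (aeW _ (fun x (_ : setT x) => cx x)) iu (aeW _ (fun x k (_ : setT x) => hb x k)).
rewrite -(sqrtr0 R); apply: continuous_cvg; first exact: sqrt_continuous.
apply: fine_cvg; rewrite -[X in _ --> X](integral0 mu setT).
exact: H.
Unshelve. all: by end_near. Qed.

(** Boundedness in L^2 and convergence to 0 in L^1 give weak convergence to 0: [Y] is cut at a
    height [K], its tail is small in norm and the rest is bounded by [K]. *)
Lemma ip_cvg0_L1 (I : Type) (F : set_system I) (FF : Filter F)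
    (q : I -> E -> R) (M : R) Y :
  (\forall i \near F, q i \in L2) -> (\forall i \near F, nrm (q i) <= M) ->
  Y \in L2 -> \int[mu]_x `|q i x| @[i --> F] --> 0 ->
  ip (q i) Y @[i --> F] --> 0.
Proof.
move=> qL qM YL q0; apply/cvgrPdist_le => eps e0.
pose M' := Num.max M 1; have M0 : 0 < M' by rewrite lt_max ltr01 orbT.
have e1 : 0 < eps / (2 * M') by rewrite divr_gt0// mulr_gt0.
have /cvgrPdist_le/(_ _ e1)[K _ /(_ K (leqnn K))/=] := nrm_tail YL.
set A := [set x | _]; rewrite sub0r normrN ger0_norm ?nrm_ge0// => tailK.
have mA : measurable A.
  rewrite (_ : A = (fun x => `|Y x|) @^-1` `]K%:R, +oo[).
    rewrite -[X in measurable X]setTI.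
    have mn : measurable_fun setT (fun x => `|Y x|).
      by apply: measurableT_comp => //; exact: L2_meas YL.
    exact: mn.
  by apply/seteqP; split => x; rewrite /A /= in_itv/= andbT.
have e2 : 0 < eps / (2 * (K%:R + 1)) by rewrite divr_gt0// mulr_gt0// ltr_wpDl.
have /cvgrPdist_le/(_ _ e2) := q0.
apply: filterS3 qL qM => i qL qM; rewrite !sub0r !normrN ger0_norm; last first.
  exact: Rintegral_ge0.
move=> q1.
have -> : ip (q i) Y = ip (q i) (fun x => \1_A x * Y x) + ip (q i) (fun x => \1_(~` A) x * Y x).
  rewrite -ipDr//; try by apply: L2_indicM => //; exact: measurableC.
  apply: eq_Rintegral => x _; rewrite !indicE in_setC.
  by case: (_ \in _) => /=; ring.
apply: (le_trans (ler_normD _ _)).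
have b1 : `|ip (q i) (fun x => \1_A x * Y x)| <= eps / 2.
  apply: (le_trans (CS _ _)) => //; first exact: L2_indicM.
  apply: (@le_trans _ _ (M' * (eps / (2 * M')))).
    by apply: ler_pM; rewrite ?nrm_ge0// (le_trans qM)// le_max lexx.
  have M0' := lt0r_neq0 M0; rewrite le_eqVlt; apply/orP; left; apply/eqP; field.
  exact: M0'.
have b2 : `|ip (q i) (fun x => \1_(~` A) x * Y x)| <= eps / 2.
  have CL : (fun x => \1_(~` A) x * Y x) \in L2 by apply: L2_indicM => //; exact: measurableC.
  apply: (@le_trans _ _ (\int[mu]_x (K%:R * `|q i x|))).
    apply: (le_trans (le_normr_Rintegral _ _)) => //; first exact: L2_intgM.
    apply: Rint_le.
    - by apply: intg_norm; exact: L2_intgM.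
    - by apply: intgZ; apply: intg_norm; exact: L2_intg.
    move=> x; rewrite normrM mulrC ler_wpM2r// indicE in_setC.
    case: (boolP (x \in A)) => /= xA; first by rewrite mul0r normr0.
    by rewrite mul1r leNgt; apply/negP; move: xA; rewrite notin_setE.
  rewrite RintZ; last by apply: intg_norm; exact: L2_intg.
  apply: (@le_trans _ _ ((K%:R + 1) * (eps / (2 * (K%:R + 1))))).
    by apply: ler_pM => //; [exact: Rintegral_ge0|rewrite lerDl].
  have K0' : K%:R + 1 != 0 :> R by rewrite lt0r_neq0// ltr_wpDl.
  rewrite le_eqVlt; apply/orP; left; apply/eqP; field.
  exact: K0'.
lra.
Qed.

(** A weakly null bounded family paired with a strongly convergent one. It serves for products whose
    convergence is at hand in L^1 only. *)
Lemma ip_cvg0_weak (I : Type) (F : set_system I) (FF : Filter F)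
    (q c : I -> E -> R) (M : R) e :
  (\forall i \near F, q i \in L2) -> (\forall i \near F, nrm (q i) <= M) ->
  (\forall i \near F, c i \in L2) -> e \in L2 ->
  \int[mu]_x `|q i x| @[i --> F] --> 0 ->
  nrm (fun x => c i x - e x) @[i --> F] --> 0 ->
  ip (q i) (c i) @[i --> F] --> 0.
Proof.
move=> qL qM cL eL q0 ce.
have z : M * nrm (fun x => c i x - e x) + `|ip (q i) e| @[i --> F] --> 0.
  rewrite -[X in _ --> X]addr0; apply: cvgD.
    by rewrite -[X in _ --> X](mulr0 M); apply: cvgM => //; exact: cvg_cst.
  rewrite -[X in _ --> X](@normr0 _ R); apply: cvg_norm.
  exact: ip_cvg0_L1 qL qM eL q0.
apply/cvgrPdist_le => eps e0; have /cvgrPdist_le/(_ _ e0) := z.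
have qLM : \forall i \near F, q i \in L2 /\ nrm (q i) <= M by apply: filterS2 qL qM.
apply: filterS3 qLM cL => i [{}qL {}qM] cL; rewrite !sub0r !normrN => h.
apply: le_trans (le_trans (ler_norm _) h).
have -> : ip (q i) (c i) = ip (q i) (fun x => c i x - e x) + ip (q i) e.
  by rewrite ipBr// subrK.
apply: (le_trans (ler_normD _ _)); rewrite lerD2r.
by apply: (le_trans (CS _ _)) => //; [exact: L2B|rewrite ler_wpM2r ?nrm_ge0].
Qed.

End L2_limits.

(** * Generator, carré du champ and energies *)

Section semigroup_calculus.
Context d (E : measurableType d) (R : realType).
Variables (mu : probability E R) (P : R -> R.-pker E ~> E).
Hypothesis hP : markov_semigroup mu P.
Implicit Types (u v w f g F G : E -> R) (t r : R).

Notation L2 := (Lfun mu 2%:E).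
Notation ip := (ip mu).
Notation nrm := (nrm mu).
Notation D := (Dom mu P).
Notation L := (generator mu P).
Notation Q := (sgop P).

Lemma Dom_L2 f : D f -> f \in L2.
Proof. by move=> [h []]. Qed.

Lemma gen_L2 f : D f -> L f \in L2.
Proof. by move=> /generatorP[]. Qed.

Lemma near_ge0 (A : R -> Prop) : (forall r, 0 <= r -> A r) ->
  \forall r \near 0^'+, A r.
Proof. by move=> h; apply: filterS (nbhs_right_gt (0 : R)) => r /ltW; exact: h. Qed.

Lemma near0_ge0 : \forall r \near (0 : R)^'+, 0 <= r.
Proof. by apply: near_ge0. Qed.

Lemma gen_ip (c : R -> E -> R) f w : D f -> w \in L2 ->
  (\forall r \near 0^'+, c r \in L2) ->
  nrm (fun x => c r x - w x) @[r --> 0^'+] --> 0 ->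
  r^-1 * ip (fun x => Q r f x - f x) (c r) @[r --> 0^'+] --> ip (L f) w.
Proof.
move=> fD wL cL cw; have fL := Dom_L2 fD.
have h : ip (fun x => r^-1 * (Q r f x - f x)) (c r) @[r --> 0^'+] --> ip (L f) w.
  apply: ip_cvg => //; last exact: gen_cvg (generatorP fD).
    by apply: near_ge0 => r r0; apply: L2Z; apply: L2B => //; exact: L2_sgop.
  exact: gen_L2.
apply: cvg_trans h; apply: near_eq_cvg.
apply: filterS2 cL near0_ge0 => r cL r0.
by rewrite ipZl//; apply: L2B => //; exact: L2_sgop.
Qed.

Lemma gen_ip_cst f w : D f -> w \in L2 ->
  r^-1 * ip (fun x => Q r f x - f x) w @[r --> 0^'+] --> ip (L f) w.
Proof.
move=> fD wL; apply: gen_ip => //; first exact: nearW.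
by under eq_fun do rewrite nrm_subrr; exact: cvg_cst.
Qed.

Lemma ip_gen1 f : D f -> \int[mu]_x L f x = 0.
Proof.
move=> fD; have fL := Dom_L2 fD.
have := gen_ip_cst fD (L2_cst mu 1).
have -> : ip (L f) (fun=> 1) = \int[mu]_x L f x.
  by apply: eq_Rintegral => x _; rewrite mulr1.
move=> h; apply: (cvg_unique _ h) => //.
apply: cvg_near_cst; apply: near_ge0 => r r0.
rewrite ipBl ?L2_cst ?L2_sgop// ip_sgop ?L2_cst// sgop_cst.
by rewrite subrr mulr0.
Qed.

Lemma nrm_sgopB t u v : 0 <= t -> u \in L2 -> v \in L2 ->
  nrm (fun x => Q t u x - Q t v x) <= nrm (fun x => u x - v x).
Proof.
move=> t0 uL vL; rewrite -(@nrm_ae _ _ _ _ (Q t (fun x => u x - v x))).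
- by apply: nrm_sgop => //; exact: L2B.
- by apply: L2_sgop => //; exact: L2B.
- by apply: L2B; exact: L2_sgop.
- by apply: sgopB => //; exact: L2_intg.
Qed.

Lemma nrm_semigroupD t r u : 0 <= t -> 0 <= r -> u \in L2 ->
  nrm (fun x => Q (t + r) u x - Q t u x) <= nrm (fun x => Q r u x - u x).
Proof.
move=> t0 r0 uL.
rewrite (@nrm_ae _ _ _ _ _ (fun x => Q t (Q r u) x - Q t u x)).
- by apply: nrm_sgopB => //; exact: L2_sgop.
- by apply: L2B; apply: L2_sgop => //; rewrite addr_ge0.
- by apply: L2B; apply: L2_sgop => //; exact: L2_sgop.
by apply: filterS (sgopD hP t0 r0 uL) => x /(_ Logic.I) -> _.
Qed.

Lemma squeeze0 (a b : R -> R) : (\forall r \near 0^'+, 0 <= a r <= b r) ->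
  b r @[r --> 0^'+] --> 0 -> a r @[r --> 0^'+] --> 0.
Proof. by move=> ab b0; apply: (squeeze_cvgr ab _ b0); exact: cvg_cst. Qed.

Lemma near_lt t : 0 < t -> \forall r \near 0^'+, 0 < r < t.
Proof.
move=> t0; apply: filterS2 (nbhs_right_gt (0 : R)) (nbhs_right_lt t0) => r.
by move=> -> ->.
Qed.

Lemma left_cont t u : 0 < t -> u \in L2 ->
  nrm (fun x => Q (t - r) u x - Q t u x) @[r --> 0^'+] --> 0.
Proof.
move=> t0 uL; apply: squeeze0 (sgop_cont hP uL).
apply: filterS (near_lt t0) => r /andP[r0 rt].
rewrite nrm_ge0 nrmBC -{1}(subrK r t).
by apply: nrm_semigroupD => //; rewrite ?subr_ge0 ltW.
Qed.

(** The weak form of [L P_t f = P_t L f]: the operators [P_r] and [P_t] commute and [P_t] is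
    symmetric. *)
Lemma gen_sgop t f w : 0 <= t -> D f -> D (Q t f) -> w \in L2 ->
  ip (L (Q t f)) w = ip (L f) (Q t w).
Proof.
move=> t0 fD QfD wL; have fL := Dom_L2 fD.
have h1 := gen_ip_cst QfD wL.
have h2 := gen_ip_cst fD (L2_sgop hP t0 wL).
apply: (cvg_unique _ h1) => //; apply: cvg_trans h2; apply: near_eq_cvg.
apply: near_ge0 => r r0; congr (_ * _).
have B : (fun x => Q r f x - f x) \in L2 by apply: L2B => //; exact: L2_sgop.
rewrite -ip_sgop//; apply: ip_ael => //; try exact: L2_sgop.
  by apply: L2B; apply: L2_sgop => //; exact: L2_sgop.
have Qf : Q r f \in L2 by exact: L2_sgop.
have e1 := sgopB hP t0 (L2_intg Qf) (L2_intg fL).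
apply: filterS3 e1 (sgopD hP t0 r0 fL) (sgopD hP r0 t0 fL) => x.
by move=> k1 k2 k3 _; rewrite k1//= -k2// -k3// (addrC r).
Qed.

(** Since [P_a u - P_(a-r) u = P_(a-r) (P_r u - u)], symmetry moves [P_(a-r)] onto [w], where it
    converges strongly to [P_a]; the left derivative thus reduces to the right derivative at 0. *)
Lemma gen_left a u w : 0 < a -> D u -> D (Q a u) -> w \in L2 ->
  r^-1 * ip (fun x => Q a u x - Q (a - r) u x) w @[r --> 0^'+]
    --> ip (L (Q a u)) w.
Proof.
move=> a0 uD QuD wL; have uL := Dom_L2 uD.
rewrite gen_sgop ?ltW//.
have h : r^-1 * ip (fun x => Q r u x - u x) (Q (a - r) w) @[r --> 0^'+] -->
    ip (L u) (Q a w).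
  apply: gen_ip => //; [by apply: (L2_sgop hP) => //; exact: ltW| |exact: left_cont].
  apply: filterS (near_lt a0) => r /andP[r0 ra].
  by apply: L2_sgop => //; rewrite subr_ge0 ltW.
apply: cvg_trans h; apply: near_eq_cvg.
apply: filterS (near_lt a0) => r /andP[/ltW r0 /ltW ra]; congr (_ * _).
have ar0 : 0 <= a - r by rewrite subr_ge0.
have B : (fun x => Q r u x - u x) \in L2 by apply: L2B => //; exact: L2_sgop.
have Qu : Q r u \in L2 by exact: L2_sgop.
rewrite -ip_sgop//; apply: ip_ael => //; try exact: L2_sgop.
  by apply: L2B; apply: L2_sgop => //; exact: ltW.
apply: filterS2 (sgopB hP ar0 (L2_intg Qu) (L2_intg uL)) (sgopD hP ar0 r0 uL) => x.
by move=> h1' h2' _; rewrite h1'//= -h2'// subrK.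
Qed.

Lemma gen_sym f g : D f -> D g -> ip (L f) g = ip f (L g).
Proof.
move=> fD gD; have fL := Dom_L2 fD; have gL := Dom_L2 gD.
rewrite (ipC _ f); apply: (cvg_unique _ (gen_ip_cst fD gL)) => //.
apply: cvg_trans (gen_ip_cst gD fL); apply: near_eq_cvg.
apply: near_ge0 => r r0; congr (_ * _).
by rewrite !ipBl ?L2_sgop// (ip_sgop hP)// (ipC _ g (Q r f)) (ipC _ g f).
Qed.

Lemma gen_ae u v : D u -> v \in L2 -> u = v %[ae mu] -> D v.
Proof.
move=> uD vL uv; have uL := Dom_L2 uD; exists (L u); split => //; first exact: gen_L2.
have [_ _ h] := generatorP uD; apply: cvg_trans h; apply: near_eq_cvg.
apply: near_ge0 => r r0.
have Qu := L2_sgop hP r0 uL; have Qv := L2_sgop hP r0 vL; have Lu := gen_L2 uD.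
rewrite !Lnorm2; try by apply: L2B => //; apply: L2Z; exact: L2B.
congr EFin; apply: nrm_ae; try by apply: L2B => //; apply: L2Z; exact: L2B.
apply: filterS2 uv (sgop_ae hP r0 (L2_intg uL) (L2_intg vL) uv) => x uv' Quv _.
by rewrite uv'// Quv.
Qed.

Lemma ip_gen_ae u v w : D u -> D v -> w \in L2 -> u = v %[ae mu] ->
  ip (L u) w = ip (L v) w.
Proof.
move=> uD vD wL uv; have uL := Dom_L2 uD; have vL := Dom_L2 vD.
apply: (cvg_unique _ (gen_ip_cst uD wL)) => //.
apply: cvg_trans (gen_ip_cst vD wL); apply: near_eq_cvg.
apply: near_ge0 => r r0; congr (_ * _); apply: ip_ael => //.
- by apply: L2B => //; exact: L2_sgop.
- by apply: L2B => //; exact: L2_sgop.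
apply: filterS2 uv (sgop_ae hP r0 (L2_intg uL) (L2_intg vL) uv) => x uv' Quv _.
by rewrite uv'// Quv.
Qed.

(** Symmetry beyond L^2, both sides being possibly infinite: [u] is truncated at height [n] and
    monotone convergence concludes. It is meant for [u = |Gamma g|], which is known to be integrable
    but not to be in L^2. *)
Lemma adjoint_ge0 t f u : 0 <= t -> f \in L2 -> (forall x, 0 <= f x) ->
  measurable_fun setT u -> (forall x, 0 <= u x) ->
  (\int[mu]_x ((f x)%:E * \int[P t x]_z (u z)%:E) =
   \int[mu]_x ((Q t f x)%:E * (u x)%:E))%E.
Proof.
move=> t0 fL f0 mu' u0.
have Qf := L2_sgop hP t0 fL.
have Qf0 x : 0 <= Q t f x by exact: Rintegral_ge0.
pose h (n : nat) x := Num.min (u x) n%:R.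
have h0 n x : 0 <= h n x by rewrite le_min u0 ler0n.
have mh n : measurable_fun setT (h n) by exact: measurable_minr.
have hn n x : `|h n x| <= n%:R by rewrite ger0_norm// ge_min lexx orbT.
have hL n : h n \in L2 by exact: L2_bnd (hn n).
have ndh x a b : (a <= b)%N -> h a x <= h b x.
  by move=> ab; rewrite /h le_min !ge_min lexx/= ler_nat ab orbT.
have ch x : (h n x)%:E @[n --> \oo] --> (u x)%:E.
  apply: cvg_near_cst; apply: filterS (nbhs_infty_ger (u x)) => n un.
  by congr EFin; apply/min_idPl.
have mQ n : measurable_fun setT (fun x => \int[P t x]_z (h n z)%:E)%E.
  apply: measurable_fun_integral_kernel => //.
  - by move=> U mU; exact: measurable_kernel.
  - by move=> z; rewrite lee_fin.
  - exact/measurable_EFinP.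
have mf : measurable_fun setT (EFin \o f) by apply/measurable_EFinP; exact: L2_meas fL.
have cP x : (\int[P t x]_z (h n z)%:E)%E @[n --> \oo] --> (\int[P t x]_z (u z)%:E)%E.
  by apply: mct_cvg => //; move=> n; exact/measurable_EFinP.
have l1 : (\int[mu]_x ((f x)%:E * \int[P t x]_z (h n z)%:E))%E @[n --> \oo] -->
    (\int[mu]_x ((f x)%:E * \int[P t x]_z (u z)%:E))%E.
  apply: mct_cvg.
  - by move=> n; exact: emeasurable_funM.
  - by move=> n x; rewrite mule_ge0 ?lee_fin// integral_ge0// => z _; rewrite lee_fin.
  - move=> x a b ab; rewrite lee_wpmul2l ?lee_fin//; apply: ge0_le_integral => //.
    + by move=> z _; rewrite lee_fin.
    + exact/measurable_EFinP.
    + exact/measurable_EFinP.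
    + by move=> z _; rewrite lee_fin; exact: ndh.
  - by move=> x; exact: cvgeZl.
have l2 : (\int[mu]_x ((Q t f x)%:E * (h n x)%:E))%E @[n --> \oo] -->
    (\int[mu]_x ((Q t f x)%:E * (u x)%:E))%E.
  apply: mct_cvg.
  - move=> n; apply: emeasurable_funM; apply/measurable_EFinP => //.
    exact: L2_meas Qf.
  - by move=> n x; rewrite mule_ge0 ?lee_fin.
  - by move=> x a b ab; rewrite lee_wpmul2l ?lee_fin//; exact: ndh.
  - by move=> x; exact: cvgeZl.
apply: (cvg_unique _ l1) => //; apply: cvg_trans l2; apply: near_eq_cvg.
apply: nearW => n.
transitivity (ip (Q t f) (h n))%:E.
  by rewrite EFin_Rint//; exact: L2_intgM.
rewrite ip_sgop// EFin_Rint; last by apply: L2_intgM => //; exact: L2_sgop.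
apply: ae_eq_integral => //.
- by apply/measurable_EFinP; exact: intg_meas (L2_intgM fL (L2_sgop hP t0 (hL n))).
- exact: emeasurable_funM.
apply: filterS (ae_intgP hP t0 (L2_intg (hL n))) => x ix _.
by rewrite EFinM /sgop EFin_Rint.
Qed.

(* The integral of w(y) (F(z) - F(y))^2 against mu(dy) P_r(y, dz), expanded. *)
Definition energy w F r :=
  ip w (fun x => Q r (F \* F) x - (F \* F) x) -
  2 * ip (w \* F) (fun x => Q r F x - F x).

Lemma energy_ge0 w F r : 0 <= r -> w \in L2 -> w \* F \in L2 ->
  {ae mu, forall x, 0 <= w x} -> F \in L2 -> F \* F \in L2 -> 0 <= energy w F r.
Proof.
move=> r0 wL wFL w0 FL F2L.
have QF := L2_sgop hP r0 FL; have QF2 := L2_sgop hP r0 F2L.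
have i1 : intg mu (fun x => w x * (Q r (F \* F) x - (F \* F) x)).
  by apply: L2_intgM => //; exact: L2B.
have i2 : intg mu (fun x => (w \* F) x * (Q r F x - F x)).
  by apply: L2_intgM => //; exact: L2B.
rewrite /energy /ip -RintZ// -RintB//; last exact: intgZ.
apply: ae_Rint_ge0; first exact: intg_meas (intgB i1 (intgZ 2 i2)).
apply: filterS2 w0 (sgop_sqr hP r0 FL) => x w0 h.
set a := Q r (F \* F) x; have {}h : Q r F x * Q r F x <= a by [].
have := sqr_ge0 (Q r F x - F x); rewrite /= => k.
have -> : w x * (a - F x * F x) - 2 * (w x * F x * (Q r F x - F x)) =
  w x * (a - 2 * F x * Q r F x + F x * F x) by ring.
by apply: mulr_ge0 => //; nra.
Qed.

Lemma intg_Gamma F : Gamma_defined mu P F F -> intg mu (Gamma mu P F F).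
Proof.
move=> [FD _ F2D]; have FL := Dom_L2 FD; have i := L2_intgM FL (gen_L2 FD).
apply: intgZ; apply: intgB => //; apply: intgB => //.
by apply: L2_intg; exact: gen_L2.
Qed.

Lemma intg_wGamma w F : w \in L2 -> w \* F \in L2 -> Gamma_defined mu P F F ->
  intg mu (w \* Gamma mu P F F).
Proof.
move=> wL wFL [FD _ F2D].
have i1 := L2_intgM wL (gen_L2 F2D); have i2 := L2_intgM wFL (gen_L2 FD).
have := intgB (intgZ 2^-1 i1) i2; congr intg.
by apply/funext => x; rewrite /Gamma/=; field.
Qed.

(** [Gamma] as the rate of quadratic variation: the limit pairs [w] with [L (F^2) - 2 F L F]. *)
Lemma energy_cvg w F : w \in L2 -> w \* F \in L2 -> Gamma_defined mu P F F ->
  r^-1 * energy w F r @[r --> 0^'+] --> 2 * \int[mu]_x (w x * Gamma mu P F F x).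
Proof.
move=> wL wFL [FD _ F2D].
have -> : 2 * \int[mu]_x (w x * Gamma mu P F F x) =
    ip (L (F \* F)) w - 2 * ip (L F) (w \* F).
  have i1 := L2_intgM wL (gen_L2 F2D); have i2 := L2_intgM wFL (gen_L2 FD).
  rewrite (ipC _ _ w) (ipC _ _ (w \* F)).
  rewrite /ip -!RintZ//; last exact: intg_wGamma.
  rewrite -RintB//; last exact: intgZ.
  by apply: eq_Rintegral => x _; rewrite /Gamma/=; field.
under eq_fun do rewrite /energy mulrBr (ipC _ w) (ipC _ (w \* F)) mulrCA.
by apply: cvgB; [|apply: cvgM; first exact: cvg_cst]; exact: gen_ip_cst.
Qed.

Lemma cvg_ge0 (a : R -> R) l : (\forall r \near 0^'+, 0 <= a r) ->
  a r @[r --> 0^'+] --> l -> 0 <= l.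
Proof. by move=> a0 al; exact: cvgr_to_ge al a0. Qed.

(** With an indicator as weight, the integral of [Gamma] over a set is a limit of nonnegative
    energies. *)
Lemma Gamma_ge0 F : Gamma_defined mu P F F ->
  {ae mu, forall x, 0 <= Gamma mu P F F x}.
Proof.
move=> hF; have [FD _ F2D] := hF; apply: Rint_indic_ge0; first exact: intg_Gamma.
move=> A mA; have FL := Dom_L2 FD; have F2L := Dom_L2 F2D.
have wL : \1_A \in L2 by exact: L2_indic.
have wFL : \1_A \* F \in L2 by exact: L2_indicM.
rewrite -(pmulr_rge0 _ (ltr0Sn R 1)).
apply: cvg_ge0 (energy_cvg wL wFL hF); apply: near_ge0 => r r0.
rewrite mulr_ge0 ?invr_ge0// energy_ge0//.
by apply: aeW => x; rewrite indicE ler0n.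
Qed.

End semigroup_calculus.

(** * Scalar inequalities and Dini derivatives *)

Section scalar.
Context (R : realType).
Implicit Types a b c p q x y r t : R.

Lemma ln_le_sub1 x : 0 < x -> ln x <= x - 1.
Proof.
move=> x0; have {1}-> : x = 1 + (x - 1) by ring.
by apply: le_ln1Dx; lra.
Qed.

(** The logarithmic mean of 1 and [exp a] is at most their arithmetic mean. *)
Lemma expR_mean a : 0 <= a -> expR a - 1 <= a / 2 * (expR a + 1).
Proof.
move=> a0; pose k a : R := a / 2 * (expR a + 1) - (expR a - 1).
have dk x : is_derive x (1 : R) k (2^-1 * (expR x + 1) + x / 2 * expR x - expR x).
  apply: is_derive_eq.
  by rewrite /GRing.scale/=; ring.
suff : k 0 <= k a by rewrite /k expR0 subrr mul0r mul0r subrr subr_ge0.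
apply: (@ger0_derive1_ndecr R k 0 a) => //.
- move=> x; rewrite in_itv/= => /andP[x0 _]; rewrite derive1E derive_val.
  have := expR_ge1Dx (- x); rewrite expRN => h.
  have e0 := expR_gt0 x.
  have : (1 - x) * expR x <= 1.
    by rewrite -[leRHS](mulVf (lt0r_neq0 e0)) ler_wpM2r// ltW.
  nra.
- by apply: derivable_within_continuous => x _.
Qed.

Let log_mean_le p q : 0 < p -> p <= q ->
  q - p <= (ln q - ln p) * (p + q) / 2.
Proof.
move=> p0 pq; have q0 := lt_le_trans p0 pq.
have a0 : 0 <= ln q - ln p by rewrite subr_ge0 ler_ln.
have := expR_mean a0; rewrite expRD expRN !lnK ?posrE// => h.
have := ler_wpM2r (ltW p0) h.
have -> : (q / p - 1) * p = q - p by field; exact: lt0r_neq0.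
suff -> : (ln q - ln p) / 2 * (q / p + 1) * p = (ln q - ln p) * (p + q) / 2 by [].
by field; exact: lt0r_neq0.
Qed.

Lemma log_mean p q : 0 < p -> 0 < q ->
  `|q - p| <= `|ln q - ln p| * (p + q) / 2.
Proof.
move=> p0 q0; have [pq|/ltW qp] := leP p q.
  by rewrite !ger0_norm ?subr_ge0 ?ler_ln//; exact: log_mean_le.
have := log_mean_le q0 qp; rewrite [q + p]addrC.
by rewrite (distrC q) (distrC (ln q)) !ger0_norm ?subr_ge0 ?ler_ln.
Qed.

(** The logarithmic mean produces the weight [(p + q) / 2]; Young's inequality then separates
    [ln q - ln p] from [b], so that each square becomes an energy after integration. *)
Lemma log_mean_young p q b theta : 0 < p -> 0 < q -> 0 < theta ->
  (q - p) * b <= 2^-1 * (p + q) *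
    (theta / 2 * (ln q - ln p) ^+ 2 + b ^+ 2 / (2 * theta)).
Proof.
move=> p0 q0 t0; set a := ln q - ln p.
have h : `|q - p| <= `|a| * (p + q) / 2 := log_mean p0 q0.
apply: le_trans (ler_norm _) _; rewrite normrM.
apply: (@le_trans _ _ (`|a| * (p + q) / 2 * `|b|)); first by rewrite ler_wpM2r.
rewrite -(real_normK (num_real a)) -(real_normK (num_real b)).
set A := `|a|; set B := `|b|.
have : A * B <= theta / 2 * A ^+ 2 + B ^+ 2 / (2 * theta).
  rewrite -subr_ge0 (_ : _ - _ = (theta * A - B) ^+ 2 / (2 * theta)).
    by rewrite divr_ge0 ?sqr_ge0// mulr_ge0// ltW.
  by field; exact: lt0r_neq0.
move=> /(ler_wpM2l (x := 2^-1 * (p + q))) => /(_ _) k; apply: le_trans (k _).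
  by rewrite le_eqVlt; apply/orP; left; apply/eqP; field.
by rewrite mulr_ge0// addr_ge0// ltW.
Qed.

(** The convex function [x ln x] lies above its tangent at [b]. *)
Lemma gibbs a b : 0 <= a -> 0 < b -> a * ln b + a - b <= a * ln a.
Proof.
move=> a0 b0; have [->|an0] := eqVneq a 0; first by rewrite !mul0r add0r sub0r oppr_le0 ltW.
have {}a0 : 0 < a by rewrite lt_def an0.
have := @ln_le_sub1 (b / a) (divr_gt0 b0 a0); rewrite ln_div ?posrE//.
move=> /(ler_wpM2l (ltW a0)); rewrite mulrBr.
have -> : a * (b / a - 1) = b - a by field.
lra.
Qed.

(** The free parameter [c] trades the Lipschitz constant against an additive error, as [x ln x] has
    infinite slope at 0: with [d = |x - y|], the tangent of [d ln d] at [d = exp (- c - 1)] is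
    [- c d - exp (- c - 1)]. *)
Lemma xlnx_modulus x y c : 0 <= x -> 0 <= y -> 0 <= c ->
  x * ln x - y * ln y <= x * `|x - y| + c * `|x - y| + expR (- c - 1).
Proof.
move=> x0 y0 c0; have e0 := expR_gt0 (- c - 1).
have [yx|xy] := leP y x.
  rewrite ger0_norm ?subr_ge0//.
  have [x0'|x0'] := eqVneq x 0.
    have -> : y = 0 by apply/eqP; rewrite eq_le y0 andbT -x0'.
    by rewrite x0' !mul0r subrr !mulr0 !add0r ltW.
  have {x0'}x0 : 0 < x by rewrite lt_def x0'.
  have := gibbs y0 x0; have := ln_le_sub1 x0 => h1 h2.
  have : (x - y) * ln x <= (x - y) * (x - 1) by rewrite ler_wpM2l// subr_ge0.
  have : 0 <= c * (x - y) by rewrite mulr_ge0// subr_ge0.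
  nra.
rewrite distrC ger0_norm; last by rewrite subr_ge0 ltW.
set d := y - x.
have d0 : 0 < d by rewrite subr_gt0.
have yE : y = x + d by rewrite /d addrC subrK.
have y0' : 0 < y by rewrite (le_lt_trans x0).
have h1 : x * ln x <= x * ln y.
  have [->|xn0] := eqVneq x 0; first by rewrite !mul0r.
  by rewrite ler_wpM2l// ler_ln ?posrE ?ltW// lt_def xn0.
have h2 : d * ln d <= d * ln y.
  by apply: ler_wpM2l; [exact: ltW|rewrite ler_ln ?posrE// yE lerDr].
have h3 : - (d * ln d) <= c * d + expR (- c - 1).
  have := @ln_le_sub1 (expR (- c - 1) / d) (divr_gt0 e0 d0).
  rewrite ln_div ?posrE// expRK => /(ler_wpM2l (ltW d0)).
  have -> : d * (expR (- c - 1) / d - 1) = expR (- c - 1) - d.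
    by field; exact: lt0r_neq0.
  nra.
have h4 : 0 <= x * d by rewrite mulr_ge0// ltW.
have -> : y * ln y = x * ln y + d * ln y by rewrite -mulrDl -yE.
lra.
Qed.

(** Entropy dominates the squared Hellinger distance: [ln (1 / s) <= 1 / s - 1] for [s] the square
    root of [x]. *)
Lemma xlnx_hellinger x : 0 <= x -> (Num.sqrt x - 1) ^+ 2 <= x * ln x - x + 1.
Proof.
move=> x0; have [->|xn0] := eqVneq x 0.
  by rewrite sqrtr0 sub0r sqrrN expr1n mul0r subr0 add0r.
have {xn0}x0' : 0 < x by rewrite lt_def xn0.
set s := Num.sqrt x; have s0 : 0 < s by rewrite sqrtr_gt0.
have xE : x = s ^+ 2 by rewrite sqr_sqrtr.
have l : ln x = 2 * ln s by rewrite xE expr2 lnM ?posrE//; ring.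
have := @ln_le_sub1 s^-1; rewrite invr_gt0 => /(_ s0); rewrite lnV ?posrE//.
move=> /(ler_wpM2l (sqr_ge0 s)).
have -> : s ^+ 2 * (s^-1 - 1) = s - s ^+ 2 by field; exact: lt0r_neq0.
by rewrite l xE; nra.
Qed.

(** Pinsker's inequality before integration: with [s] the square root of [x],
    [|x - 1| = (s + 1) |s - 1|] is split by Young's inequality, and the square of [s - 1] is bounded
    by [xlnx_hellinger]. *)
Lemma xlnx_pinsker x theta : 0 <= x -> 0 < theta ->
  `|x - 1| <= theta * (x + 1) + (x * ln x - x + 1) / (2 * theta).
Proof.
move=> x0 t0; have h := xlnx_hellinger x0; set s := Num.sqrt x in h.
have s0 : 0 <= s by exact: sqrtr_ge0.
have xE : x = s ^+ 2 by rewrite sqr_sqrtr.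
have {}h : (s - 1) ^+ 2 / (2 * theta) <= (x * ln x - x + 1) / (2 * theta).
  by rewrite ler_wpM2r// invr_ge0 mulr_ge0// ltW.
apply: le_trans (lerD (lexx _) h).
have k : 0 <= (theta * (s + 1) - `|s - 1|) ^+ 2 / (2 * theta).
  by rewrite divr_ge0 ?sqr_ge0// mulr_ge0// ltW.
have e : (theta * (s + 1) - `|s - 1|) ^+ 2 / (2 * theta) =
  theta / 2 * (s + 1) ^+ 2 + `|s - 1| ^+ 2 / (2 * theta) - (s + 1) * `|s - 1|.
  by field; exact: lt0r_neq0.
have -> : `|x - 1| = (s + 1) * `|s - 1|.
  rewrite -[X in X * _]ger0_norm ?addr_ge0// -normrM xE; congr `|_|; ring.
rewrite e real_normK ?num_real// in k.
have k2 : theta / 2 * (s + 1) ^+ 2 <= theta * (x + 1).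
  rewrite xE -mulrA ler_pM2l//; have := sqr_ge0 (s - 1).
  by clearbody s; nra.
lra.
Qed.

Lemma overlap_ln x : 0 < x -> Num.min x 1 * ln x <= Num.max (x - 1) 0.
Proof.
move=> x0; have := ln_le_sub1 x0; have [x1|x1] := leP x 1.
  rewrite max_r ?subr_le0// => h.
  by rewrite pmulr_rle0// (le_trans h)// subr_le0.
by rewrite mul1r max_l// subr_ge0 ltW.
Qed.

Lemma expR_step k v r : 0 <= r -> 0 <= k ->
  expR (- (k * (v + r))) - expR (- (k * v)) <=
  - (k * r * expR (- (k * v))) * (1 - k * r).
Proof.
move=> r0 k0; rewrite mulrDr opprD expRD; set e := expR (- (k * v)).
have e0 : 0 < e by exact: expR_gt0.
set b := k * r; have b0 : 0 <= b by rewrite mulr_ge0.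
have : expR (- b) <= 1 - b + b ^+ 2.
  rewrite expRN; have h := expR_ge1Dx b.
  have b1 : 0 < 1 + b by rewrite ltr_pwDl.
  apply: (@le_trans _ _ (1 + b)^-1); first by rewrite lef_pV2 ?posrE ?expR_gt0.
  rewrite -[leLHS]mul1r ler_pdivrMr//.
  have : 0 <= b ^+ 3 by rewrite exprn_ge0.
  have -> : (1 - b + b ^+ 2) * (1 + b) = 1 + b ^+ 3 by ring.
  lra.
nra.
Qed.

Lemma near0P (A : R -> Prop) : (\forall r \near 0^'+, A r) ->
  exists2 e, 0 < e & forall r, 0 < r -> r < e -> A r.
Proof.
move=> [e /= e0 h]; exists e => // r r0 re; apply: h => //=.
by rewrite sub0r normrN gtr0_norm.
Qed.

(** For [eta > 0], let [m] be the infimum of the times [t] with [phi b <= phi t + eta (b - t)]. The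
    semicontinuity hypothesis shows that [m] is such a time; if [m > a], the bound on left
    increments gives a smaller one. *)
Lemma dini_left (phi : R -> R) a b : a <= b ->
  (forall t, a < t -> t <= b -> forall eps, 0 < eps ->
     \forall r \near 0^'+, phi t - phi (t - r) <= eps * r) ->
  (forall t, a <= t -> t < b -> forall eps, 0 < eps ->
     \forall r \near 0^'+, phi (t + r) <= phi t + eps) ->
  phi b <= phi a.
Proof.
move=> ab left right; apply/ler_addgt0Pr => eps e0.
suff h eta : 0 < eta -> phi b <= phi a + eta * (b - a).
  have [ab'|ab'] := eqVneq a b; first by rewrite ab' ltW// ltrDl.
  have {}ab : 0 < b - a by rewrite subr_gt0 lt_neqAle ab'.
  have := h (eps / (b - a)) (divr_gt0 e0 ab).
  by rewrite divfK// lt0r_neq0.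
move=> eta0.
pose S := [set t | [/\ a <= t, t <= b & phi b <= phi t + eta * (b - t)]].
have Sb : S b by split => //; rewrite subrr mulr0 addr0.
have lbS : lbound S a by move=> t [].
have iS : has_inf S by split; [exists b|exists a].
pose m := inf S.
have am : a <= m by apply: lb_le_inf => //; exists b.
have mle t : S t -> m <= t by move=> St; apply: ge_inf => //; exists a.
have mb : m <= b by exact: mle.
have [_ _ Sm] : S m.
  split => //; apply/ler_addgt0Pr => e e0'.
  have [mb'|mb'] := eqVneq m b.
    by rewrite mb' subrr mulr0 addr0 ltW// ltrDl.
  have {}mb' : m < b by rewrite lt_neqAle mb'.
  have [del del0 h] := near0P (right m am mb' e e0').
  have [s Ss sm] := inf_adherent del0 iS.
  have ms := mle _ Ss; have [as' sb hs] := Ss.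
  have [sE|sn] := eqVneq s m; first by rewrite -sE ltW// (le_lt_trans hs)// ltrDl.
  have r0 : 0 < s - m by rewrite subr_gt0 lt_neqAle eq_sym sn.
  have r1 : s - m < del by rewrite ltrBlDl.
  have := h _ r0 r1; rewrite addrC subrK => h2; nra.
have [mE|mn] := eqVneq m a; first by rewrite -mE.
have {}am : a < m by rewrite lt_neqAle eq_sym mn.
have [del del0 h] := near0P (left m am mb eta eta0).
pose r := Num.min del (m - a) / 2.
have r0 : 0 < r by rewrite divr_gt0// lt_min del0 subr_gt0.
have rE : r + r = Num.min del (m - a) by rewrite /r; field.
have r1 : r < del.
  apply: (@lt_le_trans _ _ (r + r)); first by rewrite ltrDl.
  by rewrite rE ge_min lexx.
have r2 : r <= m - a.
  apply: (@le_trans _ _ (r + r)); first by rewrite lerDl ltW.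
  by rewrite rE ge_min lexx orbT.
have := h _ r0 r1 => h1.
have : S (m - r) by split; nra.
by move=> /mle; rewrite lerBrDl gerDr leNgt r0.
Qed.

(** Reversing time and changing the sign of [phi] exchanges left and right increments. *)
Lemma dini_right (phi : R -> R) a b : a <= b ->
  (forall t, a <= t -> t < b -> forall eps, 0 < eps ->
     \forall r \near 0^'+, phi (t + r) - phi t <= eps * r) ->
  (forall t, a < t -> t <= b -> forall eps, 0 < eps ->
     \forall r \near 0^'+, phi t <= phi (t - r) + eps) ->
  phi b <= phi a.
Proof.
move=> ab right left; pose psi t := - phi (- t).
suff : psi (- a) <= psi (- b) by rewrite /psi !opprK lerN2.
apply: dini_left; first by rewrite lerN2.
- move=> t tb ta eps e0; have := right (- t); rewrite lerNr ltrNl => /(_ ta tb _ e0).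
  by apply: filterS => r; rewrite /psi (_ : - (t - r) = - t + r); [lra|ring].
- move=> t tb ta eps e0; have := left (- t); rewrite lerNl ltrNr => /(_ ta tb _ e0).
  by apply: filterS => r; rewrite /psi (_ : - (t + r) = - t - r); [lra|ring].
Qed.

(** The function [psi t + C / k * exp (- k (t - a))] is non-increasing. Increments of [psi] need
    only be dominated by some [u] that has a right derivative [l], since the functions to which this
    applies are not known to be differentiable. *)
Lemma dini_exp (psi : R -> R) a b C k : a <= b -> 0 <= C -> 0 < k ->
  (forall t, a <= t -> t < b -> exists l (u : R -> R),
     [/\ l <= C * expR (- (k * (t - a))),
         \forall r \near 0^'+, psi (t + r) - psi t <= u r &
         r^-1 * u r @[r --> 0^'+] --> l]) ->
  (forall t, a < t -> t <= b -> forall eps, 0 < eps ->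
     \forall r \near 0^'+, psi t <= psi (t - r) + eps) ->
  psi b - psi a <= C / k.
Proof.
move=> ab C0 k0 dpsi lpsi.
pose e t := expR (- (k * (t - a))).
pose phi t := psi t + C / k * e t.
have Ck0 : 0 <= C / k by rewrite divr_ge0// ltW.
have e0 t : 0 < e t by exact: expR_gt0.
suff h : phi b <= phi a.
  have ea : e a = 1 by rewrite /e subrr mulr0 oppr0 expR0.
  move: h; rewrite /phi ea mulr1 => h.
  have := mulr_ge0 Ck0 (ltW (e0 b)); lra.
have estep t r : 0 <= r -> e (t + r) - e t <= - (k * r * e t) * (1 - k * r).
  move=> r0; have := expR_step (t - a) r0 (ltW k0).
  by rewrite (_ : t - a + r = t + r - a)//; ring.
apply: dini_right => //.
- move=> t ta tb eps eps0; have [l [u [lC ul dl]]] := dpsi t ta tb.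
  have d2 : 0 < eps / 2 by rewrite divr_gt0.
  pose B := C * k * e t; have B0 : 0 <= B by rewrite !mulr_ge0// ltW.
  have B1 : 0 < B + 1 by rewrite ltr_wpDl.
  have r1 : \forall r \near (0 : R)^'+, r <= eps / 2 / (B + 1).
    by apply: nbhs_right_le; rewrite divr_gt0.
  have {}r1 : \forall r \near (0 : R)^'+, 0 < r /\ r <= eps / 2 / (B + 1).
    by apply: filterS2 (nbhs_right_gt (0 : R)) r1 => r.
  have /cvgrPdist_le/(_ _ d2) dl' := dl.
  apply: filterS3 ul r1 dl' => r ulr [r0 {}r1] h.
  have {}h : r^-1 * u r <= l + eps / 2.
    by move: h; rewrite ler_norml => /andP[h _]; lra.
  have {h}h1 : psi (t + r) - psi t <= r * (l + eps / 2).
    apply: le_trans ulr _.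
    by have := ler_wpM2l (ltW r0) h; rewrite mulrA divff ?mul1r// lt0r_neq0.
  have h2 : C / k * (e (t + r) - e t) <= - (r * (C * e t)) + r * (r * B).
    apply: (le_trans (ler_wpM2l Ck0 (estep _ _ (ltW r0)))).
    by rewrite le_eqVlt; apply/orP; left; apply/eqP; rewrite /B; field; exact: lt0r_neq0.
  have h3 : r * B <= eps / 2.
    apply: (@le_trans _ _ (r * (B + 1))); first by rewrite ler_pM2l// lerDl.
    by rewrite -ler_pdivlMr.
  have h4 : r * (r * B) <= r * (eps / 2) by rewrite ler_pM2l.
  have h5 : r * l <= r * (C * e t) by rewrite ler_pM2l.
  rewrite /phi; lra.
- move=> t ta tb eps eps0; apply: filterS2 (nbhs_right_gt (0 : R)) (lpsi t ta tb eps eps0).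
  move=> r r0 h; rewrite /phi.
  have : C / k * e t <= C / k * e (t - r).
    by rewrite ler_wpM2l// ler_expR lerN2 ler_pM2l//; lra.
  lra.
Qed.

End scalar.

(** * Comparison of the Dirichlet form with weighted energies *)

Section dirichlet.
Context d (E : measurableType d) (R : realType).
Variables (mu : probability E R) (P : R -> R.-pker E ~> E).
Hypothesis hP : markov_semigroup mu P.

Notation L2 := (Lfun mu 2%:E).
Notation ip := (ip mu).
Notation Q := (sgop P).

Lemma energyE w F r : 0 <= r -> w \in L2 -> w \* F \in L2 -> F \in L2 ->
  F \* F \in L2 ->
  energy mu P w F r = \int[mu]_x (w x * F x * F x)
    - 2 * \int[mu]_x (w x * F x * Q r F x) + \int[mu]_x (w x * Q r (F \* F) x).
Proof.
move=> r0 wL wFL FL F2L; rewrite /energy.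
have QF := L2_sgop hP r0 FL; have QF2 := L2_sgop hP r0 F2L.
rewrite !ipBr//.
have -> : ip w (F \* F) = \int[mu]_x (w x * F x * F x).
  by apply: eq_Rintegral => x _; rewrite mulrA.
rewrite -[ip (w \* F) F]/(\int[mu]_x (w x * F x * F x)).
rewrite -[ip (w \* F) (Q r F)]/(\int[mu]_x (w x * F x * Q r F x)).
rewrite -[ip w (Q r (F \* F))]/(\int[mu]_x (w x * Q r (F \* F) x)).
by do ?[move: (Rintegral mu _ _) => ?]; ring.
Qed.

(* The off-diagonal weight (f(y) + f(z))/2 comes from comparing the logarithmic
   and the arithmetic mean of f(y) and f(z); it symmetrizes to f(y). *)
Lemma dirichlet_le (f G : E -> R) (r theta : R) :
  let g := @ln R \o f in
  0 <= r -> 0 < theta -> {ae mu, forall x, 0 < f x} ->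
  f \in L2 -> f \* f \in L2 -> g \in L2 -> g \* g \in L2 -> f \* g \in L2 ->
  G \in L2 -> G \* G \in L2 ->
  - ip (fun x => Q r f x - f x) G <=
    2^-1 * (theta / 2 * energy mu P f g r + (2 * theta)^-1 * energy mu P f G r).
Proof.
move=> g r0 t0 f0 fL f2L gL g2L fgL GL G2L.
have fGL : f \* G \in L2.
  by apply: L2_prod => //; [exact: L2_meas fL|exact: L2_meas GL].
have t0' := lt0r_neq0 t0.
have i1 := intg_cst mu (1 : R).
have ifg2 : intg mu ((f \* g) \* g) by exact: L2_intgM.
have ifG2 : intg mu ((f \* G) \* G) by exact: L2_intgM.
have lnE x : ln (f x) = g x by [].
clearbody g.
pose c y := theta / 2 * g y ^+ 2 + G y ^+ 2 / (2 * theta).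
(* The sum is the right side minus the left side of [log_mean_young] for [p = f y], [q = f z] and
   [b = G z - G y], sorted by the functions of [z]. *)
pose s : seq ((E -> R) * (E -> R)) :=
  [:: ((fun y => 2^-1 * f y * c y - f y * G y), fun=> 1);
      ((fun y => 2^-1 * c y + G y), f);
      ((fun y => f y - f y * G y / (2 * theta)), G);
      ((fun y => 2^-1 * f y / (2 * theta)), G \* G);
      ((fun y => - 1 - G y / (2 * theta)), f \* G);
      ((fun y => 2^-1 / (2 * theta)), (f \* G) \* G);
      ((fun y => - (f y * theta * g y / 2)), g);
      ((fun y => 2^-1 * f y * (theta / 2)), g \* g);
      ((fun y => - (theta * g y / 2)), f \* g);
      ((fun y => theta / 4), (f \* g) \* g)].
have is' : all_intg2 mu s.
  by do 10 (split; first by [|exact: L2_intg]).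
have pos y z : 0 < f y -> 0 < f z -> 0 <= \sum_(p <- s) p.1 y * p.2 z.
  move=> fy fz; rewrite !big_cons big_nil/=.
  have := log_mean_young (G z - G y) fy fz t0.
  rewrite !lnE -subr_ge0 => h.
  apply: le_trans h _; rewrite le_eqVlt; apply/orP; left; apply/eqP.
  by rewrite /c; field.
have {is' pos} key := sgop_ge0 hP r0 f0 is' pos.
have Qf := L2_sgop hP r0 fL; have Qg := L2_sgop hP r0 gL.
have QG := L2_sgop hP r0 GL; have QG2 := L2_sgop hP r0 G2L.
have Qg2 := L2_sgop hP r0 g2L; have QfG := L2_sgop hP r0 fGL.
have Qfg := L2_sgop hP r0 fgL.
have iQfG2 := intg_sgop hP r0 ifG2; have iQfg2 := intg_sgop hP r0 ifg2.
pose t2 := (2 * theta)^-1.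
pose s2 : seq (R * (E -> R)) :=
  [:: (theta / 4, (f \* g) \* g); (2^-1 * t2, (f \* G) \* G); (-1, f \* G);
      (theta / 4, (g \* g) \* Q r f); (2^-1 * t2, (G \* G) \* Q r f); (1, G \* Q r f);
      (1, f \* Q r G); (- t2, (f \* G) \* Q r G); (2^-1 * t2, f \* Q r (G \* G));
      (-1, Q r (f \* G)); (- t2, G \* Q r (f \* G)); (2^-1 * t2, Q r ((f \* G) \* G));
      (- theta / 2, (f \* g) \* Q r g); (theta / 4, f \* Q r (g \* g));
      (- theta / 2, g \* Q r (f \* g)); (theta / 4, Q r ((f \* g) \* g))].
have is2 : all_intg mu s2.
  by do 16 (split; first by [|exact: L2_intgM|exact: L2_intg]).
have pos2 : {ae mu, forall y, 0 <= \sum_(p <- s2) p.1 * p.2 y}.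
  apply: filterS key => y; rewrite /s /s2 !big_cons !big_nil/= (sgop_cst P) => key.
  apply: le_trans key _; rewrite le_eqVlt; apply/orP; left; apply/eqP.
  by rewrite /c /t2; field.
have {is2 pos2} := Rint_lin_ge0 is2 pos2; rewrite /s2 !big_cons big_nil/=.
rewrite !(Rint_sgop hP r0)//; last exact: L2_intg.
(* Self-adjointness turns terms weighted by [f z] into terms weighted by [f y]; the sixteen
   integrals then regroup into two energies and the pairing with [G]. *)
have e1 u : u \in L2 -> u \* u \in L2 ->
    \int[mu]_x (u x * u x * Q r f x) = \int[mu]_x (f x * Q r (u \* u) x).
  by move=> uL u2L; rewrite -[RHS]/(ip f (Q r (u \* u))) -ip_sgop// ipC.
have e2 u : u \in L2 -> f \* u \in L2 ->
    \int[mu]_x (u x * Q r (f \* u) x) = \int[mu]_x (f x * u x * Q r u x).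
  by move=> uL fuL; rewrite -[LHS]/(ip u (Q r (f \* u))) -ip_sgop// ipC.
have e3 : \int[mu]_x (G x * Q r f x) = \int[mu]_x (f x * Q r G x).
  by rewrite -[RHS]/(ip f (Q r G)) -ip_sgop// ipC.
rewrite !e1// !e2// e3 !energyE// ipBl// ip_sgop//.
rewrite -[ip f (Q r G)]/(\int[mu]_x (f x * Q r G x)).
rewrite -[ip f G]/(\int[mu]_x (f x * G x)).
rewrite -/t2 => h.
rewrite -subr_ge0 -(pmulr_rge0 _ (ltr0Sn R 1)).
apply: le_trans h _; rewrite le_eqVlt; apply/orP; left; apply/eqP.
by do ?[move: (Rintegral mu _ _) => ?]; field.
Qed.

End dirichlet.

(** * Entropy and Fisher information along the flow of densities *)

(** All that the entropy and Fisher information estimates retain of the process; the initial point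
    comes back with the zero-one law. *)
Record density_flow d (E : measurableType d) (R : realType) (mu : probability E R)
    (P : R -> R.-pker E ~> E) (kappa : R) (f : R -> E -> R) : Prop := DensityFlow {
  df_kappa : 0 < kappa ;
  df_ge0 : forall t y, 0 < t -> 0 <= f t y ;
  df_gt0 : forall t, 0 < t -> {ae mu, forall y, 0 < f t y} ;
  df_int : forall t, 0 < t -> \int[mu]_y f t y = 1 ;
  df_flow : forall s t, 0 <= s -> 0 < t -> f (s + t) = sgop P s (f t) %[ae mu] ;
  df_dom : forall t, 0 < t -> let g := @ln R \o f t in
    [/\ Dom mu P (f t), Dom mu P g,
        Dom mu P (f t \* f t), Dom mu P (g \* g) & Dom mu P (f t \* g)] ;
  df_chain : forall t, 0 < t -> chain_rule mu P (@ln R) (f t) (@ln R \o f t) ;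
  df_curv : forall t, 0 < t -> curvature_criterion mu P kappa (@ln R \o f t) }.

Section flow.
Context d (E : measurableType d) (R : realType).
Variables (mu : probability E R) (P : R -> R.-pker E ~> E).
Variables (kappa : R) (f : R -> E -> R).
Hypothesis hP : markov_semigroup mu P.
Hypothesis hf : density_flow mu P kappa f.
Implicit Types (s t r : R) (w : E -> R).

Notation L2 := (Lfun mu 2%:E).
Notation ip := (ip mu).
Notation nrm := (nrm mu).
Notation D := (Dom mu P).
Notation L := (generator mu P).
Notation Q := (sgop P).
Notation g t := (@ln R \o f t).

Definition ent t := ip (f t) (g t).
(** Entropy production in the form that pairs with the generator; [fisherE] identifies it with the
    integral of [f_t Gamma(ln f_t)]. *)
Definition fisher t := - ip (L (f t)) (g t).

Lemma fD t : 0 < t -> D (f t). Proof. by move=> /(df_dom hf)[]. Qed.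
Lemma fL t : 0 < t -> f t \in L2. Proof. by move=> /fD/Dom_L2. Qed.
Lemma gD t : 0 < t -> D (g t). Proof. by move=> /(df_dom hf)[]. Qed.
Lemma gL t : 0 < t -> g t \in L2. Proof. by move=> /gD/Dom_L2. Qed.
Lemma f2L t : 0 < t -> f t \* f t \in L2. Proof. by move=> /(df_dom hf)[_ _ /Dom_L2]. Qed.
Lemma g2D t : 0 < t -> D (g t \* g t). Proof. by move=> /(df_dom hf)[]. Qed.
Lemma g2L t : 0 < t -> g t \* g t \in L2. Proof. by move=> /g2D/Dom_L2. Qed.
Lemma fgD t : 0 < t -> D (f t \* g t). Proof. by move=> /(df_dom hf)[]. Qed.
Lemma fgL t : 0 < t -> f t \* g t \in L2. Proof. by move=> /fgD/Dom_L2. Qed.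

Lemma curvE s t : 0 <= s -> 0 < t -> Gamma_defined mu P (Q s (g t)) (Q s (g t)).
Proof. by move=> s0 /(df_curv hf)/(_ s s0)[]. Qed.

Lemma flowE s t : 0 <= s -> 0 < t -> Q s (f t) = f (s + t) %[ae mu].
Proof. by move=> s0 t0; apply: filterS (df_flow hf s0 t0) => x h I; rewrite h. Qed.

Lemma QfD s t : 0 <= s -> 0 < t -> D (Q s (f t)).
Proof.
move=> s0 t0; apply: (gen_ae hP _ _ (df_flow hf s0 t0)).
  by apply: fD; rewrite ltr_wpDl.
by apply: L2_sgop => //; exact: fL.
Qed.

Lemma ip_Lf_shift s t w : 0 <= s -> 0 < t -> w \in L2 ->
  ip (L (f (s + t))) w = ip (L (f t)) (Q s w).
Proof.
move=> s0 t0 wL; rewrite -(gen_sgop hP s0 (fD t0) (QfD s0 t0) wL).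
apply: (ip_gen_ae hP) => //; [by apply: fD; rewrite ltr_wpDl|exact: QfD|exact: (df_flow hf)].
Qed.

Lemma ip_flow s t w : 0 <= s -> 0 < t -> w \in L2 ->
  ip (f (s + t)) w = ip (Q s (f t)) w.
Proof.
move=> s0 t0 wL; apply: ip_ael => //; [apply: fL; exact: ltr_wpDl | | exact: (df_flow hf)].
by apply: L2_sgop => //; exact: fL.
Qed.

Lemma flow_right t w : 0 < t -> w \in L2 ->
  r^-1 * ip (fun x => f (t + r) x - f t x) w @[r --> 0^'+] --> ip (L (f t)) w.
Proof.
move=> t0 wL; apply: cvg_trans (gen_ip_cst hP (fD t0) wL); apply: near_eq_cvg.
apply: near_ge0 => r r0; congr (_ * _).
have h1 := fL t0; have h2 : f (t + r) \in L2 by apply: fL; rewrite ltr_wpDr.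
have h3 := L2_sgop hP r0 h1.
by rewrite !ipBl// (addrC t) (ip_flow r0 t0 wL).
Qed.

(** Writing [f_t] as [P_(t/2) f_(t/2)] leaves room on the left within the semigroup, as the flow has
    no density at time 0. *)
Lemma flow_left t w : 0 < t -> w \in L2 ->
  r^-1 * ip (fun x => f t x - f (t - r) x) w @[r --> 0^'+] --> ip (L (f t)) w.
Proof.
move=> t0 wL; have t2 : 0 < t / 2 by rewrite divr_gt0.
have tE : t = t / 2 + t / 2 by field.
have := gen_left hP t2 (fD t2) (QfD (ltW t2) t2) wL.
rewrite (_ : ip (L (Q (t / 2) (f (t / 2)))) w = ip (L (f t)) w); last first.
  apply: (ip_gen_ae hP) => //; [exact: QfD (ltW t2) t2|exact: fD|].
  by apply: filterS (flowE (ltW t2) t2) => x; rewrite -tE.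
apply: cvg_trans; apply: near_eq_cvg.
apply: filterS (near_lt t2) => r /andP[r0 rt]; congr (_ * _).
have tr : 0 <= t / 2 - r by rewrite subr_ge0 ltW.
have trE : t - r = (t / 2 - r) + t / 2 by rewrite {1}tE; ring.
have h1 := fL t0; have h2 := fL t2.
have h3 : f (t - r) \in L2 by apply: fL; rewrite trE ltr_wpDl.
have h4 := L2_sgop hP tr h2; have h5 := L2_sgop hP (ltW t2) h2.
rewrite !ipBl// trE -(ip_flow tr t2 wL).
by rewrite -(ip_flow (ltW t2) t2 wL) -tE.
Qed.

Lemma nrm_flow_right t : 0 < t ->
  nrm (fun x => f (t + r) x - f t x) @[r --> 0^'+] --> 0.
Proof.
move=> t0; apply: cvg_trans (sgop_cont hP (fL t0)); apply: near_eq_cvg.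
apply: near_ge0 => r r0.
have h1 := fL t0; have h2 : f (t + r) \in L2 by apply: fL; rewrite ltr_wpDr.
have h3 := L2_sgop hP r0 h1.
apply: nrm_ae; try exact: L2B.
by apply: filterS (flowE r0 t0) => x e _; rewrite e// (addrC r).
Qed.

Lemma nrm_flow_left t : 0 < t ->
  nrm (fun x => f (t - r) x - f t x) @[r --> 0^'+] --> 0.
Proof.
move=> t0; have t2 : 0 < t / 2 by rewrite divr_gt0.
have tE : t = t / 2 + t / 2 by field.
apply: cvg_trans (left_cont hP t2 (fL t2)); apply: near_eq_cvg.
apply: filterS (near_lt t2) => r /andP[r0 rt].
have tr : 0 <= t / 2 - r by rewrite subr_ge0 ltW.
have trE : t - r = (t / 2 - r) + t / 2 by rewrite {1}tE; ring.
have h1 := fL t0; have h2 := fL t2.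
have h3 : f (t - r) \in L2 by apply: fL; rewrite trE ltr_wpDl.
have h4 := L2_sgop hP tr h2; have h5 := L2_sgop hP (ltW t2) h2.
apply: nrm_ae; try exact: L2B.
apply: filterS2 (flowE tr t2) (flowE (ltW t2) t2) => x e1 e2 _.
by rewrite e1// e2// -tE -trE.
Qed.

Lemma nrm_f_le s t : 0 < s -> s <= t -> nrm (f t) <= nrm (f s).
Proof.
move=> s0 st; have st0 : 0 <= t - s by rewrite subr_ge0.
have t0 := lt_le_trans s0 st.
rewrite (@nrm_ae _ _ _ _ (f t) (Q (t - s) (f s))).
- exact: nrm_sgop (fL s0).
- exact: fL.
- exact: L2_sgop (fL s0).
by have := df_flow hf st0 s0; rewrite subrK.
Qed.

Lemma nrm_f2_le s t : 0 < s -> s <= t -> nrm (f t \* f t) <= nrm (f s \* f s).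
Proof.
move=> s0 st; have st0 : 0 <= t - s by rewrite subr_ge0.
have t0 := lt_le_trans s0 st.
have [vL v] := L4_sgop hP st0 (fL s0) (f2L s0).
rewrite (@nrm_ae _ _ _ _ (f t \* f t) (fun x => Q (t - s) (f s) x * Q (t - s) (f s) x))//.
  exact: f2L.
have := df_flow hf st0 s0; rewrite subrK.
by apply: filterS => x e _ /=; rewrite e.
Qed.

(** The one place where the chain rule is used: [Gamma(ln f, g) = Gamma(f, g) / f] with
    [g = ln f]. *)
Lemma f_gammaE t : 0 < t ->
  f t \* Gamma mu P (g t) (g t) = Gamma mu P (f t) (g t) %[ae mu].
Proof.
move=> t0; apply: filterS2 (df_gt0 hf t0) (df_chain hf t0) => x fx /= -> _.
by rewrite derive1E (@derive_val _ _ _ _ _ _ _ (is_derive1_ln fx)) mulrA divff ?mul1r// lt0r_neq0.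
Qed.

(** In the integral of [Gamma(f, ln f)] the term [L (f ln f)] vanishes, and the other two are equal
    by symmetry of [L]. *)
Lemma fisherE t : 0 < t -> fisher t = \int[mu]_x (f t x * Gamma mu P (g t) (g t) x).
Proof.
move=> t0; have LfL := gen_L2 (fD t0); have LgL := gen_L2 (gD t0).
have i1 : intg mu (L (f t \* g t)) by apply: L2_intg; apply: gen_L2; exact: fgD.
have i2 := L2_intgM (fL t0) LgL; have i3 := L2_intgM (gL t0) LfL.
have iG : intg mu (Gamma mu P (f t) (g t)).
  by apply: intgZ; apply: intgB => //; exact: intgB.
have m1 : measurable_fun setT (fun x => f t x * Gamma mu P (g t) (g t) x).
  apply: measurable_funM; first exact: L2_meas (fL t0).
  apply: intg_meas (intg_Gamma _); split; [exact: gD|exact: gD|exact: g2D].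
rewrite (ae_Rint_eq m1 (intg_meas iG) (f_gammaE t0)).
rewrite /Gamma RintZ; last by apply: intgB => //; exact: intgB.
rewrite RintB//; last exact: intgB.
rewrite RintB// (ip_gen1 hP (fgD t0)).
rewrite -[\int[mu]_x (f t x * _)]/(ip (f t) (L (g t))) -(gen_sym hP (fD t0) (gD t0)).
rewrite -[\int[mu]_x (g t x * _)]/(ip (g t) (L (f t))) (ipC _ (g t)) /fisher.
by field.
Qed.

Lemma fisher_energy t : 0 < t ->
  r^-1 * energy mu P (f t) (g t) r @[r --> 0^'+] --> 2 * fisher t.
Proof.
move=> t0; rewrite fisherE//; apply: energy_cvg => //; [exact: fL|exact: fgL|].
by split; [exact: gD|exact: gD|exact: g2D].
Qed.

Lemma fisher_ge0 t : 0 < t -> 0 <= fisher t.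
Proof.
move=> t0; rewrite -(pmulr_rge0 _ (ltr0Sn R 1)).
apply: cvg_ge0 (fisher_energy t0); apply: near_ge0 => r r0.
rewrite mulr_ge0 ?invr_ge0// energy_ge0//; [exact: fL|exact: fgL| |exact: gL|exact: g2L].
by apply: aeW => x; exact: (df_ge0 hf).
Qed.

Lemma fQgL s t v : 0 <= s -> 0 < t -> 0 < v -> f v \* Q s (g t) \in L2.
Proof.
move=> s0 t0 v0; have QL := L2_sgop hP s0 (gL t0).
apply: L2_prod; [exact: L2_meas (fL v0)|exact: L2_meas QL|exact: f2L|].
by have [] := L4_sgop hP s0 (gL t0) (g2L t0).
Qed.

(** The curvature criterion integrated against [f_v]: as [P_s f_v = f_(s+v)], symmetry carries [P_s]
    from [Gamma g] to the density. *)
Lemma curvature_bound s v : 0 <= s -> 0 < v ->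
  \int[mu]_x (f v x * Gamma mu P (Q s (g (s + v))) (Q s (g (s + v))) x) <=
  expR (- (2 * kappa * s)) * fisher (s + v).
Proof.
move=> s0 v0; set t := s + v; have t0 : 0 < t by rewrite ltr_wpDl.
set GF := Gamma mu P _ _; set e := expR _.
have hG : Gamma_defined mu P (g t) (g t) by split; [exact: gD|exact: gD|exact: g2D].
have hF := curvE s0 t0; have e0 : 0 < e := expR_gt0 _.
have iG := intg_Gamma hG; have G0 := Gamma_ge0 hP hG; have GF0 := Gamma_ge0 hP hF.
set Gg := Gamma mu P (g t) (g t) in iG G0.
have ifG := intg_wGamma (fL t0) (fgL t0) hG.
have ifGF := intg_wGamma (fL v0) (fQgL s0 t0 v0) hF.
(* [Gamma] is nonnegative only almost everywhere. This version is nonnegative everywhere, so that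
   extended integrals apply without knowing that [f_v P_s u] is integrable. *)
pose u x := `|Gg x|.
have u0 x : 0 <= u x by exact: normr_ge0.
have mG := intg_meas iG.
have mu' : measurable_fun setT u by exact: measurableT_comp.
have iu : intg mu u := intg_norm iG.
have f0 x : 0 <= f v x by exact: (df_ge0 hf).
have mP : measurable_fun setT (fun x => \int[P s x]_z (u z)%:E)%E.
  apply: measurable_fun_integral_kernel => //; last exact/measurable_EFinP.
  by move=> U mU; exact: measurable_kernel.
have mf : measurable_fun setT (EFin \o f v) by apply/measurable_EFinP; exact: L2_meas (fL v0).
have mfP : measurable_fun setT (fun x => (f v x)%:E * \int[P s x]_z (u z)%:E)%E.
  exact: emeasurable_funM.
have pos x : (0 <= (f v x)%:E * \int[P s x]_z (u z)%:E)%E.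
  by rewrite mule_ge0 ?lee_fin// integral_ge0// => z _; rewrite lee_fin.
rewrite -lee_fin EFinM (fisherE t0) (EFin_Rint ifGF) (EFin_Rint ifG).
have -> : (\int[mu]_x ((f t \* Gg) x)%:E = \int[mu]_x ((f v x)%:E * \int[P s x]_z (u z)%:E))%E.
  rewrite (adjoint_ge0 hP s0 (fL v0))//; apply: ae_eq_integral => //.
  - by apply/measurable_EFinP; exact: intg_meas ifG.
  - apply: emeasurable_funM; apply/measurable_EFinP => //.
    exact: L2_meas (L2_sgop hP s0 (fL v0)).
  apply: filterS2 (flowE s0 v0) G0 => x e1 G0 _ /=.
  by rewrite e1// /u ger0_norm// EFinM.
rewrite -ge0_integralZl//; last by rewrite lee_fin ltW.
have nn : (\int[mu]_x ((f v \* GF) x)%:E = \int[mu]_x `|((f v \* GF) x)%:E|)%E.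
  apply: ae_eq_integral => //.
  - by apply/measurable_EFinP; exact: intg_meas ifGF.
  - by apply: measurableT_comp => //; apply/measurable_EFinP; exact: intg_meas ifGF.
  by apply: filterS GF0 => x GF0 _; rewrite gee0_abs// lee_fin mulr_ge0.
rewrite [leLHS]nn; apply: ae_ge0_le_integral => //.
- by apply: measurableT_comp => //; apply/measurable_EFinP; exact: intg_meas ifGF.
- by move=> x _; rewrite mule_ge0// lee_fin ltW.
- exact: measurable_funeM.
have [_ cc] := df_curv hf t0 s0.
have G0' : {ae mu, forall x, (Q s Gg x)%:E <= \int[P s x]_z (u z)%:E}%E.
  apply: filterS (ae_intgP hP s0 iG) => x ix.
  rewrite -EFin_Rint ?lee_fin; last exact: intg_norm.
  by apply: Rint_le => //; [exact: intg_norm|move=> z; exact: ler_norm].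
apply: filterS3 GF0 cc G0' => x GF0 cc G0' _.
rewrite /= ger0_norm; last exact: mulr_ge0.
rewrite EFinM muleCA lee_wpmul2l ?lee_fin//.
apply: (@le_trans _ _ (e%:E * (Q s Gg x)%:E)%E); first by rewrite -EFinM lee_fin.
by rewrite lee_wpmul2l// lee_fin ltW.
Qed.

(* With G = P_s ln f_(s+t), fisher (s+t) = - <L f_t, G>; in dirichlet_le the
   choice theta = e^(-2 kappa s) balances fisher t against the integral of
   f_t Gamma(G), which curvature bounds by e^(-2 kappa s) fisher (s+t). *)
Lemma fisher_decay s t : 0 <= s -> 0 < t ->
  fisher (s + t) <= expR (- (2 * kappa * s)) * fisher t.
Proof.
move=> s0 t0; set e := expR _; have e0 : 0 < e := expR_gt0 _.
have st0 : 0 < s + t by rewrite ltr_wpDl.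
set G := Q s (g (s + t)).
have GL : G \in L2 by apply: L2_sgop => //; exact: gL.
have [G2L _] := L4_sgop hP s0 (gL st0) (g2L st0).
have fGL := fQgL s0 st0 t0.
have h1 : r^-1 * - ip (fun x => Q r (f t) x - f t x) G @[r --> 0^'+] --> fisher (s + t).
  rewrite /fisher ip_Lf_shift//; last exact: gL.
  under eq_fun do rewrite mulrN; apply: cvgN.
  exact: gen_ip_cst (fD t0) GL.
have h2 : 2^-1 * (e / 2 * (r^-1 * energy mu P (f t) (g t) r) +
     (2 * e)^-1 * (r^-1 * energy mu P (f t) G r)) @[r --> 0^'+] -->
   2^-1 * (e / 2 * (2 * fisher t) + (2 * e)^-1 *
     (2 * \int[mu]_x (f t x * Gamma mu P G G x))).
  apply: cvgM; first exact: cvg_cst.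
  apply: cvgD; (apply: cvgM; first exact: cvg_cst).
    exact: fisher_energy.
  by apply: energy_cvg => //; [exact: fL|exact: curvE].
have h3 : fisher (s + t) <= 2^-1 * (e / 2 * (2 * fisher t) + (2 * e)^-1 *
     (2 * \int[mu]_x (f t x * Gamma mu P G G x))).
  apply: (ler_cvg_to h1 h2).
  apply: filterS (nbhs_right_gt (0 : R)) => r r0.
  have ri : 0 <= r^-1 by rewrite invr_ge0 ltW.
  have := ler_wpM2l ri (dirichlet_le hP (ltW r0) e0 (df_gt0 hf t0) (fL t0) (f2L t0)
    (gL t0) (g2L t0) (fgL t0) GL G2L).
  move=> /le_trans; apply; rewrite le_eqVlt; apply/orP; left; apply/eqP.
  by field; rewrite !lt0r_neq0.
(* Now [h3] reads [I(s+t) <= e / 2 * I(t) + I(s+t) / 2], and the last term is absorbed on the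
   left. *)
have h4 : (2 * e)^-1 * (2 * \int[mu]_x (f t x * Gamma mu P G G x)) <= fisher (s + t).
  have := curvature_bound s0 t0; rewrite -/e -/G => k.
  rewrite invfM mulrACA mulVf ?mul1r ?pnatr_eq0// mulrC ler_pdivrMr// mulrC.
  exact: k.
lra.
Qed.

Lemma fisher_mono s t : 0 < s -> s <= t -> fisher t <= fisher s.
Proof.
move=> s0 st; have st0 : 0 <= t - s by rewrite subr_ge0.
have := fisher_decay st0 s0; rewrite subrK => /le_trans; apply.
rewrite -[leRHS]mul1r ler_wpM2r ?fisher_ge0// -[leRHS]expR0 ler_expR oppr_le0.
by rewrite !mulr_ge0// ltW// (df_kappa hf).
Qed.

(** Convexity in place of differentiation: the tangent of [x ln x] at [f_t] is integrated, and its
    linear part cancels because both densities have mass 1. *)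
Lemma ent_diff s t : 0 < s -> 0 < t ->
  ent t - ent s <= ip (fun x => f t x - f s x) (g t).
Proof.
move=> s0 t0; have fs := fL s0; have ft := fL t0; have gt := gL t0.
rewrite ipBl// -[ip (f t) (g t)]/(ent t) lerD2l lerN2.
have i := L2_intgM fs gt.
have -> : ip (f s) (g t) = \int[mu]_x (f s x * g t x + f s x - f t x).
  rewrite RintB ?RintD//; try exact: L2_intg; last by apply: intgD => //; exact: L2_intg.
  by rewrite !(df_int hf)// addrK.
apply: ae_Rint_le; first by apply: intgB; [apply: intgD => //|]; exact: L2_intg.
  exact: L2_intgM fs (gL s0).
by apply: filterS (df_gt0 hf t0) => x fx; apply: gibbs => //; exact: (df_ge0 hf).
Qed.

Lemma ent_modulus s t c : 0 < s -> 0 < t -> 0 <= c ->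
  ent s - ent t <= (nrm (f s) + c) * nrm (fun x => f s x - f t x) + expR (- c - 1).
Proof.
move=> s0 t0 c0; have fs := fL s0; have ft := fL t0.
have dL : (fun x => `|f s x - f t x|) \in L2.
  apply: (L2_le _ _ (L2B fs ft)).
    by apply: measurableT_comp => //; exact: L2_meas (L2B fs ft).
  by move=> x; rewrite normr_id.
have nd : nrm (fun x => `|f s x - f t x|) = nrm (fun x => f s x - f t x).
  by congr Num.sqrt; apply: eq_Rintegral => x _; rewrite -normrM ger0_norm// -expr2 sqr_ge0.
have is_ := L2_intgM fs (gL s0); have it := L2_intgM ft (gL t0).
have i1 := L2_intgM fs dL; have i2 := intgZ c (L2_intg dL).
have i3 := intg_cst mu (expR (- c - 1)).
apply: (@le_trans _ _ (ip (f s) (fun x => `|f s x - f t x|) +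
   c * \int[mu]_x `|f s x - f t x| + expR (- c - 1))).
  rewrite -(Rint_cst mu (expR _)) -RintZ; last exact: L2_intg.
  rewrite /ip -RintD// -RintD//; last exact: intgD.
  rewrite /ent /ip -RintB//; apply: Rint_le; first exact: intgB.
    by apply: intgD => //; exact: intgD.
  by move=> x; apply: xlnx_modulus => //; exact: (df_ge0 hf).
rewrite lerD2r mulrDl lerD//.
  by rewrite -nd (le_trans (ler_norm _))// CS.
by rewrite ler_wpM2l// Rint_norm_le_nrm//; exact: L2B.
Qed.

Lemma ent_usc (M : R) (a b : R -> R) eps : 0 < eps -> 0 <= M ->
  (\forall r \near 0^'+, [/\ 0 < a r, 0 < b r & nrm (f (a r)) <= M]) ->
  nrm (fun x => f (a r) x - f (b r) x) @[r --> 0^'+] --> 0 ->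
  \forall r \near 0^'+, ent (a r) <= ent (b r) + eps.
Proof.
move=> eps0 M0 hab cab; pose c := Num.max 0 (- ln (eps / 2) - 1).
have e2 : 0 < eps / 2 by rewrite divr_gt0.
have c0 : 0 <= c by rewrite le_max lexx.
have ce : expR (- c - 1) <= eps / 2.
  rewrite -[leRHS]lnK ?posrE// ler_expR.
  have : - ln (eps / 2) - 1 <= c by rewrite le_max lexx orbT.
  lra.
have M1 : 0 < M + c + 1 by lra.
have d0 : 0 < eps / 2 / (M + c + 1) by rewrite divr_gt0.
have /cvgrPdist_le/(_ _ d0) := cab.
apply: filterS2 hab => r [a0 b0 nM]; rewrite sub0r normrN ger0_norm ?nrm_ge0// => h.
have := ent_modulus a0 b0 c0.
have : (nrm (f (a r)) + c) * nrm (fun x => f (a r) x - f (b r) x) <= eps / 2.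
  apply: (@le_trans _ _ ((M + c + 1) * (eps / 2 / (M + c + 1)))).
    by apply: ler_pM => //; rewrite ?nrm_ge0 ?addr_ge0 ?nrm_ge0//; lra.
  by rewrite mulrC divfK// lt0r_neq0.
lra.
Qed.

Lemma ent_right_usc t eps : 0 < t -> 0 < eps ->
  \forall r \near 0^'+, ent (t + r) <= ent t + eps.
Proof.
move=> t0 eps0; apply: (@ent_usc (nrm (f t)) (fun r => t + r) (fun=> t)) => //.
- exact: nrm_ge0.
- apply: near_ge0 => r r0; rewrite ltr_wpDr//; split => //.
  by apply: nrm_f_le => //; rewrite lerDl.
- exact: nrm_flow_right.
Qed.

Lemma ent_left_usc t eps : 0 < t -> 0 < eps ->
  \forall r \near 0^'+, ent (t - r) <= ent t + eps.
Proof.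
move=> t0 eps0; have t2 : 0 < t / 2 by rewrite divr_gt0.
apply: (@ent_usc (nrm (f (t / 2))) (fun r => t - r) (fun=> t)) => //.
- exact: nrm_ge0.
- apply: filterS (near_lt t2) => r /andP[r0 rt].
  have h : t / 2 <= t - r by lra.
  by split => //; [exact: lt_le_trans h|exact: nrm_f_le].
- exact: nrm_flow_left.
Qed.

Lemma ent_ge0 t : 0 < t -> 0 <= ent t.
Proof.
move=> t0; rewrite -(subrr (1 : R)) -{1}(df_int hf t0) -{1}(Rint_cst mu 1).
have i1 := intg_cst mu (1 : R).
rewrite -RintB//; last exact: L2_intg (fL t0).
apply: Rint_le; [apply: intgB => //; exact: L2_intg (fL t0)|exact: L2_intgM (fL t0) (gL t0)|].
move=> x; have := @gibbs R (f t x) 1 (df_ge0 hf _ t0) ltr01.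
by rewrite ln1 mulr0 add0r.
Qed.

(** For [v <= t] the left slope of the entropy at [v] is at most [- I(v) <= - I(t)], so
    [ent v + v * I(t)] is non-increasing up to [t]. *)
Lemma ent_drop s t : 0 < s -> s <= t -> (t - s) * fisher t <= ent s - ent t.
Proof.
move=> s0 st; have t0 := lt_le_trans s0 st.
suff : ent t + t * fisher t <= ent s + s * fisher t by lra.
apply: (@dini_left R (fun v => ent v + v * fisher t)) => //.
- move=> v sv vt eps eps0; have v0 := lt_trans s0 sv.
  have /cvgrPdist_le/(_ _ eps0) := flow_left v0 (gL v0).
  apply: filterS2 (near_lt v0) => r /andP[r0 rv]; rewrite ler_norml => /andP[h _].
  have vr : 0 < v - r by rewrite subr_gt0.
  have := ent_diff vr v0; have := fisher_mono v0 vt; rewrite {2}/fisher.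
  set A := ip (L (f v)) _ in h *; set B := ip (fun x => _) _ in h *.
  move=> k1 k2.
  have {}h : r^-1 * B <= A + eps by lra.
  have {h}h : B <= r * (A + eps).
    by have := ler_wpM2l (ltW r0) h; rewrite mulrA divff ?mul1r// lt0r_neq0.
  have := ler_wpM2l (ltW r0) k1; nra.
- move=> v sv vt eps eps0; have v0 := lt_le_trans s0 sv.
  have If := fisher_ge0 t0.
  have e2 : 0 < eps / 2 by rewrite divr_gt0.
  have r1 : \forall r \near (0 : R)^'+, r <= eps / 2 / (fisher t + 1).
    by apply: nbhs_right_le; rewrite divr_gt0// ltr_wpDl.
  apply: filterS3 (ent_right_usc v0 e2) (nbhs_right_gt (0 : R)) r1 => r k r0.
  rewrite ler_pdivlMr ?ltr_wpDl// => k2.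
  lra.
Qed.

(** The bound [I(v) <= e^(-2 kappa (v - s)) I(s)] on the entropy production is integrated in [v]. *)
Lemma ent_le_fisher s t : 0 < s -> s <= t -> ent s - ent t <= fisher s / (2 * kappa).
Proof.
move=> s0 st; have k0 : 0 < 2 * kappa by rewrite mulr_gt0// (df_kappa hf).
suff : (fun v => - ent v) t - (fun v => - ent v) s <= fisher s / (2 * kappa) by rewrite opprK addrC.
apply: (@dini_exp R (fun v => - ent v) s t _ _ st (fisher_ge0 s0) k0).
- move=> v sv vt; have v0 := lt_le_trans s0 sv.
  exists (fisher v), (fun r => - ip (fun x => f (v + r) x - f v x) (g v)); split.
  + have vs : 0 <= v - s by rewrite subr_ge0.
    by have := fisher_decay vs s0; rewrite subrK mulrC.
  + apply: near_ge0 => r r0; have vr : 0 < v + r by rewrite ltr_wpDr.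
    have := ent_diff vr v0; rewrite /= !ipBl ?gL ?fL//; lra.
  + by under eq_fun do rewrite mulrN; apply: cvgN; apply: flow_right => //; exact: gL.
- move=> v sv vt eps eps0; have v0 := lt_trans s0 sv.
  by apply: filterS (ent_left_usc v0 eps0) => r /=; lra.
Qed.

(** With [F u = P_u (ln f_t)], the pairing [phi u] of [f_(t-u)] with [(F u)^2] decreases at rate at
    most twice the integral of [f_(t-u) Gamma(F u)], which curvature bounds by
    [2 e^(-2 kappa u) I(t)]; the integral over [u] is at most [I(t) / kappa]. *)
Lemma local_poincare s t : 0 < t -> 0 <= s -> s < t ->
  ip (f t) (g t \* g t) -
    ip (f (t - s)) (fun x => Q s (g t) x * Q s (g t) x) <= fisher t / kappa.
Proof.
move=> t0 s0 st.
pose F s := Q s (g t); pose F2 s := fun x => F s x * F s x.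
pose phi s := ip (f (t - s)) (F2 s).
have k0 := df_kappa hf; have k20 : 0 < 2 * kappa by rewrite mulr_gt0.
have FL u : 0 <= u -> F u \in L2 by move=> u0; apply: L2_sgop => //; exact: gL.
have F2L u : 0 <= u -> F2 u \in L2.
  by move=> u0; have [] := L4_sgop hP u0 (gL t0) (g2L t0).
have F2M u : 0 <= u -> nrm (F2 u) <= nrm (g t \* g t).
  by move=> u0; have [] := L4_sgop hP u0 (gL t0) (g2L t0).
have -> : ip (f t) (g t \* g t) = phi 0.
  rewrite /phi subr0; apply: ip_ae => //; [exact: fL|exact: fL|exact: g2L|exact: F2L|exact: aeW|].
  by apply: filterS (sgop0 hP (gL t0)) => x e _; rewrite /F2 /F e.
rewrite -[X in _ - X]/(phi s).
suff : (fun v => - phi v) s - (fun v => - phi v) 0 <= 2 * fisher t / (2 * kappa).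
  by rewrite opprK addrC -mulf_div divff ?mul1r// pnatr_eq0.
apply: (@dini_exp R (fun v => - phi v) 0 s) => //; first by rewrite mulr_ge0// fisher_ge0.
- move=> u u0 us; have ut := lt_trans us st; set v := t - u.
  have v0 : 0 < v by rewrite subr_gt0.
  have tE : t = u + v by rewrite /v; ring.
  have hF : Gamma_defined mu P (F u) (F u) := curvE u0 t0.
  have [FD _ F2D] := hF.
  have fFL : f v \* F u \in L2 := fQgL u0 t0 v0.
  (* The square of [F (u + r)] is bounded below by its tangent at [F u], so that only [F] has to be
     differentiated and not its square. *)
  exists (2 * \int[mu]_x (f v x * Gamma mu P (F u) (F u) x)),
    (fun r => ip (fun x => f v x - f (v - r) x) (F2 u)
      - 2 * ip (f (v - r) \* F u) (fun x => Q r (F u) x - F u x)); split.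
  + rewrite subr0 -mulrA ler_pM2l// mulrC.
    by have := curvature_bound u0 v0; rewrite -tE.
  + apply: filterS (near_lt v0) => r /andP[r0 rv].
    have vr : 0 < v - r by rewrite subr_gt0.
    have ur : 0 <= u + r by rewrite addr_ge0// ltW.
    have fvr := fL vr; have fv := fL v0.
    have fFr := fQgL u0 t0 vr; rewrite -/(F u) in fFr.
    have QF := L2_sgop hP (ltW r0) (FL _ u0).
    have e : Q r (F u) = F (u + r) %[ae mu].
      by apply: filterS (sgopD hP (ltW r0) u0 (gL t0)) => x e I; rewrite -e// addrC.
    have tE' : t - (u + r) = v - r by rewrite /v; ring.
    rewrite /phi -/v tE' ipBl ?F2L//.
    suff : ip (f (v - r)) (F2 u) + 2 * ip (f (v - r) \* F u) (fun x => Q r (F u) x - F u x)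
        <= ip (f (v - r)) (F2 (u + r)).
      by do ?[move: (ip _ _) => ?]; lra.
    have i1 := L2_intgM fvr (F2L _ u0); have i2 := L2_intgM fvr (F2L _ ur).
    have i3 := L2_intgM fFr (L2B QF (FL _ u0)).
    rewrite /ip -RintZ// -RintD//; last exact: intgZ.
    apply: ae_Rint_le => //; first by apply: intgD => //; exact: intgZ.
    apply: filterS e => x e; rewrite /F2 -e//=.
    have fx := df_ge0 hf x vr; rewrite -subr_ge0.
    have -> : f (v - r) x * (Q r (F u) x * Q r (F u) x) -
      (f (v - r) x * (F u x * F u x) + 2 * (f (v - r) x * F u x * (Q r (F u) x - F u x)))
      = f (v - r) x * (Q r (F u) x - F u x) ^+ 2 by ring.
    by rewrite mulr_ge0// sqr_ge0.
  + have LF := gen_L2 FD; have LF2 := gen_L2 F2D; have fv := fL v0.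
    have v2 : 0 < v / 2 by rewrite divr_gt0.
    have -> : 2 * \int[mu]_x (f v x * Gamma mu P (F u) (F u) x) =
        ip (L (f v)) (F2 u) - 2 * ip (f v \* F u) (L (F u)).
      have i1 := L2_intgM fv LF2; have i2 := L2_intgM fFL LF.
      rewrite (gen_sym hP (fD v0) F2D) /ip -!RintZ//; last exact: intg_wGamma.
      rewrite -RintB//; last exact: intgZ.
      by apply: eq_Rintegral => x _; rewrite /Gamma/=; field.
    pose c r x := r^-1 * (Q r (F u) x - F u x).
    pose q r x := (f (v - r) x - f v x) * F u x.
    have lc : \forall r \near 0^'+, c r \in L2.
      apply: near_ge0 => r r0; apply: L2Z; apply: L2B; last exact: FL.
      by apply: L2_sgop => //; exact: FL.
    have gc := gen_cvg hP (generatorP FD).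
    have near_v : \forall r \near 0^'+, 0 < v - r /\ v / 2 <= v - r /\ 0 < r.
      by apply: filterS (near_lt v2) => r /andP[r0 rv]; split; [lra|split => //; lra].
    have qr : \forall r \near 0^'+, q r \in L2.
      apply: filterS near_v => r [vr _].
      rewrite (_ : q r = fun x => (f (v - r) \* F u) x - (f v \* F u) x).
        exact: L2B (fQgL u0 t0 vr) fFL.
      by apply/funext => x; rewrite /q mulrBl.
    (* The factors of [q r] converge in L^2, hence [q r] tends to 0 in L^1; fourth moments of [f],
       bounded by those at time [v / 2], keep it bounded in L^2. *)
    have qc : ip (q r) (c r) @[r --> 0^'+] --> 0.
      apply: (@ip_cvg0_weak _ _ _ _ _ _ _ _ _
        (2 * Num.sqrt (nrm (f (v / 2) \* f (v / 2)) * nrm (F2 u))) (L (F u))) => //.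
        apply: filterS near_v => r [vr [v2r _]].
        have nf a : v / 2 <= a -> nrm (f a \* F u) <= Num.sqrt (nrm (f (v / 2) \* f (v / 2)) * nrm (F2 u)).
          move=> va; have a0 := lt_le_trans v2 va.
          apply: (le_trans (nrm_prod _ _ _ _)); [exact: L2_meas (fL a0)|
            exact: L2_meas (FL _ u0)|exact: f2L|exact: F2L|].
          by rewrite ler_wsqrtr// ler_wpM2r ?nrm_ge0// nrm_f2_le.
        have := nrmB (fQgL u0 t0 vr) fFL.
        rewrite (_ : (fun x => _) = q r); last by apply/funext => x; rewrite /q mulrBl.
        move=> /le_trans; apply; rewrite mulr_natl mulr2n; apply: lerD; apply: nf => //.
        lra.
      apply: (@squeeze0 _ _ (fun r => nrm (fun x => f (v - r) x - f v x) * nrm (F u))).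
        apply: filterS near_v => r [vr _]; rewrite Rintegral_ge0//=.
        by apply: Rint_norm_prod; [apply: L2B => //; exact: fL|exact: FL].
      rewrite -[X in _ --> X](mul0r (nrm (F u))); apply: cvgM; last exact: cvg_cst.
      exact: nrm_flow_left.
    have fc : ip (f v \* F u) (c r) @[r --> 0^'+] --> ip (f v \* F u) (L (F u)).
      apply: (ip_cvg _ _ lc fFL LF _ gc); first exact: nearW.
      by under eq_fun do rewrite nrm_subrr; exact: cvg_cst.
    have H : r^-1 * ip (fun x => f v x - f (v - r) x) (F2 u) -
        2 * (ip (q r) (c r) + ip (f v \* F u) (c r)) @[r --> 0^'+] -->
        ip (L (f v)) (F2 u) - 2 * (0 + ip (f v \* F u) (L (F u))).
      apply: cvgB; first exact: flow_left (F2L _ u0).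
      by apply: cvgM; [exact: cvg_cst|exact: cvgD].
    rewrite add0r in H.
    apply: cvg_trans H; apply: near_eq_cvg.
    apply: filterS3 lc near_v qr => r cL [vr [_ r0]] qrL.
    have QFr : (fun x => Q r (F u) x - F u x) \in L2.
      by apply: L2B; [apply: L2_sgop => //; [exact: ltW|exact: FL]|exact: FL].
    rewrite /= mulrBr; congr (_ - _); rewrite mulrCA; congr (_ * _).
    rewrite -ipDl// -ipZr//; last exact: (fQgL u0 t0 vr).
    by apply: eq_Rintegral => x _; rewrite /q /c /=; ring.
- move=> u u0 us eps eps0; have ut := le_lt_trans us st; set v := t - u.
  have v0 : 0 < v by rewrite subr_gt0.
  have fv := fL v0; have u0' := ltW u0.
  (* A difference of squares, controlled in L^1 by [(F (u - r) - F u) (F (u - r) + F u)] and bounded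
     in L^2. *)
  pose N := nrm (g t \* g t); pose q r x := F2 (u - r) x - F2 u x.
  have near_u : \forall r \near 0^'+, 0 <= r /\ 0 <= u - r.
    by apply: filterS (near_lt u0) => r /andP[r0 ru]; rewrite subr_ge0 !ltW.
  have lq : ip (q r) (f v) @[r --> 0^'+] --> 0.
    apply: (@ip_cvg0_L1 _ _ _ _ _ _ _ _ (N + N)) => //.
    + apply: filterS near_u => r [r0 ur]; apply: L2B; exact: F2L.
    + apply: filterS near_u => r [r0 ur].
      by apply: (le_trans (nrmB (F2L _ ur) (F2L _ u0'))); rewrite lerD// F2M.
    apply: (@squeeze0 _ _ (fun r => nrm (fun x => F (u - r) x - F u x) * (nrm (g t) + nrm (g t)))).
      apply: filterS near_u => r [r0 ur]; rewrite Rintegral_ge0//=.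
      have Fr := FL _ ur; have Fu := FL _ u0'.
      have := Rint_norm_prod (L2B Fr Fu) (L2D Fr Fu).
      rewrite (_ : (fun x => _) = (fun x => `|q r x|)); last first.
        by apply/funext => x; rewrite /q /F2; congr `|_|; ring.
      move=> /le_trans; apply; rewrite ler_wpM2l ?nrm_ge0//.
      apply: (le_trans (nrmD Fr Fu)).
      by rewrite lerD// /F nrm_sgop// gL.
    rewrite -[X in _ --> X](mul0r (nrm (g t) + nrm (g t))); apply: cvgM; last exact: cvg_cst.
    exact: left_cont (gL t0).
  have lf : nrm (fun x => f (v + r) x - f v x) * N @[r --> 0^'+] --> 0.
    rewrite -[X in _ --> X](mul0r N); apply: cvgM; last exact: cvg_cst.
    exact: nrm_flow_right.
  have e2 : 0 < eps / 2 by rewrite divr_gt0.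
  have /cvgrPdist_le/(_ _ e2) lq' := lq.
  have /cvgrPdist_le/(_ _ e2) := lf.
  apply: filterS3 near_u lq' => r [r0 ur]; rewrite !sub0r !normrN.
  move=> /(le_trans (ler_norm _)) h1 /(le_trans (ler_norm _)) h2.
  have vr : 0 < v + r by rewrite ltr_wpDr.
  have h3 : ip (fun x => f (v + r) x - f v x) (F2 (u - r)) <= eps / 2.
    apply: le_trans h2; apply: (le_trans (ler_norm _)).
    apply: (le_trans (CS _ (F2L _ ur))); first by apply: L2B => //; exact: fL.
    by rewrite ler_wpM2l ?nrm_ge0// F2M.
  have tE : t - (u - r) = v + r by rewrite /v; ring.
  rewrite /phi -/v tE.
  move: h1 h3; rewrite ipBl ?F2L ?fL// /q ipBl ?F2L// !(ipC _ (f v)).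
  do ?[move: (ip _ _) => ?]; lra.
Qed.

End flow.

(** * Fast Cauchy sequences in L^1 *)

Section fast_cauchy.
Context d (T : measurableType d) (R : realType).
Variable m : probability T R.

(** The sum [S] of the absolute increments is integrable, hence finite almost everywhere: the
    sequence converges there and is dominated by [|u 0| + S]. *)
Lemma fast_L1_cvg (u : nat -> T -> R) :
  (forall n, intg m (u n)) ->
  (forall n, \int[m]_x `|u n.+1 x - u n x| <= 2^-1 ^+ n) ->
  exists v, [/\ intg m v, {ae m, forall x, u n x @[n --> \oo] --> v x} &
    \int[m]_x `|u n x - v x| @[n --> \oo] --> 0].
Proof.
move=> iu hu; pose del n x := `|u n.+1 x - u n x|.
have del0 n x : 0 <= del n x by exact: normr_ge0.
have idel n : intg m (del n) by apply: intg_norm; exact: intgB.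
have mdel n : measurable_fun setT (EFin \o del n).
  by apply/measurable_EFinP; exact: intg_meas (idel n).
pose S x := (\sum_(0 <= n <oo) (del n x)%:E)%E.
have S0 x : (0 <= S x)%E by apply: nneseries_ge0 => n _ _; rewrite lee_fin.
have mS : measurable_fun setT S.
  apply: ge0_emeasurable_sum; last by move=> n _; exact: mdel.
  by move=> n x _ _; rewrite lee_fin.
have iS : m.-integrable setT S.
  apply/integrableP; split => //.
  under eq_integral do rewrite gee0_abs//.
  have -> : (\int[m]_x S x = \sum_(0 <= n <oo) \int[m]_x (del n x)%:E)%E.
    by apply: integral_nneseries => // n x _; rewrite lee_fin.
  have geo n : \sum_(0 <= k < n) (2^-1 : R) ^+ k <= 2 - 2 * 2^-1 ^+ n.
    elim: n => [|n ih]; first by rewrite big_nil expr0 mulr1 subrr.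
    rewrite big_nat_recr//= exprS; lra.
  apply: (@le_lt_trans _ _ 2%:E); last exact: ltry.
  apply: lime_le; first by apply: is_cvg_nneseries => n _ _; apply: integral_ge0 => x _; rewrite lee_fin.
  apply: nearW => n; apply: (@le_trans _ _ (\sum_(0 <= k < n) (2^-1 ^+ k)%:E)%E).
    by apply: lee_sum => k _; rewrite -(EFin_Rint (idel k)) lee_fin; exact: hu.
  rewrite sumEFin lee_fin; apply: (le_trans (geo n)).
  by rewrite gerBl mulr_ge0// exprn_ge0.
pose F x := limn_esup (fun n => (u n x)%:E).
have mu n : measurable_fun setT (EFin \o u n).
  by apply/measurable_EFinP; exact: intg_meas (iu n).
have mF : measurable_fun setT F by exact: measurable_fun_limn_esup.
have tele n x : u n x = u 0%N x + \sum_(0 <= k < n) (u k.+1 x - u k x).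
  by rewrite telescope_sumr// addrC subrK.
have partial n x : ((\sum_(0 <= k < n) del k x)%:E <= S x)%E.
  by rewrite -sumEFin; apply: nneseries_lim_ge => k _ _; rewrite lee_fin.
have cF : {ae m, forall x, exists2 l : R, F x = l%:E & u n x @[n --> \oo] --> l}.
  apply: filterS (integrable_ae measurableT iS) => x /(_ Logic.I) fS.
  have cd : cvgn (series (del ^~ x)).
    apply: nondecreasing_is_cvgn.
      apply/nondecreasing_seqP => n.
      by rewrite seriesSr lerDl.
    exists (fine (S x)) => _ [n _ <-]; rewrite -lee_fin fineK//.
    exact: partial.
  have /cvg_ex[l cl] : cvgn (series (fun k => u k.+1 x - u k x)) by exact: normed_cvg cd.
  have cu : u n x @[n --> \oo] --> u 0%N x + l.
    under eq_fun do rewrite tele.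
    by apply: cvgD; [exact: cvg_cst|exact: cl].
  exists (u 0%N x + l) => //.
  have cu' : (u n x)%:E @[n --> \oo] --> (u 0%N x + l)%:E by apply: cvg_EFin => //; exact: nearW.
  by rewrite /F (cvg_limn_einf_sup cu').
pose v x := fine (F x).
have mv : measurable_fun setT v by exact: measurableT_comp.
have cv : {ae m, forall x, u n x @[n --> \oo] --> v x}.
  by apply: filterS cF => x [l Fl ul]; rewrite /v Fl.
pose G x := (`|u 0%N x|%:E + S x)%E.
have iG : m.-integrable setT G by apply: integrableD => //; exact: intg_norm.
have uG x n : (`|(u n x)%:E| <= G x)%E.
  apply: (@le_trans _ _ (`|u 0%N x| + \sum_(0 <= k < n) del k x)%:E).
    rewrite lee_fin tele (le_trans (ler_normD _ _))// lerD2l.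
    exact: ler_norm_sum.
  by rewrite EFinD leeD2l.
have cv' : {ae m, forall x, setT x -> (EFin \o u n) x @[n --> \oo] --> (EFin \o v) x}.
  by apply: filterS cv => x h _; apply: cvg_EFin => //; exact: nearW.
have [iv H _] := @dominated_convergence _ _ _ m setT measurableT
  (fun n => EFin \o u n) (EFin \o v) G mu ((measurable_EFinP _ _).2 mv)
  cv' iG
  (aeW _ (fun x n (_ : setT x) => uG x n)).
exists v; split => //.
apply: fine_cvg; apply: cvg_trans H; apply: near_eq_cvg; apply: nearW => n /=.
by apply: eq_integral.
Qed.

End fast_cauchy.

(** * The Markov process and its right-continuous past *)

Section sigma_past.
Context d (E : measurableType d) (R : realType).
Context d' (Omega : measurableType d') (Pr : probability Omega R).
Variable X : R -> {RV Pr >-> E}.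

Lemma past_measurable s : past X s `<=` measurable.
Proof.
apply: smallest_sub; first exact: sigma_algebra_measurable.
move=> _ [r [B [r0 rs mB ->]]].
by rewrite -[X in measurable X]setTI; exact: (measurable_funPT (X r)).
Qed.

Lemma right_past_measurable s : right_past X s `<=` measurable.
Proof. by move=> A /(_ (s + 1)); rewrite ltrDl => /(_ ltr01)/past_measurable. Qed.

Lemma past_mono s r : s <= r -> past X s `<=` past X r.
Proof.
move=> sr; apply: sub_sigma_algebra2 => _ [q [B [q0 qs mB ->]]].
by exists q, B; split => //; exact: le_trans sr.
Qed.

Lemma past_right_past s A : past X s A -> right_past X s A.
Proof. by move=> sA r sr; exact: (past_mono (ltW sr)). Qed.

Lemma past_preimage s r B : 0 <= r -> r <= s -> measurable B ->
  past X s (X r @^-1` B).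
Proof. by move=> r0 rs mB; apply: sub_sigma_algebra; exists r, B. Qed.

Lemma past_setT s : past X s setT.
Proof.
have := @sigma_algebraCD _ setT _ _ (@sigma_algebra0 _ setT
  [set A | exists r B, [/\ 0 <= r, r <= s, measurable B & A = X r @^-1` B]]).
by rewrite setD0.
Qed.

Lemma past_bigcup s (A : (set Omega)^nat) : (forall n, past X s (A n)) ->
  past X s (\bigcup_n A n).
Proof. by move=> h; exact: sigma_algebra_bigcup. Qed.

Lemma past_setC s A : past X s A -> past X s (~` A).
Proof. by move=> h; rewrite -setTD; exact: sigma_algebraCD. Qed.

Lemma past_bigcap s (A : (set Omega)^nat) : (forall n, past X s (A n)) ->
  past X s (\bigcap_n A n).
Proof.
move=> h; rewrite -(setCK (\bigcap_n A n)); apply: past_setC.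
by rewrite setC_bigcap; apply: past_bigcup => n; exact: past_setC.
Qed.

End sigma_past.

Section process.
Context d (E : measurableType d) (R : realType).
Variables (mu : probability E R) (P : R -> R.-pker E ~> E).
Context d' (Omega : measurableType d') (Pr : probability Omega R).
Variables (X : R -> {RV Pr >-> E}) (f : R -> E -> R).
Hypothesis hP : markov_semigroup mu P.
Hypothesis hX : markov_process X P.
Hypothesis hd : forall t, 0 < t -> has_density mu (X t) (f t).

Notation L2 := (Lfun mu 2%:E).
Notation ip := (ip mu).
Notation Q := (sgop P).

Lemma f_ge0 t y : 0 < t -> 0 <= f t y.
Proof. by move=> /hd[_ + _]; exact. Qed.

Lemma f_meas t : 0 < t -> measurable_fun setT (f t).
Proof. by move=> /hd[]. Qed.

Lemma ge0_law t (u : E -> \bar R) : 0 < t -> (forall y, 0 <= u y)%E ->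
  measurable_fun setT u ->
  (\int[Pr]_w u (X t w) = \int[mu]_y ((f t y)%:E * u y))%E.
Proof.
move=> t0 u0 mu'; have [mf f0 hf] := hd t0.
have := @ge0_integral_distribution _ _ _ _ _ Pr (X t) u mu' u0; rewrite /comp => <-.
exact: (@ge0_integral_density _ _ _ mu (distribution Pr (X t)) (f t)).
Qed.

Lemma intg_law t (u : E -> R) : 0 < t -> measurable_fun setT u ->
  intg mu (fun y => f t y * u y) -> intg Pr (fun w => u (X t w)).
Proof.
move=> t0 mu' /integrableP[_ iu]; apply/integrableP; split.
  by apply/measurable_EFinP; exact: measurableT_comp.
under eq_integral do rewrite /=.
rewrite (@ge0_law t (fun y => `|u y|%:E)%E)//; last first.
  by apply/measurable_EFinP; exact: measurableT_comp.
apply: le_lt_trans iu; rewrite le_eqVlt; apply/orP; left; apply/eqP.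
by apply: eq_integral => y _ /=; rewrite normrM ger0_norm// f_ge0.
Qed.

Lemma Rint_law_ge0 t (u : E -> R) : 0 < t -> measurable_fun setT u ->
  (forall y, 0 <= u y) -> intg mu (fun y => f t y * u y) ->
  \int[Pr]_w u (X t w) = \int[mu]_y (f t y * u y).
Proof.
move=> t0 mu' u0 iu; congr fine; rewrite (@ge0_law t (fun y => (u y)%:E))//.
exact/measurable_EFinP.
Qed.

Lemma Rint_law t (u : E -> R) : 0 < t -> measurable_fun setT u ->
  intg mu (fun y => f t y * u y) ->
  \int[Pr]_w u (X t w) = \int[mu]_y (f t y * u y).
Proof.
move=> t0 mu' iu.
pose p y := (u y + `|u y|); pose n y := `|u y|.
have mn : measurable_fun setT n by exact: measurableT_comp.
have mp : measurable_fun setT p by exact: measurable_funD.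
have ifn : intg mu (fun y => f t y * n y).
  apply: (le_intg _ _ (intg_norm iu)).
    by apply: measurable_funM => //; exact: f_meas.
  by move=> y; rewrite !normrM /n normr_id.
have ifp : intg mu (fun y => f t y * p y).
  by have := intgD iu ifn; under eq_fun do rewrite -mulrDr.
have p0 y : 0 <= p y by rewrite /p -lerBlDl sub0r -normrN ler_norm.
transitivity (\int[Pr]_w (p (X t w) - n (X t w))).
  by apply: eq_Rintegral => w _; rewrite /p addrK.
rewrite RintB; [|exact: intg_law|exact: intg_law].
rewrite (Rint_law_ge0 t0 mp p0 ifp) (Rint_law_ge0 t0 mn _ ifn); last first.
  by move=> y; exact: normr_ge0.
rewrite -RintB//.
by apply: eq_Rintegral => y _; rewrite /p /n; ring.
Qed.

Lemma law_next s t B : 0 <= s -> 0 < t -> measurable B ->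
  Pr (X (s + t) @^-1` B) = (\int[mu]_y ((f t y)%:E * P s y B))%E.
Proof.
move=> s0 t0 mB.
have pT : right_past X t setT by apply: past_right_past; exact: past_setT.
have := hX (ltW t0) s0 pT mB.
rewrite setTI addrC => ->; rewrite (@ge0_law t (fun y => P s y B))//.
exact: measurable_kernel.
Qed.

(** By the Markov property [X (s + t)] has law [f_t mu P_s], and symmetry of [P_s] turns this into
    the density [P_s f_t]. *)
Lemma density_next s t : 0 <= s -> 0 < t -> f t \in L2 -> f (s + t) \in L2 ->
  f (s + t) = Q s (f t) %[ae mu].
Proof.
move=> s0 t0 fL fL'; have st0 : 0 < s + t by rewrite ltr_wpDl.
have QfL := L2_sgop hP s0 fL.
apply: Rint_indic_ae; [exact: L2_intg|exact: L2_intg|move=> A mA].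
have A1L := L2_indic mu mA; have QA := L2_sgop hP s0 A1L.
apply: EFin_inj.
transitivity (Pr (X (s + t) @^-1` A)).
  have [_ _ hA] := hd st0.
  rewrite -[RHS]/(distribution Pr (X (s + t)) A) hA//.
  rewrite EFin_Rint; last exact: L2_intgM.
  rewrite [RHS]integral_mkcond; apply: eq_integral => y _.
  by rewrite patchE indicE; case: (_ \in _); rewrite ?mul1r ?mul0r.
rewrite law_next//.
have -> : \int[mu]_x (\1_A x * Q s (f t) x) = ip (f t) (Q s \1_A).
  by rewrite -(ip_sgop hP s0 fL A1L) ipC.
rewrite EFin_Rint; last exact: L2_intgM.
apply: eq_integral => y _; rewrite EFinM sgop_indic// fineK//.
exact: P_fin.
Qed.

Section time0.
Variable x0 : E.
Hypothesis start : {ae Pr, forall w, X 0 w = x0}.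

(** Because [X 0] is deterministic, the Markov property at time 0 factors out the number
    [P_t(x0, B)]; the case of the sure event identifies it as the probability that [X t] is in
    [B]. *)
Lemma indep0 t A B : 0 <= t -> right_past X 0 A -> measurable B ->
  Pr (A `&` X t @^-1` B) = (Pr A * Pr (X t @^-1` B))%E.
Proof.
move=> t0 pA mB; have mA := right_past_measurable pA.
have key C : right_past X 0 C -> Pr (C `&` X t @^-1` B) = (Pr C * P t x0 B)%E.
  move=> pC; have mC := right_past_measurable pC.
  have := hX (lexx 0) t0 pC mB; rewrite add0r => ->.
  rewrite (ae_eq_integral (cst (P t x0 B)))//.
  - by rewrite integral_cst// muleC.
  - apply: measurable_funTS.
    exact: measurableT_comp (measurable_kernel (P t) B mB) (measurable_funPT (X 0)).
  - by apply: filterS start => w -> _.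
have pT : right_past X 0 setT by apply: past_right_past; exact: past_setT.
have := key _ pT.
by rewrite setTI probability_setT mul1e key// => ->.
Qed.

Lemma ge0_indep0 t A (u : E -> \bar R) : 0 <= t -> right_past X 0 A ->
  (forall y, 0 <= u y)%E -> measurable_fun setT u ->
  (\int[Pr]_w ((\1_A w)%:E * u (X t w)) = Pr A * \int[Pr]_w u (X t w))%E.
Proof.
move=> t0 pA u0 mu'; have mA := right_past_measurable pA.
have pf : Pr A \is a fin_num by exact: fin_num_measure.
pose c := NngNum (fine_ge0 (measure_ge0 Pr A)).
have cE : (c%:num)%:E = Pr A by rewrite /= fineK.
pose nu : {measure set E -> \bar R} := mscale c (distribution Pr (X t)).
have := @ge0_integral_mixture _ _ _ _ R Pr
  (fun w => \d_(X t w) : {measure set E -> \bar R}) (\1_A : Omega -> R) nu.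
move=> H; have {}H := H _ _ _ _ u u0 mu'.
transitivity (\int[nu]_z u z)%E.
  rewrite H.
  - by apply: eq_integral => w _; rewrite integral_dirac// diracT mul1e.
  - move=> U mU.
    exact: (measurableT_comp (measurable_fun_dirac (D := setT) mU) (measurable_funPT (X t))).
  - by move=> w; rewrite indicE.
  - exact: measurable_indic.
  - move=> U mU; transitivity (Pr A * Pr (X t @^-1` U))%E.
      by rewrite -cE.
    have mXU : measurable (X t @^-1` U).
      by rewrite -[X in measurable X]setTI; exact: (measurable_funPT (X t)).
    rewrite -(indep0 t0 pA mU) -[in LHS](setIT (A `&` _)) -integral_indic//; last exact: measurableI.
    apply: eq_integral => w _.
    rewrite -[X in (_ * X)%E]/((\1_U (X t w))%:E) !indicE in_setI.
    rewrite (_ : (w \in X t @^-1` U) = (X t w \in U)); last by apply/idP/idP; rewrite !inE.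
    by case: (w \in A); case: (_ \in U); rewrite /= -EFinM ?mul1r ?mul0r.
rewrite ge0_integral_mscale// cE; congr (_ * _)%E.
exact: ge0_integral_distribution.
Qed.

Lemma Rint_indep0 t A (u : E -> R) : 0 < t -> right_past X 0 A ->
  measurable_fun setT u -> intg mu (fun y => f t y * u y) ->
  \int[Pr]_w (\1_A w * u (X t w)) = fine (Pr A) * \int[Pr]_w u (X t w).
Proof.
move=> t0 pA mu' iu; have mA := right_past_measurable pA.
have pf : Pr A \is a fin_num by exact: fin_num_measure.
have iX := intg_law t0 mu' iu.
pose p y := (u y + `|u y|); pose n y := `|u y|.
have mn : measurable_fun setT n by exact: measurableT_comp.
have mp : measurable_fun setT p by exact: measurable_funD.
have n0 y : 0 <= n y by exact: normr_ge0.
have p0 y : 0 <= p y by rewrite /p -lerBlDl sub0r -normrN ler_norm.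
have inX : intg Pr (fun w => n (X t w)) by exact: intg_norm.
have ipX : intg Pr (fun w => p (X t w)) by exact: intgD.
have key (v : E -> R) : measurable_fun setT v -> (forall y, 0 <= v y) ->
    intg Pr (fun w => v (X t w)) ->
    intg Pr (fun w => \1_A w * v (X t w)) /\
    \int[Pr]_w (\1_A w * v (X t w)) = fine (Pr A) * \int[Pr]_w v (X t w).
  move=> mv v0 iv.
  have iAv : intg Pr (fun w => \1_A w * v (X t w)).
    apply: (le_intg _ _ iv).
      by apply: measurable_funM => //; exact: intg_meas iv.
    move=> w; rewrite normrM [X in _ * X]ger0_norm// ler_piMl// indicE.
    by case: (_ \in _); rewrite ?normr1 ?normr0.
  split => //; apply: EFin_inj; rewrite EFin_Rint// EFinM fineK// EFin_Rint//.
  under eq_integral do rewrite EFinM.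
  apply: (@ge0_indep0 t A (fun y => (v y)%:E)) => //; first exact: ltW.
  exact/measurable_EFinP.
have [i1 e1] := key p mp p0 ipX; have [i2 e2] := key n mn n0 inX.
transitivity (\int[Pr]_w (\1_A w * p (X t w) - \1_A w * n (X t w))).
  by apply: eq_Rintegral => w _; rewrite /p /n; ring.
rewrite RintB// e1 e2 -mulrBr -RintB//; congr (_ * _).
by apply: eq_Rintegral => w _; rewrite /p /n addrK.
Qed.

End time0.

(** On rectangles this is the Markov property; Dynkin's theorem extends it to the product
    sigma-algebra. *)
Lemma joint_law s t (U : set (E * E)) : 0 < s -> 0 <= t -> measurable U ->
  Pr [set w | U (X s w, X (s + t) w)] =
  (\int[mu]_y ((f s y)%:E * P t y (xsection U y)))%E.
Proof.
move=> s0 t0 mU.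
have mXX : measurable_fun setT (fun w => (X s w, X (s + t) w)).
  by apply: measurable_fun_pair; exact: (measurable_funPT (X _)).
have mpre (V : set (E * E)) : measurable V -> measurable [set w | V (X s w, X (s + t) w)].
  by move=> mV; rewrite -[X in measurable X]setTI; exact: mXX.
have mfs : measurable_fun setT (EFin \o f s) by apply/measurable_EFinP; exact: f_meas.
have mk (V : set (E * E)) : measurable V -> measurable_fun setT (fun y => P t y (xsection V y)).
  by move=> mV; apply: measurable_fun_xsection_finite_kernel; rewrite inE.
have fk0 y V : (0 <= (f s y)%:E * P t y V)%E by rewrite mule_ge0 ?lee_fin ?f_ge0.
have tot : (\int[mu]_y (f s y)%:E = 1)%E.
  have := @ge0_law s (cst 1%E) s0 (fun=> lee01) (measurable_cst _).
  rewrite integral_cst// mul1e -[X in (X = _)%E]/(Pr setT) probability_setT => ->.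
  by apply: eq_integral => y _; rewrite mule1.
pose PU (V : set (E * E)) := Pr [set w | V (X s w, X (s + t) w)] =
  (\int[mu]_y ((f s y)%:E * P t y (xsection V y)))%E.
have gen := measurable_prod_measurableType E E.
apply: (@dynkin_induction _ _ _ PU gen).
- move=> _ _ [A mA [B mB <-]] [C mC [D mD <-]].
  exists (A `&` C); first exact: measurableI.
  exists (B `&` D); first exact: measurableI.
  by rewrite setXI.
- rewrite /PU (_ : [set w | _] = setT)// probability_setT -tot.
  apply: eq_integral => y _; rewrite (_ : xsection _ _ = setT) ?P_setT ?mule1//.
  by rewrite xsectionE preimage_setT.
- move=> _ [A mA [B mB <-]]; rewrite /PU.
  have pA : right_past X s (X s @^-1` A).
    by apply: past_right_past; apply: past_preimage => //; exact: ltW.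
  have := hX (ltW s0) t0 pA mB.
  rewrite (_ : _ `&` _ = [set w | (A `*` B) (X s w, X (s + t) w)])// => ->.
  rewrite integral_mkcond.
  pose v y := ((\1_A y)%:E * P t y B)%E.
  have mv : measurable_fun setT v.
    apply: emeasurable_funM; last exact: measurable_kernel.
    by apply/measurable_EFinP; exact: measurable_indic.
  transitivity (\int[Pr]_w v (X s w))%E.
    apply: eq_integral => w _; rewrite patchE /v indicE.
    rewrite (_ : (w \in X s @^-1` A) = (X s w \in A)); last by apply/idP/idP; rewrite !inE.
    by case: ifP => _; rewrite ?mul1e ?mul0e.
  rewrite ge0_law//; last by move=> y; rewrite mule_ge0// lee_fin indicE.
  apply: eq_integral => y _; congr (_ * _)%E; rewrite /v indicE.
  have [yA|yA] := boolP (y \in A); first by rewrite in_xsectionX// mul1e.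
  by rewrite notin_xsectionX// measure0 mul0e.
- move=> V mV hV; rewrite /PU.
  have mPV := mpre _ mV.
  rewrite (_ : [set w | _] = ~` [set w | V (X s w, X (s + t) w)])// probability_setC//.
  rewrite -tot hV.
  have fin : (\int[mu]_y ((f s y)%:E * P t y (xsection V y)))%E \is a fin_num.
    by rewrite -hV fin_num_measure.
  have iC := mk _ (measurableC mV).
  rewrite -[X in (X - _)%E](_ : (\int[mu]_y ((f s y)%:E * P t y (xsection (~` V) y)) +
     \int[mu]_y ((f s y)%:E * P t y (xsection V y)))%E = _) ?addeK//.
  rewrite -ge0_integralD//; [|exact: emeasurable_funM|by apply: emeasurable_funM => //; exact: mk].
  apply: eq_integral => y _; rewrite -ge0_muleDr//.
  rewrite -measureU//.
  + have -> : xsection (~` V) y `|` xsection V y = setT.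
      by rewrite !xsectionE preimage_setC setUC setUv.
    by rewrite -[X in (_ * X)%E]/(P t y setT) P_setT mule1.
  + by apply: measurable_xsection; exact: measurableC.
  + exact: measurable_xsection.
  + by rewrite !xsectionE preimage_setC setICl.
- move=> F mF tF hF; rewrite /PU.
  rewrite (_ : [set w | _] = \bigcup_n [set w | F n (X s w, X (s + t) w)])//.
  rewrite measure_semi_bigcup//; last 3 first.
  + by move=> n; exact: mpre.
  + apply/trivIsetP => i j _ _ ij; have /trivIsetP/(_ _ _ Logic.I Logic.I ij) FF := tF.
    apply/seteqP; split => w // [a b].
    have : (F i `&` F j) (X s w, X (s + t) w) by split.
    by rewrite FF.
  + by apply: bigcup_measurable => n _; exact: mpre.
  rewrite (eq_eseriesr (fun n _ => hF n)).
  rewrite -integral_nneseries//; last first.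
    by move=> n; apply: emeasurable_funM => //; exact: mk.
  apply: eq_integral => y _; rewrite nneseriesZl//.
  congr (_ * _)%E; rewrite xsection_bigcup measure_semi_bigcup//.
  + by move=> n; exact: measurable_xsection.
  + apply/trivIsetP => i j _ _ ij; have /trivIsetP/(_ _ _ Logic.I Logic.I ij) := tF.
    by rewrite -xsectionI => ->; rewrite xsection0.
  + by apply: bigcup_measurable => n _; exact: measurable_xsection.
- by rewrite -gen.
Qed.

Lemma ge0_joint s t (W : E * E -> \bar R) : 0 < s -> 0 <= t ->
  (forall z, 0 <= W z)%E -> measurable_fun setT W ->
  (\int[Pr]_w W (X s w, X (s + t) w) =
   \int[mu]_y ((f s y)%:E * \int[P t y]_z W (y, z)))%E.
Proof.
move=> s0 t0 W0 mW.
have mXX : measurable_fun setT (fun w => (X s w, X (s + t) w)).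
  by apply: measurable_fun_pair; exact: (measurable_funPT (X _)).
have mp (y : E) : measurable_fun setT (fun z : E => (y, z)) by apply: measurable_fun_pair; [exact: measurable_cst|exact: measurable_id].
pose nu : {measure set (E * E) -> \bar R} := pushforward Pr (fun w => (X s w, X (s + t) w)).
pose k (y : E) : {measure set (E * E) -> \bar R} := pushforward (P t y) (fun z : E => (y, z)).
have := @ge0_integral_mixture _ _ _ _ R mu (k mp) (f s) (nu mXX).
move=> H; have {}H := H _ _ _ _ W W0 mW.
transitivity (\int[nu mXX]_z W z)%E; first by rewrite ge0_integral_pushforward.
rewrite H.
- by apply: eq_integral => y _; rewrite ge0_integral_pushforward.
- move=> U mU.
  have : measurable_fun setT (fun y => P t y (xsection U y)).
    by apply: measurable_fun_xsection_finite_kernel; rewrite inE.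
  by under eq_fun do rewrite xsectionE.
- by move=> y; exact: f_ge0.
- exact: f_meas.
- move=> U mU; rewrite -[LHS]/(Pr [set w | U (X s w, X (s + t) w)]).
  by rewrite joint_law//; apply: eq_integral => y _; rewrite xsectionE.
Qed.

End process.

(** * The zero-one law at time 0 *)

Section zero_one.
Context d (E : measurableType d) (R : realType).
Variables (mu : probability E R) (P : R -> R.-pker E ~> E).
Context d' (Omega : measurableType d') (Pr : probability Omega R).
Variables (X : R -> {RV Pr >-> E}) (f : R -> E -> R) (x0 : E).
Hypothesis hP : markov_semigroup mu P.
Hypothesis hX : markov_process X P.
Hypothesis hd : forall t, 0 < t -> has_density mu (X t) (f t).
Hypothesis start : {ae Pr, forall w, X 0 w = x0}.
Hypothesis fL : forall t, 0 < t -> f t \in Lfun mu 2%:E.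

Notation L2 := (Lfun mu 2%:E).
Notation Q := (sgop P).

Let ip_next s t v : 0 <= s -> 0 < t -> v \in L2 ->
  ip mu (f (s + t)) v = ip mu (f t) (Q s v).
Proof.
move=> s0 t0 vL; have st0 : 0 < s + t by rewrite ltr_wpDl.
have Qf := L2_sgop hP s0 (fL t0).
rewrite -(ip_sgop hP s0 (fL t0) vL); apply: ip_ael => //; first exact: fL.
exact: density_next hP hX hd _ _ s0 t0 (fL t0) (fL st0).
Qed.

Let compL2 t v : 0 < t -> v \in L2 -> v \* v \in L2 ->
  (fun w => v (X t w)) \in Lfun Pr 2%:E.
Proof.
move=> t0 vL v2L; have mv := L2_meas vL; apply/L2P; split.
  by apply: measurableT_comp => //; exact: (measurable_funPT (X t)).
apply: (intg_law (f := f) hd t0 (u := v \* v)); first exact: measurable_funM.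
exact: L2_intgM (fL t0) v2L.
Qed.

(** As [u (X s)] is the conditional expectation of [v (X (s + a))] given [X s], the cross term of
    the expanded square is twice the second moment of [u (X s)]. *)
Lemma martingale_var s a u v : 0 < s -> 0 <= a -> v \in L2 -> v \* v \in L2 ->
  u \in L2 -> u \* u \in L2 -> u = Q a v %[ae mu] ->
  \int[Pr]_w ((v (X (s + a) w) - u (X s w)) * (v (X (s + a) w) - u (X s w))) =
  ip mu (f (s + a)) (v \* v) - ip mu (f s) (u \* u).
Proof.
move=> s0 a0 vL v2L uL u2L uE.
have mv := L2_meas vL; have mu' := L2_meas uL.
pose W (p : E * E) := ((v p.2 - u p.1) * (v p.2 - u p.1))%:E.
have W0 p : (0 <= W p)%E by rewrite lee_fin -expr2 sqr_ge0.
have mW : measurable_fun setT W.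
  apply/measurable_EFinP.
  have m1 : measurable_fun setT (fun p : E * E => v p.2 - u p.1).
    apply: measurable_funB; first exact: (measurableT_comp mv measurable_snd).
    exact: (measurableT_comp mu' measurable_fst).
  exact: measurable_funM.
have Qv2 := L2_sgop hP a0 v2L.
have i1 := L2_intgM (fL s0) Qv2; have i2 := L2_intgM (fL s0) u2L.
have -> : ip mu (f (s + a)) (v \* v) = ip mu (f s) (Q a (v \* v)).
  by rewrite addrC ip_next.
rewrite /ip -RintB// /Rintegral; congr fine.
rewrite (ge0_joint hX hd s0 a0 W0 mW).
apply: ae_eq_integral => //.
- apply: emeasurable_funM; first by apply/measurable_EFinP; exact: L2_meas (fL s0).
  by apply: (measurable_fun_integral_finite_kernel W (P a)).
- by apply/measurable_EFinP; exact: intg_meas (intgB i1 i2).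
apply: filterS3 uE (ae_intgP hP a0 (L2_intg vL)) (ae_intgP hP a0 (L2_intg v2L)).
move=> y /(_ Logic.I) uy iv iv2 _.
pose l : seq (R * (E -> R)) := [:: (1, v \* v); (-2 * u y, v); (u y * u y, fun=> 1)].
have il : all_intg (P a y) l by split => //; split => //; split => //; exact: P_intg_cst.
have := Rint_lin il; rewrite !big_cons big_nil/=.
under eq_Rintegral do rewrite !big_cons big_nil/=.
rewrite -[\int[P a y]_x v x]/(Q a v y) -uy -[\int[P a y]_x 1]/(Q a (fun=> 1) y) (sgop_cst P).
rewrite -[\int[P a y]_x (v x * v x)]/(Q a (v \* v) y) => e.
have -> : (\int[P a y]_z W (y, z) = (Q a (v \* v) y - u y * u y)%:E)%E.
  transitivity (\int[P a y]_x (1 * (v x * v x) + (- 2 * u y * v x + (u y * u y * 1 + 0))))%:E.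
    rewrite EFin_Rint; first by apply: eq_integral => z _; congr EFin; rewrite /=; ring.
    have := intg_lin il; congr intg; apply/funext => z.
    by rewrite !big_cons big_nil.
  by rewrite e; congr EFin; ring.
by rewrite -EFinM mulrBr.
Qed.

(* M_s = P_(t-s) w (X_s) is a martingale on ]0, t], so it converges in L^2 as s
   decreases to 0. The limit v is measurable with respect to the right-continuous
   past at time 0, hence constant. *)
Lemma blumenthal t w C : 0 < t -> w \in L2 -> w \* w \in L2 ->
  (forall s, 0 < s -> s < t ->
    ip mu (f t) (w \* w) - ip mu (f s) (fun y => Q (t - s) w y * Q (t - s) w y) <= C) ->
  ip mu (f t) (w \* w) - (\int[mu]_y (f t y * w y)) ^+ 2 <= C.
Proof.
move=> t0 wL w2L hC.
pose F s := Q (t - s) w; pose M s := fun om => F s (X s om).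
pose e s := ip mu (f s) (F s \* F s).
pose c := \int[mu]_y (f t y * w y).
have FL s : s <= t -> F s \in L2.
  by move=> st; apply: L2_sgop => //; rewrite subr_ge0.
have F2L s : s <= t -> F s \* F s \in L2.
  by move=> st; have [] := @L4_sgop _ _ _ _ _ hP (t - s) w; rewrite ?subr_ge0.
have ML s : 0 < s -> s <= t -> M s \in Lfun Pr 2%:E.
  by move=> s0 st; apply: compL2 => //; [exact: FL|exact: F2L].
have Mt : (fun om => w (X t om)) \in Lfun Pr 2%:E by exact: compL2.
have EM s : 0 < s -> s <= t -> \int[Pr]_om M s om = c.
  move=> s0 st; rewrite (Rint_law hd s0 (L2_meas (FL _ st)) (L2_intgM (fL s0) (FL _ st))).
  have ts : 0 <= t - s by rewrite subr_ge0.
  by have := ip_next ts s0 wL; rewrite subrK /ip => <-.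
have var s r : 0 < s -> s <= r -> r <= t -> ip Pr (fun om => M r om - M s om)
    (fun om => M r om - M s om) = e r - e s.
  move=> s0 sr rt; have st := le_trans sr rt.
  have rs : 0 <= r - s by rewrite subr_ge0.
  have tr : 0 <= t - r by rewrite subr_ge0.
  have h : F s = Q (r - s) (F r) %[ae mu].
    by apply: filterS (sgopD hP rs tr wL) => y h I; rewrite -h// /F; congr (Q _ w y); ring.
  have := martingale_var s0 rs (FL _ rt) (F2L _ rt) (FL _ st) (F2L _ st) h.
  by rewrite addrC subrK.
have Et s : 0 < s -> s < t -> ip Pr (M s) (fun om => w (X t om)) = e s.
  move=> s0 st; have ts : 0 <= t - s by rewrite subr_ge0 ltW.
  have st' := ltW st; have Ms := ML _ s0 st'.
  have := martingale_var s0 ts wL w2L (FL _ st') (F2L _ st') (aeW _ (fun y _ => erefl)).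
  rewrite addrC subrK.
  rewrite -[LHS]/(ip Pr (fun om => w (X t om) - M s om) (fun om => w (X t om) - M s om)).
  rewrite ipBl ?ipBr ?L2B// (ipC _ (fun om => w _) (M s)).
  have -> : ip Pr (fun om => w (X t om)) (fun om => w (X t om)) = ip mu (f t) (w \* w).
    by apply: (Rint_law hd t0 (u := w \* w)); [exact: L2_meas w2L|exact: L2_intgM (fL t0) w2L].
  have -> : ip Pr (M s) (M s) = e s.
    apply: (Rint_law hd s0 (u := F s \* F s)); [exact: L2_meas (F2L _ st')|].
    exact: L2_intgM (fL s0) (F2L _ st').
  rewrite -/(e s); lra.
have e_mono s r : 0 < s -> s <= r -> r <= t -> e s <= e r.
  by move=> s0 sr rt; rewrite -subr_ge0 -(var _ _ s0 sr rt) ip_ge0.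
have e_ge0 s : 0 < s -> s <= t -> 0 <= e s.
  move=> s0 st; apply: Rintegral_ge0 => y _.
  by rewrite mulr_ge0 ?(f_ge0 hd)//= -expr2 sqr_ge0.
pose S := [set e s | s in [set s | 0 < s /\ s <= t]].
have S0 : S !=set0 by exists (e t); exists t => //.
have iS : has_inf S by split => //; exists 0 => _ [s [s0 st] <-]; exact: e_ge0.
(* A squared increment of the martingale is an increment of [e], so an excess of [4^-n] over the
   infimum gives increments of norm at most [2^-n]. The bound [t / (n + 2)] sends the times to 0 and
   keeps them below [t] even for [n = 0]. *)
have /choice[sq hsq] : forall n : nat, exists s,
    [/\ 0 < s, s < t, s <= t / n.+2%:R & e s <= inf S + (4^-1) ^+ n].
  move=> n; have p0 : 0 < (4^-1 : R) ^+ n by rewrite exprn_gt0.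
  have [_ [q [q0 qt] <-] hq] := inf_adherent p0 iS.
  have tn0 : 0 < t / n.+2%:R by rewrite divr_gt0.
  have tnt : t / n.+2%:R < t by rewrite ltr_pdivrMr// ltr_pMr// ltr1n.
  exists (Num.min q (t / n.+2%:R)); split.
  - by rewrite lt_min q0.
  - by rewrite gt_min tnt orbT.
  - by rewrite ge_min lexx orbT.
  - apply: le_trans (ltW hq); apply: e_mono => //; first by rewrite lt_min q0.
    by rewrite ge_min lexx.
have infS s : 0 < s -> s <= t -> inf S <= e s.
  by move=> s0 st; apply: ge_inf; [case: iS|exists s].
pose u n := M (sq n).
have uL n : u n \in Lfun Pr 2%:E by have [s0 /ltW st _ _] := hsq n; exact: ML.
have udiff n : nrm Pr (fun om => u n.+1 om - u n om) <= 2^-1 ^+ n.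
  have [s0 /ltW st _ es] := hsq n; have [r0 /ltW rt _ er] := hsq n.+1.
  have p2 : 0 <= (2^-1 : R) ^+ n by rewrite exprn_ge0.
  rewrite -(@ler_pXn2r _ 2)// ?nnegrE ?nrm_ge0// nrm_sqr -exprM mulnC exprM.
  have -> : (2^-1 : R) ^+ 2 = 4^-1 by field.
  have q4 : (4^-1 : R) ^+ n.+1 <= 4^-1 ^+ n.
    by rewrite exprS ler_piMl ?exprn_ge0//; lra.
  have i1 := infS _ s0 st; have i2 := infS _ r0 rt.
  have [le|/ltW le] := leP (sq n) (sq n.+1).
    rewrite [leLHS](var _ _ s0 le rt) lerBlDr addrC.
    by apply: (le_trans er); exact: lerD i1 q4.
  rewrite -nrm_sqr nrmBC nrm_sqr [leLHS](var _ _ r0 le st) lerBlDr addrC.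
  by apply: (le_trans es); rewrite lerD2r.
have iu n : intg Pr (u n) := L2_intg (uL n).
have [v [iv cv l1v]] := fast_L1_cvg iu (fun n => le_trans (Rint_norm_le_nrm (L2B (uL _) (uL _))) (udiff n)).
have intA A : measurable A -> forall z, intg Pr z -> intg Pr (fun om => \1_A om * z om).
  move=> mA z iz; apply: (le_intg _ _ (intg_norm iz)).
    by apply: measurable_funM => //; exact: intg_meas iz.
  move=> om; rewrite normrM ler_piMl// indicE.
  by case: (_ \in _); rewrite ?normr1 ?normr0.
have EA A : right_past X 0 A -> \int[Pr]_om (\1_A om * v om) = fine (Pr A) * c.
  move=> pA; have mA := right_past_measurable pA.
  have h n : \int[Pr]_om (\1_A om * u n om) = fine (Pr A) * c.
    have [s0 /ltW st _ _] := hsq n; rewrite -(EM _ s0 st).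
    exact: (Rint_indep0 hX hd start s0 pA (L2_meas (FL _ st)) (L2_intgM (fL s0) (FL _ st))).
  apply/eqP; rewrite -subr_eq0 -normr_le0; apply/ler_addgt0Pr => eps e0; rewrite add0r.
  have /cvgrPdist_le/(_ _ e0)[n _ /(_ n (leqnn n))/=] := l1v.
  rewrite sub0r normrN ger0_norm ?Rintegral_ge0// => k; apply: le_trans k.
  have iA1 := intA _ mA _ (iu n); have iA2 := intA _ mA _ iv.
  rewrite -(h n) distrC -RintB//.
  apply: (le_trans (le_normr_Rintegral _ _)) => //; first exact: intgB.
  apply: Rint_le; [exact: intg_norm (intgB iA1 iA2)|exact: intg_norm (intgB (iu n) iv)|].
  move=> om; rewrite -mulrBr normrM ler_piMl// indicE.
  by case: (_ \in _); rewrite ?normr1 ?normr0.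
have vle k : {ae Pr, forall om, v om <= c + k.+1%:R^-1}.
  pose del : R := k.+1%:R^-1; have del0 : 0 < del by rewrite invr_gt0.
  (* The event that [u n > c + del] infinitely often is decided by arbitrarily early times, so it
     lies in the right past of 0. On it [v >= c + del], while independence makes the mean of [v]
     over it equal to [c] times its probability, which must therefore be 0. *)
  pose A := [set om | forall m, exists n, c + del < u (n + m)%N om].
  have pA : right_past X 0 A.
    move=> r r0; have [N hN] : exists N : nat, t / N.+2%:R <= r.
      exists (Num.bound (t / r)); rewrite ler_pdivrMr// mulrC -ler_pdivrMr//.
      apply: (@le_trans _ _ (Num.bound (t / r))%:R); last by rewrite ler_nat ltnW.
      by rewrite ltW// archi_boundP// divr_ge0// ltW.
    have -> : A = \bigcap_m \bigcup_n [set om | c + del < u (n + (m + N))%N om].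
      apply/seteqP; split => om h.
        by move=> m _; have [n hn] := h (m + N)%N; exists n.
      by move=> m; have [n _ hn] := h m Logic.I; exists (n + N)%N; rewrite -addnA (addnC N).
    apply: past_bigcap => m; apply: past_bigcup => n.
    have [s0 st sn _] := hsq (n + (m + N))%N.
    have -> : [set om | c + del < u (n + (m + N))%N om] =
        X (sq (n + (m + N))%N) @^-1` (F (sq (n + (m + N))%N) @^-1` `]c + del, +oo[).
      by apply/seteqP; split => om /=; rewrite in_itv/= andbT.
    apply: past_preimage; first exact: ltW.
      apply: (le_trans sn); apply: le_trans hN; rewrite ler_pM2l// lef_pV2 ?posrE//.
      by rewrite ler_nat !ltnS addnA leq_addl.
    rewrite -[X in measurable X]setTI; exact: (L2_meas (FL _ (ltW st))).
  have mA := right_past_measurable pA.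
  have cvA : {ae Pr, forall om, (c + del) * \1_A om <= \1_A om * v om}.
    apply: filterS cv => om cvo; rewrite indicE; have [oA|oA] := boolP (om \in A); last first.
      by rewrite mulr0 mul0r.
    rewrite mulr1 mul1r; rewrite inE in oA; rewrite leNgt; apply/negP => lt.
    have d0 : 0 < c + del - v om by rewrite subr_gt0.
    have /cvgrPdist_lt/(_ _ d0)[m _ hm] := cvo.
    have [n hn] := oA m; have := hm (n + m)%N (leq_addl _ _); rewrite /= ltr_norml => /andP[+ _].
    lra.
  have i1 : intg Pr (\1_A : Omega -> R).
    have := intA _ mA _ (intg_cst Pr 1); congr intg.
    by apply/funext => om; rewrite mulr1.
  have PA : \int[Pr]_om (\1_A om : R) = fine (Pr A).
    by rewrite /Rintegral integral_indic// setIT.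
  have := ae_Rint_le (intgZ (c + del) i1) (intA _ mA _ iv) cvA.
  rewrite RintZ// EA// PA => h.
  have pf : Pr A \is a fin_num by exact: fin_num_measure.
  have p0 : fine (Pr A) = 0.
    apply/eqP; rewrite eq_le fine_ge0// andbT.
    have : del * fine (Pr A) <= 0 by lra.
    by rewrite pmulr_rle0.
  have PA0 : Pr A = 0%E by rewrite -(fineK pf) p0.
  have nA : {ae Pr, forall om, ~ A om}.
    by exists A; split => // om /= /contrapT.
  apply: filterS2 cv nA => om cvo nAo; rewrite leNgt; apply/negP => lt.
  apply: nAo => m.
  have d0 : 0 < v om - (c + del) by rewrite subr_gt0.
  have /cvgrPdist_lt/(_ _ d0)[m' _ hm] := cvo.
  exists m'; have := hm (m' + m)%N (leq_addr _ _); rewrite /= ltr_norml => /andP[_].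
  lra.
have Ev : \int[Pr]_om v om = c.
  have pT : right_past X 0 setT by apply: past_right_past; exact: past_setT.
  have := EA _ pT; rewrite probability_setT mul1r => <-.
  by apply: eq_Rintegral => om _; rewrite indicT mul1r.
(* The upper bound suffices, since [v] has mean [c]. *)
have vc : v = (fun=> c) %[ae Pr].
  have le_c : {ae Pr, forall om, v om <= c}.
    have := ae_foralln vle; apply: filterS => om h.
    apply/ler_addgt0Pr => eps e0; apply: (le_trans (h (Num.bound eps^-1))).
    rewrite lerD2l invf_ple ?posrE//; apply: ltW; apply: (lt_le_trans (archi_boundP _)).
      by rewrite invr_ge0 ltW.
    by rewrite ler_nat.
  have icv := intgB (intg_cst Pr c) iv.
  have h0 : \int[Pr]_om `|c - v om| = 0.
    transitivity (\int[Pr]_om (c - v om)); last by rewrite RintB ?Rint_cst ?Ev ?subrr//; exact: intg_cst.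
    apply: ae_Rint_eq; [exact: intg_meas (intg_norm icv)|exact: intg_meas icv|].
    by apply: filterS le_c => om h _; rewrite ger0_norm// subr_ge0.
  have := Rint_eq0 (intg_meas (intg_norm icv)) (fun _ => normr_ge0 _) (intg_norm icv) h0.
  by apply: filterS => om /(_ Logic.I)/= /normr0_eq0/eqP; rewrite subr_eq0 => /eqP <-.
have cu : \int[Pr]_om `|u n om - c| @[n --> \oo] --> 0.
  apply: cvg_trans l1v; apply: near_eq_cvg; apply: nearW => n.
  apply: ae_Rint_eq; [exact: intg_meas (intg_norm (intgB (iu n) iv))|
    exact: intg_meas (intg_norm (intgB (iu n) (intg_cst Pr c)))|].
  by apply: filterS vc => om h _; rewrite h.
have cL : (fun=> c) \in Lfun Pr 2%:E := L2_cst Pr c.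
(* This inner product equals [e (sq n) - c^2], so [e] tends to [c^2] along [sq]. *)
have lim_e : ip Pr (fun om => u n om - c) (fun om => w (X t om)) @[n --> \oo] --> 0.
  apply: (@ip_cvg0_L1 _ _ _ _ _ _ _ _ (Num.sqrt (e t) + nrm Pr (fun=> c))) => //.
    by apply: nearW => n; exact: L2B.
  apply: nearW => n; apply: (le_trans (nrmB (uL n) cL)); rewrite lerD2r.
  have [s0 /ltW st _ _] := hsq n; apply: ler_wsqrtr.
  have -> : ip Pr (u n) (u n) = e (sq n).
    apply: (Rint_law hd s0 (u := F (sq n) \* F (sq n))); [exact: L2_meas (F2L _ st)|].
    exact: L2_intgM (fL s0) (F2L _ st).
  exact: e_mono.
rewrite -/c; apply/ler_addgt0Pr => eps e0.
have /cvgrPdist_le/(_ _ e0)[n _ /(_ n (leqnn n))/=] := lim_e.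
have [s0 st _ _] := hsq n.
rewrite sub0r normrN ipBl// Et//.
have -> : ip Pr (fun=> c) (fun om => w (X t om)) = c ^+ 2.
  rewrite /ip RintZ; last exact: L2_intg Mt.
  by rewrite (Rint_law hd t0 (L2_meas wL) (L2_intgM (fL t0) wL)) expr2.
rewrite ler_norml => /andP[_ h].
have := hC _ s0 st; rewrite -/(F (sq n)) -/(e (sq n)); lra.
Qed.

End zero_one.

(** * Ergodicity, log-Sobolev inequality and varentropy *)

Section ergodic.
Context d (E : measurableType d) (R : realType).
Variables (mu : probability E R) (P : R -> R.-pker E ~> E).
Variables (kappa : R) (f : R -> E -> R).
Hypothesis hP : markov_semigroup mu P.
Hypothesis hf : density_flow mu P kappa f.

Notation L2 := (Lfun mu 2%:E).
Notation ip := (ip mu).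
Notation nrm := (nrm mu).
Notation Q := (sgop P).
Notation ent := (ent mu f).

Lemma fatou_L2 (u : nat -> E -> R) (v : E -> R) M : (forall n, u n \in L2) ->
  (forall n, nrm (u n) <= M) -> measurable_fun setT v ->
  {ae mu, forall x, u n x @[n --> \oo] --> v x} -> v \in L2 /\ nrm v <= M.
Proof.
move=> uL uM mv cv; have M0 : 0 <= M := le_trans (nrm_ge0 _ _) (uM 0%N).
pose U n x := (u n x * u n x)%:E.
have mU n : measurable_fun setT (U n).
  by apply/measurable_EFinP; apply: measurable_funM; exact: L2_meas (uL n).
have U0 n x : setT x -> (0 <= U n x)%E by rewrite lee_fin -expr2 sqr_ge0.
have mv2 : measurable_fun setT (fun x => (v x * v x)%:E).
  by apply/measurable_EFinP; exact: measurable_funM.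
have h : (\int[mu]_x (v x * v x)%:E <= (M ^+ 2)%:E)%E.
  have -> : (\int[mu]_x (v x * v x)%:E = \int[mu]_x limn_einf (U^~ x))%E.
    apply: ae_eq_integral => //.
      apply: measurableT_comp; first exact: oppe_measurable.
      by apply: measurable_fun_limn_esup => n; apply: measurableT_comp => //; exact: oppe_measurable.
    apply: filterS cv => x cvx _; apply/esym.
    have cU : U n x @[n --> \oo] --> (v x * v x)%:E.
      by apply: cvg_EFin; [exact: nearW|exact: cvgM].
    by have [-> _] := cvg_limn_einf_sup cU.
  apply: (le_trans (fatou mu measurableT mU U0)).
  rewrite limn_einf_lim; apply: lime_le; first exact: is_cvg_einfs.
  apply: nearW => n; apply: (@le_trans _ _ (\int[mu]_x U n x)%E).
    by apply: ereal_inf_lbound; exists n => /=.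
  rewrite -(EFin_Rint (L2_intgM (uL n) (uL n))) lee_fin -/(ip _ _) -nrm_sqr.
  by rewrite ler_sqr// nnegrE nrm_ge0.
have vL : v \in L2.
  apply/L2P; split => //; apply/integrableP; split => //.
  apply: (le_lt_trans _ (ltry (M ^+ 2))); apply: le_trans h; rewrite le_eqVlt; apply/orP; left.
  by apply/eqP; apply: eq_integral => x _; rewrite gee0_abs// lee_fin -expr2 sqr_ge0.
split => //; rewrite -(@ler_pXn2r _ 2)// ?nnegrE ?nrm_ge0// nrm_sqr.
by rewrite -lee_fin /ip EFin_Rint//; exact: L2_intgM.
Qed.

Let N T := ip (f T) (f T).

(** Symmetry moves half of the time gap from the later density to the earlier one, and both reach
    the midpoint. *)
Lemma ip_ff S T : 0 < S -> 0 < T -> ip (f S) (f T) = N ((S + T) / 2).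
Proof.
wlog ST : S T / S <= T.
  move=> h S0 T0; have [le|/ltW le] := leP S T; first exact: h.
  by rewrite ipC h// addrC.
move=> S0 T0; set m := (S + T) / 2.
have m0 : 0 < m by rewrite divr_gt0// addr_gt0.
pose a := (T - S) / 2; have a0 : 0 <= a by rewrite divr_ge0// subr_ge0.
have e1 : ip (f S) (f T) = ip (f S) (Q a (f m)).
  rewrite (ipC _ (f S) (Q a _)) -(ip_flow hP hf a0 m0 (fL hf S0)) ipC; congr (ip (f _) _).
  by rewrite /a /m; field.
rewrite e1 -(ip_sgop hP a0 (fL hf S0) (fL hf m0)).
rewrite -(ip_flow hP hf a0 S0 (fL hf m0)); congr (ip (f _) _).
by rewrite /a /m; field.
Qed.

Lemma sqr_flowB S T : 0 < S -> 0 < T ->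
  nrm (fun x => f S x - f T x) ^+ 2 = N S + N T - 2 * N ((S + T) / 2).
Proof.
move=> S0 T0; have fS := fL hf S0; have fT := fL hf T0; have fB := L2B fS fT.
by rewrite nrm_sqr ipBl// !ipBr// (ipC _ (f T) (f S)) (ip_ff S0 T0) /N; ring.
Qed.

Lemma N_mono S T : 0 < S -> S <= T -> N T <= N S.
Proof.
move=> S0 ST; rewrite /N -!nrm_sqr ler_sqr ?nnegrE ?nrm_ge0//.
exact: (nrm_f_le hP hf).
Qed.

Lemma ip1_flow T : 0 < T -> ip (f T) (fun=> 1) = 1.
Proof.
move=> T0; rewrite -[RHS](df_int hf T0).
by apply: eq_Rintegral => x _; rewrite mulr1.
Qed.

Lemma Nsub1 T : 0 < T -> nrm (fun x => f T x - 1) ^+ 2 = N T - 1.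
Proof.
move=> T0; have fT := fL hf T0; have c1 := L2_cst mu 1.
rewrite nrm_sqr ipBl ?ipBr ?L2B// (ipC _ (fun=> 1) (f T)) ip1_flow//.
by rewrite -[ip (fun=> 1) _]nrm_sqr nrm1 /N; ring.
Qed.

Lemma ent_leN T : 0 < T -> ent T <= N T - 1.
Proof.
move=> T0; have fT := fL hf T0; have i1 := L2_intg fT.
have i2 := L2_intgM fT fT.
have -> : N T - 1 = \int[mu]_x (f T x * f T x - f T x).
  by rewrite RintB// (df_int hf T0).
apply: ae_Rint_le; [exact: L2_intgM (gL hf T0)|exact: intgB|].
apply: filterS (df_gt0 hf T0) => x x0 /=.
by rewrite -[X in _ - X]mulr1 -mulrBr ler_pM2l// ln_le_sub1.
Qed.

Hypothesis zero_one : forall t w C, 0 < t -> w \in L2 -> w \* w \in L2 ->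
  (forall s, 0 < s -> s < t ->
    ip (f t) (w \* w) - ip (f s) (fun y => Q (t - s) w y * Q (t - s) w y) <= C) ->
  ip (f t) (w \* w) - (\int[mu]_y (f t y * w y)) ^+ 2 <= C.

(* Since v and v^2 are both invariant, the zero-one law applies with C = 0 and
   the variance of v under f_1 mu vanishes. *)
Lemma invariant_cst (v : E -> R) : v \in L2 -> v \* v \in L2 ->
  (forall s, 0 < s -> Q s v = v %[ae mu]) -> exists c, v = (fun=> c) %[ae mu].
Proof.
move=> vL v2L inv.
have inv2 s : 0 < s -> Q s (v \* v) = v \* v %[ae mu].
  move=> /[dup] s0 /ltW s0'; have iv2 := L2_intg v2L.
  have Qv2 := intg_sgop hP s0' iv2.
  have h1 : {ae mu, forall y, 0 <= Q s (v \* v) y - v y * v y}.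
    apply: filterS2 (inv _ s0) (sgop_sqr hP s0' vL) => y /(_ Logic.I) -> h.
    by rewrite subr_ge0.
  have i := intgB Qv2 iv2.
  have h2 : \int[mu]_y `|Q s (v \* v) y - v y * v y| = 0.
    transitivity (\int[mu]_y (Q s (v \* v) y - v y * v y)).
      apply: ae_Rint_eq; [exact: intg_meas (intg_norm i)|exact: intg_meas i|].
      by apply: filterS h1 => y h _; rewrite ger0_norm.
    by rewrite RintB// (Rint_sgop hP)// subrr.
  apply: filterS (Rint_eq0 (intg_meas (intg_norm i)) (fun _ => normr_ge0 _) (intg_norm i) h2).
  by by move=> y /(_ Logic.I)/= /normr0_eq0/eqP h _; apply/eqP; rewrite -subr_eq0.
pose c := \int[mu]_y (f 1 y * v y); exists c.
have f1 := fL hf (@ltr01 R).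
have h : ip (f 1) (v \* v) - c ^+ 2 <= 0.
  apply: (zero_one (@ltr01 R) vL v2L) => s s0 s1; have r0 : 0 < 1 - s by rewrite subr_gt0.
  have fs := fL hf s0.
  have [Qv2 _] := L4_sgop hP (ltW r0) vL v2L.
  have -> : ip (f s) (fun y => Q (1 - s) v y * Q (1 - s) v y) = ip (f s) (v \* v).
    rewrite ipC [RHS]ipC; apply: ip_ael => //.
    by apply: filterS (inv _ r0) => y /(_ Logic.I) e _; rewrite /= e.
  have -> : ip (f 1) (v \* v) = ip (f s) (v \* v).
    have := ip_flow hP hf (ltW r0) s0 v2L; rewrite subrK => ->.
    rewrite (ip_sgop hP (ltW r0) fs v2L).
    rewrite ipC [RHS]ipC; apply: ip_ael => //; last exact: inv2.
    by apply: L2_sgop => //; exact: ltW.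
  by rewrite subrr.
pose l : seq (R * (E -> R)) := [:: (1, fun y => f 1 y * (v y * v y)); (- 2 * c, fun y => f 1 y * v y); (c ^+ 2, f 1)].
have il : all_intg mu l.
  split; first exact: L2_intgM f1 v2L.
  by split; [exact: L2_intgM|split => //; exact: L2_intg].
have lE y : \sum_(p <- l) p.1 * p.2 y = f 1 y * (v y - c) ^+ 2.
  by rewrite !big_cons big_nil /=; ring.
have i0 := intg_lin il; have e0 := Rint_lin il.
rewrite !big_cons big_nil /= -/c -[\int[mu]_x (f 1 x * _)]/(ip (f 1) (v \* v)) (df_int hf ltr01) in e0.
have z y : 0 <= \sum_(p <- l) p.1 * p.2 y by rewrite lE mulr_ge0 ?sqr_ge0// (df_ge0 hf).
have e1 : \int[mu]_x (\sum_(p <- l) p.1 * p.2 x) = 0.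
  by apply/eqP; rewrite eq_le Rintegral_ge0// andbT e0; lra.
apply: filterS2 (Rint_eq0 (intg_meas i0) z i0 e1) (df_gt0 hf (@ltr01 R)).
move=> y /(_ Logic.I)/= + y0 _; rewrite lE => /eqP.
by rewrite mulf_eq0 gt_eqF//= sqrf_eq0 subr_eq0 => /eqP.
Qed.

(* N is non-increasing and |f_S - f_T|^2 = N S + N T - 2 N ((S + T) / 2), so
   near-minimizers of N form a Cauchy sequence; its limit is invariant. *)
Lemma flow_ergodic eps : 0 < eps -> exists2 T, 0 < T & N T - 1 <= eps.
Proof.
move=> eps0; pose S := [set N T | T in [set T | 0 < T]].
have iS : has_inf S.
  split; first by exists (N 1), 1 => /=.
  by exists 0 => _ [s s0 <-]; exact: ip_ge0.
have infS s : 0 < s -> inf S <= N s.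
  by move=> s0; apply: ge_inf; [case: iS|exists s].
(* In [sqr_flowB] two near-minimal values enter and the value at the midpoint is at least the
   infimum, whence the factor [2^-1]. Times are at least 1 so that [f 1] bounds second and fourth
   moments. *)
have /choice[T hT] : forall n : nat, exists s,
    1 <= s /\ N s <= inf S + 2^-1 * (4^-1) ^+ n.
  move=> n; have p0 : 0 < 2^-1 * (4^-1 : R) ^+ n by rewrite mulr_gt0// exprn_gt0.
  have [_ [q /= q0 <-] hq] := inf_adherent p0 iS.
  exists (Num.max q 1); split; first by rewrite le_max lexx orbT.
  by apply: le_trans (ltW hq); apply: N_mono => //; rewrite le_max lexx.
have T0 n : 0 < T n by have [h _] := hT n; exact: lt_le_trans h.
have q2 n : 2 * (2^-1 * (4^-1 : R) ^+ n) = (2^-1 ^+ n) ^+ 2.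
  by rewrite -exprM mulnC exprM (_ : 2^-1 ^+ 2 = 4^-1 :> R); [field|field].
(* The sequence [T] need not be monotone: its later terms serve for convergence, all times beyond
   [T n] for the invariance of the limit. *)
have step n s : T n <= s \/ (exists2 m, (n <= m)%N & s = T m) ->
    nrm (fun x => f s x - f (T n) x) <= 2^-1 ^+ n.
  move=> h; have p2 : 0 <= (2^-1 : R) ^+ n by rewrite exprn_ge0.
  have [s0 Ns] : 0 < s /\ N s <= inf S + 2^-1 * (4^-1) ^+ n.
    case: h => [h|[m nm ->]].
      by split; [exact: lt_le_trans h|exact: le_trans (N_mono (T0 n) h) (hT n).2].
    split => //; apply: (le_trans (hT m).2); rewrite lerD2l ler_pM2l//.
    by apply: ler_wiXn2l => //; lra.
  rewrite -(@ler_pXn2r _ 2)// ?nnegrE ?nrm_ge0// sqr_flowB// -q2.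
  have := infS ((s + T n) / 2); rewrite divr_gt0 ?addr_gt0// => /(_ isT).
  have := (hT n).2; lra.
have fT n := fL hf (T0 n).
have udiff n : \int[mu]_x `|f (T n.+1) x - f (T n) x| <= 2^-1 ^+ n.
  apply: (le_trans (Rint_norm_le_nrm (L2B (fT _) (fT _)))).
  by apply: step; right; exists n.+1.
have [v [iv cv _]] := fast_L1_cvg (fun n => L2_intg (fT n)) udiff.
have mv := intg_meas iv.
have [vL _] : v \in L2 /\ nrm v <= nrm (f 1).
  apply: (fatou_L2 fT) => // n; apply: (nrm_f_le hP hf) => //; exact: (hT n).1.
have [v2L _] : v \* v \in L2 /\ nrm (v \* v) <= nrm (f 1 \* f 1).
  apply: (@fatou_L2 (fun n => f (T n) \* f (T n))) => //.
  - by move=> n; exact: (f2L hf).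
  - by move=> n; apply: (nrm_f2_le hP hf) => //; exact: (hT n).1.
  - exact: measurable_funM.
  - by apply: filterS cv => x h; exact: cvgM.
have rate n : nrm (fun x => v x - f (T n) x) <= 2^-1 ^+ n.
  have hL k : (fun x => f (T (k + n)%N) x - f (T n) x) \in L2 by exact: L2B.
  apply: (fatou_L2 hL _ _ _).2.
  - by move=> k; apply: step; right; exists (k + n)%N; rewrite ?leq_addl.
  - by apply: measurable_funB => //; exact: L2_meas (fT n).
  - apply: filterS cv => x h; apply: cvgB; last exact: cvg_cst.
    by rewrite (cvg_shiftn n (fun n => f (T n) x)).
have pow0 (a : R) : (forall n, a <= 3 * 2^-1 ^+ n) -> a <= 0.
  move=> h; have c : 3 * (2^-1 : R) ^+ n @[n --> \oo] --> (3 * 0 : R).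
    by apply: cvgMr; apply: cvg_expr; rewrite ger0_norm//; lra.
  rewrite mulr0 in c; apply: (ler_cvg_to _ c); first exact: cvg_cst.
  exact: nearW.
have ae0 u : u \in L2 -> nrm u <= 0 -> u = (fun=> 0) %[ae mu].
  move=> uL u0; have i := L2_intg uL.
  have : \int[mu]_x `|u x| = 0.
    apply/eqP; rewrite eq_le Rintegral_ge0// andbT.
    exact: le_trans (Rint_norm_le_nrm uL) u0.
  move/(Rint_eq0 (intg_meas (intg_norm i)) (fun _ => normr_ge0 _) (intg_norm i)).
  by apply: filterS => x /(_ Logic.I)/= /normr0_eq0.
have inv s : 0 < s -> Q s v = v %[ae mu].
  move=> /[dup] s0 /ltW s0'; have QvL := L2_sgop hP s0' vL.
  have : nrm (fun x => Q s v x - v x) <= 0.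
    apply: pow0 => n; have fn := fT n; have Qf := L2_sgop hP s0' fn.
    apply: (le_trans (nrm_tri QvL Qf vL)).
    apply: (@le_trans _ _ (2^-1 ^+ n + (2^-1 ^+ n + 2^-1 ^+ n))); last lra.
    apply: lerD.
      exact: le_trans (nrm_sgopB hP s0' vL fn) (rate n).
    apply: (le_trans (nrm_tri Qf fn vL)); apply: lerD; last by rewrite nrmBC rate.
    have sT : 0 < s + T n by rewrite addr_gt0.
    have := step n (s + T n); rewrite lerDr s0' => /(_ (or_introl isT)).
    apply: le_trans; rewrite le_eqVlt (@nrm_ae _ _ _ _ _ (fun x => f (s + T n) x - f (T n) x)) ?eqxx//.
    - exact: L2B.
    - by apply: L2B => //; exact: (fL hf sT).
    - by apply: filterS (flowE hf s0' (T0 n)) => x /(_ Logic.I) /= -> _.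
  move/(ae0 _ (L2B QvL vL)); apply: filterS => x h I.
  by apply/eqP; rewrite -subr_eq0 h.
have [c vc] := invariant_cst vL v2L inv.
have c1L := L2_cst mu c.
have rate' n : nrm (fun x => c - f (T n) x) <= 2^-1 ^+ n.
  apply: le_trans (rate n); rewrite (@nrm_ae _ _ _ _ _ (fun x => v x - f (T n) x))//; try exact: L2B.
  by apply: filterS vc => x /(_ Logic.I) /= -> _.
have c1 : c = 1.
  apply/eqP; rewrite -subr_eq0 -normr_le0; apply: pow0 => n.
  have -> : c - 1 = \int[mu]_x (c - f (T n) x).
    by rewrite RintB ?Rint_cst ?(df_int hf)//; [exact: intg_cst|exact: L2_intg].
  apply: (le_trans (le_normr_Rintegral _ _)) => //; first exact: L2_intg (L2B c1L (fT n)).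
  apply: (le_trans (Rint_norm_le_nrm (L2B c1L (fT n)))); apply: (le_trans (rate' n)).
  have : 0 <= (2^-1 : R) ^+ n by rewrite exprn_ge0.
  lra.
have c4 : (4^-1 : R) ^+ n @[n --> \oo] --> 0.
  by apply: cvg_expr; rewrite ger0_norm//; lra.
have /cvgrPdist_le/(_ _ eps0)[n _ /(_ n (leqnn n))/=] := c4.
rewrite sub0r normrN ger0_norm ?exprn_ge0// => hn; exists (T n) => //.
rewrite -(Nsub1 (T0 n)); apply: le_trans hn.
have -> : (4^-1 : R) = 2^-1 ^+ 2 by field.
rewrite -exprM mulnC exprM ler_sqr ?nnegrE ?nrm_ge0 ?exprn_ge0//.
by have := rate' n; rewrite c1 nrmBC.
Qed.

(** In [ent_le_fisher] the entropy at a late time is made arbitrarily small by ergodicity, as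
    [ln f <= f - 1] bounds it by the squared L^2 distance to equilibrium. *)
Lemma log_sobolev t : 0 < t -> ent t <= fisher mu P f t / (2 * kappa).
Proof.
move=> t0; apply/ler_addgt0Pr => eps e0.
have [T T0 hT] := flow_ergodic e0.
pose T' := Num.max T t; have TT' : T <= T' by rewrite le_max lexx.
have tT' : t <= T' by rewrite le_max lexx orbT.
have T'0 := lt_le_trans T0 TT'.
have := ent_le_fisher hP hf t0 tT'.
have := ent_leN T'0; have := N_mono T0 TT'; lra.
Qed.

(** [local_poincare] bounds the conditional variance uniformly in the conditioning time, which is
    the hypothesis of the zero-one law for [w = ln f_t]. *)
Lemma varentropy t : 0 < t ->
  ip (f t) ((@ln R \o f t) \* (@ln R \o f t)) - ent t ^+ 2 <= fisher mu P f t / kappa.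
Proof.
move=> t0; apply: zero_one => //; [exact: gL hf _ t0|exact: g2L hf _ t0|].
move=> s s0 st; have ts : 0 <= t - s by rewrite subr_ge0 ltW.
have ts' : t - s < t by rewrite ltrBlDr ltrDl.
by have := local_poincare hP hf t0 ts ts'; rewrite subKr.
Qed.

End ergodic.

(** * Total variation and the width of the mixing window *)

(* Going from u <= 2^(k+1) to u <= 2^k takes a time at most 2^-k / c. *)
Lemma riccati_le1 (R : realType) (u : R -> R) s0 c : 0 < c ->
  (forall s t, s0 < s -> s <= t -> 0 < u t -> c * (t - s) * u t ^+ 2 <= u s - u t) ->
  forall s t, s0 < s -> s + 2 / c <= t -> u t <= 1.
Proof.
move=> c0 hu.
(* [2 - 2 * 2^-k] is the sum of the [2^-j] for [j < k]. *)
have dyadic k : forall s t, s0 < s -> u s <= 2 ^+ k ->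
    s + (2 - 2 * 2^-1 ^+ k) / c <= t -> u t <= 1.
  elim: k => [|k ih] s t s0s us st.
    rewrite expr0 in us; rewrite expr0 mulr1 subrr mul0r addr0 in st.
    have [ut|ut] := ltP 0 (u t); last exact: le_trans ut ler01.
    have := hu _ _ s0s st ut.
    have : 0 <= c * (t - s) * u t ^+ 2.
      by rewrite mulr_ge0 ?sqr_ge0// mulr_ge0 ?subr_ge0// ltW.
    lra.
  pose p : R := 2^-1 ^+ k; have p0 : 0 < p by rewrite exprn_gt0.
  have pc0 : 0 < p / c by rewrite divr_gt0.
  have p2 : 2 ^+ k * p = 1 by rewrite -exprMn divff// expr1n.
  apply: (ih (s + p / c)); first by rewrite ltr_wpDr// ltW.
    rewrite leNgt; apply/negP => lt.
    have k0 : 0 < (2 : R) ^+ k by rewrite exprn_gt0.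
    have ut := lt_trans k0 lt.
    have sle : s <= s + p / c by rewrite lerDl ltW.
    have := hu _ _ s0s sle ut.
    have -> : c * (s + p / c - s) = p by field; rewrite gt_eqF.
    rewrite exprS in us.
    have : u (s + p / c) < p * u (s + p / c) ^+ 2.
      by rewrite expr2 mulrA ltr_pMl// -p2 mulrC ltr_pM2l.
    lra.
  apply: le_trans st; rewrite le_eqVlt; apply/orP; left; apply/eqP.
  by rewrite /p exprS; field; rewrite gt_eqF.
move=> s t s0s st; apply: (dyadic (Num.bound (u s)) s) => //.
  have [us|us] := leP (u s) 0; first by apply: (le_trans us); rewrite exprn_ge0.
  apply: (le_trans (ltW (archi_boundP (ltW us)))).
  by rewrite -natrX ler_nat ltnW// ltn_expl.
apply: le_trans st; rewrite lerD2l ler_pM2r ?invr_gt0// gerBl.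
by rewrite mulr_ge0// exprn_ge0.
Qed.

Section total_variation.
Context d (E : measurableType d) (R : realType).
Variables (mu : probability E R) (P : R -> R.-pker E ~> E).
Variables (kappa : R) (f : R -> E -> R).
Hypothesis hP : markov_semigroup mu P.
Hypothesis hf : density_flow mu P kappa f.

Notation L2 := (Lfun mu 2%:E).
Notation ip := (ip mu).
Notation Q := (sgop P).
Notation ent := (ent mu f).
Notation fisher := (fisher mu P f).

Definition excess t x : R := Num.max (f t x - 1) 0.
(** The total variation distance between [f_t mu] and [mu], as half the L^1 distance of the
    densities ([tv_norm]). *)
Definition tv t := \int[mu]_x excess t x.

Lemma excess_ge0 t x : 0 <= excess t x.
Proof. by rewrite le_max lexx orbT. Qed.

Lemma intg_excess t : 0 < t -> intg mu (excess t).
Proof.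
move=> t0; have fB := intgB (L2_intg (fL hf t0)) (intg_cst mu 1).
apply: (le_intg _ _ (intg_norm fB)).
  by apply: measurable_maxr => //; exact: intg_meas fB.
move=> x; rewrite /excess ger0_norm ?excess_ge0//.
by rewrite ge_max ler_norm normr_ge0.
Qed.

Lemma tv_mono s t : 0 < s -> s <= t -> tv t <= tv s.
Proof.
move=> s0 st; have r0 : 0 <= t - s by rewrite subr_ge0.
have ie := intg_excess s0; have ifs := L2_intg (fL hf s0).
rewrite /tv -(Rint_sgop hP r0 ie).
apply: ae_Rint_le; [exact: intg_excess (lt_le_trans s0 st)|exact: intg_sgop|].
have c1 := intg_cst mu 1.
have h1 : {ae mu, forall y, Q (t - s) (fun x => f s x - 1) y <= Q (t - s) (excess s) y}.
  apply: (sgop_le hP r0 (intgB ifs c1) ie); apply: aeW => x.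
  by rewrite /excess le_max lexx.
have h0 : {ae mu, forall y, Q (t - s) (fun=> 0) y <= Q (t - s) (excess s) y}.
  by apply: (sgop_le hP r0 (intg_cst mu 0) ie); apply: aeW => x; exact: excess_ge0.
have hB := sgopB hP r0 ifs c1.
have hF := df_flow hf r0 s0; rewrite subrK in hF.
move: h0; rewrite sgop_cst => h0; rewrite sgop_cst in hB.
apply: filterS2 (filterI h1 h0) (filterI hB hF) => y [h1y h0y] [/(_ Logic.I) hBy /(_ Logic.I) hFy].
by rewrite /excess ge_max h0y andbT hFy -hBy.
Qed.

Lemma tv_norm t : 0 < t -> \int[mu]_x `|f t x - 1| = 2 * tv t.
Proof.
move=> t0; have ifs := L2_intg (fL hf t0); have ie := intg_excess t0.
have i1 := intg_cst mu 1.
have e x : `|f t x - 1| = 2 * excess t x - (f t x - 1).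
  rewrite /excess; have [h|h] := leP 0 (f t x - 1).
    by rewrite ger0_norm//; ring.
  by rewrite ltr0_norm//; ring.
under eq_Rintegral do rewrite e.
rewrite RintB ?RintZ//; [|exact: intgZ|exact: intgB].
by rewrite RintB// (df_int hf t0) Rint_cst subrr subr0.
Qed.

Lemma tv_le1 t : 0 < t -> tv t <= 1.
Proof.
move=> t0; rewrite -(df_int hf t0); apply: Rint_le; [exact: intg_excess|exact: L2_intg (fL hf t0)|].
move=> x; have := df_ge0 hf x t0; rewrite /excess ge_max => ->; rewrite andbT; lra.
Qed.

Lemma tv_pinsker t eps : 0 < t -> 0 < eps -> ent t <= eps ^+ 2 -> tv t <= eps.
Proof.
move=> t0 e0 he; have ifs := L2_intg (fL hf t0); have i1 := intg_cst mu 1.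
have ig : intg mu (fun x => f t x * ln (f t x)) := L2_intgM (fL hf t0) (gL hf t0).
pose b := eps^-1; have b0 : 0 < b by rewrite invr_gt0.
pose l : seq (R * (E -> R)) := [:: (eps / 2 - b, f t); (eps / 2 + b, fun=> 1);
  (b, fun x => f t x * ln (f t x))].
have il : all_intg mu l by [].
have h : \int[mu]_x `|f t x - 1| <= \int[mu]_x \sum_(p <- l) p.1 * p.2 x.
  apply: Rint_le; [exact: intg_norm (intgB ifs i1)|exact: intg_lin|].
  move=> x; rewrite !big_cons big_nil /=.
  (* The parameter [theta = eps / 2] gives [2 tv <= eps + ent / eps] after integration. *)
  have e20 : 0 < eps / 2 by rewrite divr_gt0.
  apply: (le_trans (xlnx_pinsker (df_ge0 hf x t0) e20)); rewrite le_eqVlt; apply/orP; left.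
  by apply/eqP; rewrite /b; field; rewrite gt_eqF.
rewrite tv_norm// Rint_lin// !big_cons big_nil /= (df_int hf t0) Rint_cst in h.
have : b * ent t <= eps.
  by rewrite /b mulrC ler_pdivrMr// -expr2.
rewrite /ent /ip /= => h2; lra.
Qed.

(* The overlap of f_t mu and mu has mass 1 - tv t; on it ln f_t is close to its
   mean ent t under f_t mu, while the integral of min(f_t, 1) ln f_t is at most
   tv t. *)
Lemma tv_overlap t a : 0 < t -> 0 < a ->
  ent t * (1 - tv t) <= tv t + a / 2 +
    (ip (f t) ((@ln R \o f t) \* (@ln R \o f t)) - ent t ^+ 2) / (2 * a).
Proof.
move=> t0 a0; set V2 := ip _ _; pose h := ent t.
have h0 : 0 <= h := ent_ge0 hf t0.
have fLt := fL hf t0.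
(* With [m = min (f, 1) = f - excess] and [y = ln f], nonnegativity of the sum says [m h <= excess +
   f (a / 2 + (h - y)^2 / (2 a))]. It adds [m y <= excess] to Young's inequality for [m (h - y)],
   with [m <= f]. *)
pose l : seq (R * (E -> R)) := [:: (1 + h, excess t);
  (a / 2 + h ^+ 2 / (2 * a) - h, f t); (- (h / a), fun x => f t x * ln (f t x));
  ((2 * a)^-1, fun x => f t x * (ln (f t x) * ln (f t x)))].
have il : all_intg mu l.
  split; first exact: intg_excess.
  split; first exact: L2_intg.
  split; first exact: L2_intgM fLt (gL hf t0).
  by split => //; exact: L2_intgM fLt (g2L hf t0).
have := Rint_lin_ge0 il; rewrite !big_cons big_nil /= (df_int hf t0).
rewrite -/(tv t) -[\int[mu]_x (f t x * ln _)]/h -[\int[mu]_x (f t x * (_ * _))]/V2.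
have ai : 0 < a^-1 by rewrite invr_gt0.
move=> H; rewrite -/h -subr_ge0.
rewrite [leRHS](_ : _ = (1 + h) * tv t + ((a / 2 + h ^+ 2 / (2 * a) - h) * 1 +
  (- (h / a) * h + ((2 * a)^-1 * V2 + 0)))); last by field; rewrite gt_eqF.
apply: H; apply: filterS (df_gt0 hf t0) => x x0; rewrite !big_cons big_nil /=.
have := overlap_ln x0; rewrite -/(excess t x).
set y := ln _; set m := Num.min _ _.
have em : excess t x = f t x - m.
  rewrite /excess /m maxEge minElt subr_ge0.
  by rewrite leNgt; case: ltP => /= _; ring.
rewrite em => hm.
have m0 : 0 <= m by rewrite le_min ltW//= ler01.
have mx : m <= f t x by rewrite ge_min lexx.
have : m * (h - y) <= f t x * (a / 2 + (h - y) ^+ 2 / (2 * a)).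
  have n0 : 0 <= a / 2 + (h - y) ^+ 2 / (2 * a).
    by rewrite addr_ge0 ?divr_ge0 ?sqr_ge0 ?mulr_ge0// ltW.
  apply: (@le_trans _ _ (m * (a / 2 + (h - y) ^+ 2 / (2 * a)))); last by rewrite ler_wpM2r.
  rewrite ler_wpM2l// -subr_ge0.
  rewrite (_ : _ - _ = (a - (h - y)) ^+ 2 / (2 * a)); last by field; rewrite gt_eqF.
  by rewrite divr_ge0 ?sqr_ge0// mulr_ge0// ltW.
rewrite (_ : f t x * (a / 2 + (h - y) ^+ 2 / (2 * a)) =
  (a / 2 + h ^+ 2 / (2 * a)) * f t x + (- (h / a) * (f t x * y) + (2 * a)^-1 * (f t x * (y * y)))); last first.
  by field; rewrite gt_eqF.
lra.
Qed.

Hypothesis varent : forall t, 0 < t ->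
  ip (f t) ((@ln R \o f t) \* (@ln R \o f t)) - ent t ^+ 2 <= fisher t / kappa.
Hypothesis logsob : forall t, 0 < t -> ent t <= fisher t / (2 * kappa).

(** [tv_overlap] is used with [a = u], where [u = eps * ent t - 1]: it becomes
    [u <= u / 2 + V / (2 u)], that is [u^2 <= V]. *)
Lemma ent_sqr_le_fisher t eps : 0 < t -> 0 < eps -> tv t <= 1 - eps ->
  0 < eps * ent t - 1 -> kappa * (eps * ent t - 1) ^+ 2 <= fisher t.
Proof.
move=> t0 e0 tve; set u := _ - 1 => u0; have k0 := df_kappa hf.
have uE : u = eps * ent t - 1 by [].
move: u uE u0 => u uE u0.
have h0 : 0 <= ent t := ent_ge0 hf t0.
have h1 := tv_overlap t0 u0; have h2 := varent t0; have h3 := tv_le1 t0.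
have h4 : eps * ent t <= ent t * (1 - tv t).
  by rewrite mulrC ler_wpM2l//; lra.
move: h1 h2; set V := ip _ _ - _; clearbody V => h1 h2.
have : u / 2 <= V / (2 * u) by lra.
rewrite ler_pdivlMr ?mulr_gt0// => h5.
have h6 : u ^+ 2 <= V by rewrite expr2; lra.
by rewrite mulrC -ler_pdivlMr//; exact: le_trans h6 h2.
Qed.

(* u = eps ent - 1 falls below 1 within 2 / (kappa eps); then the Fisher
   information is at most 2 kappa ent within 1 / (2 kappa), and the exponential
   decay brings the entropy below eps^2 within another 2 / (kappa eps). *)
Lemma tv_window s0 s eps : 0 < eps -> eps < 2^-1 -> 0 <= s0 -> s0 < s ->
  (forall t, s0 < t -> tv t <= 1 - eps) -> tv (s + 3 / (kappa * eps ^+ 2)) <= eps.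
Proof.
move=> e0 e2 s00 s0s htv; have k0 := df_kappa hf.
have ke : 0 < kappa * eps by rewrite mulr_gt0.
have kn : kappa != 0 by rewrite gt_eqF.
have en : eps != 0 by rewrite gt_eqF.
pose y := eps^-1; have y0 : 0 < y by rewrite invr_gt0.
have y2 : 2 <= y by rewrite -[2]invrK lef_pV2 ?posrE ?invr_gt0// ltW.
pose t1 := s + 2 / (kappa * eps).
have t10 : 0 < t1 by rewrite addr_gt0 ?divr_gt0//; exact: le_lt_trans s0s.
have ent1 : ent t1 <= 2 * y.
  have : eps * ent t1 - 1 <= 1.
    apply: (@riccati_le1 _ (fun t => eps * ent t - 1) s0 (kappa * eps) ke _ s) => //.
    move=> a b s0a ab ub; have a0 := le_lt_trans s00 s0a; have b0 := lt_le_trans a0 ab.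
    have h1 := ent_drop hP hf a0 ab.
    have h2 := ent_sqr_le_fisher b0 e0 (htv _ (lt_le_trans s0a ab)) ub.
    have ab' : 0 <= b - a by rewrite subr_ge0.
    have h3 : (b - a) * (kappa * (eps * ent b - 1) ^+ 2) <= ent a - ent b.
      by apply: le_trans h1; rewrite ler_wpM2l.
    have := ler_wpM2l (ltW e0) h3; rewrite /=; lra.
  move=> h; have : ent t1 <= 2 / eps by rewrite ler_pdivlMr//; lra.
  by [].
pose t2 := t1 + 1 / (2 * kappa).
have d2 : 0 < 1 / (2 * kappa) by rewrite divr_gt0// mulr_gt0.
have t12 : t1 <= t2 by rewrite lerDl ltW.
have t20 := lt_le_trans t10 t12.
have fi2 : fisher t2 <= 2 * kappa * (2 * y).
  have := ent_drop hP hf t10 t12; rewrite /t2 addrC addKr -/t2.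
  rewrite mul1r ler_pdivrMl ?mulr_gt0// => /le_trans; apply.
  rewrite ler_pM2l ?mulr_gt0//; have := ent_ge0 hf t20; lra.
pose r := 2 * y / kappa; have r0 : 0 < r by rewrite divr_gt0// mulr_gt0.
have t3 : 0 < r + t2 by rewrite addr_gt0.
have ent3 : ent (r + t2) <= eps ^+ 2.
  apply: (le_trans (logsob t3)).
  have := fisher_decay hP hf (ltW r0) t20.
  rewrite (_ : 2 * kappa * r = 4 * y); last by rewrite /r; field.
  move=> h; rewrite ler_pdivrMr ?mulr_gt0//; apply: (le_trans h).
  rewrite expRN ler_pdivrMl ?expR_gt0//; apply: (le_trans fi2).
  (* Over the time [r] the Fisher information loses a factor [e^(-4 y)]. The target needs
     [2 y^3 <= e^(4 y)], which follows from [2 <= y] and the fourth power of [y <= e^y]. *)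
  have ey : y ^+ 4 <= expR (4 * y).
    rewrite expRM_natl.
    have ey1 : y <= expR y by have := expR_ge1Dx y; lra.
    by apply: lerXn2r; rewrite ?nnegrE ?expR_ge0//; exact: ltW.
  apply: (@le_trans _ _ (y ^+ 4 * (eps ^+ 2 * (2 * kappa)))); last first.
    by rewrite ler_wpM2r// !mulr_ge0 ?sqr_ge0// ltW.
  rewrite (_ : y ^+ 4 * (eps ^+ 2 * (2 * kappa)) = 2 * kappa * (y * y)); last first.
    by rewrite /y; field.
  by rewrite ler_pM2l ?mulr_gt0// ler_pM2r.
apply: (le_trans (tv_mono t3 _)); last exact: tv_pinsker.
rewrite /t2 /t1 /r /y.
have -> : 2 * eps^-1 / kappa + (s + 2 / (kappa * eps) + 1 / (2 * kappa)) =
  s + (4 * y + 2^-1) / kappa by rewrite /y; field; rewrite kn en.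
have -> : 3 / (kappa * eps ^+ 2) = (3 * y ^+ 2) / kappa by rewrite /y; field; rewrite kn en.
(* The three durations add up to [(4 y + 1 / 2) / kappa], and [4 y + 1 / 2 <= 3 y^2] because
   [y >= 2]: this is the constant 3. *)
rewrite lerD2l ler_pM2r ?invr_gt0// expr2.
have : 2 * y <= y * y by rewrite ler_pM2r.
lra.
Qed.

End total_variation.

(** * Mixing times of a positively curved diffusion *)

Lemma pcd_flow (R : realType) (D : positively_curved_diffusion R) :
  exists2 f : R -> pcd_E D -> R,
    forall t, 0 < t -> has_density (pcd_mu D) (pcd_X D t) (f t) &
    density_flow (pcd_mu D) (@pcd_P R D) (pcd_kappa D) f.
Proof.
have /choice[f hf] : forall t, exists f : pcd_E D -> R, 0 < t ->
    let g := @ln R \o f in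
    [/\ has_density (pcd_mu D) (pcd_X D t) f,
        {ae pcd_mu D, forall y, 0 < f y},
        [/\ Dom (pcd_mu D) (@pcd_P R D) f, Dom (pcd_mu D) (@pcd_P R D) g,
            Dom (pcd_mu D) (@pcd_P R D) (f \* f), Dom (pcd_mu D) (@pcd_P R D) (g \* g) &
            Dom (pcd_mu D) (@pcd_P R D) (f \* g)],
        chain_rule (pcd_mu D) (@pcd_P R D) (@ln R) f g &
        curvature_criterion (pcd_mu D) (@pcd_P R D) (pcd_kappa D) g].
  move=> t; have [t0|t0] := ltP 0 t; last by exists (fun=> 0).
  by have [f hf] := pcd_curved D t0; exists f.
have hd t : 0 < t -> has_density (pcd_mu D) (pcd_X D t) (f t) by move=> /hf[].
have fD t : 0 < t -> Dom (pcd_mu D) (@pcd_P R D) (f t) by move=> /hf[_ _ []].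
exists f => //; split.
- exact: pcd_kappa_gt0.
- by move=> t y /hd[].
- by move=> t /hf[].
- move=> t /hd[mf f0 h]; have := h setT measurableT.
  by rewrite /Rintegral => <-; rewrite probability_setT.
- move=> s t s0 t0; apply: (density_next (pcd_semigroup D) (@pcd_markov R D) hd s0 t0).
    exact: Dom_L2 (fD _ t0).
  by apply: Dom_L2; apply: fD; rewrite ltr_wpDl.
- by move=> t /hf[].
- by move=> t /hf[].
- by move=> t /hf[].
Qed.

Section total_variation_distance.
Context d (E : measurableType d) (R : realType).
Variables (mu : probability E R) (P : R -> R.-pker E ~> E).
Variables (kappa : R) (f : R -> E -> R).
Context d' (Omega : measurableType d') (Pr : probability Omega R).
Variable X : R -> {RV Pr >-> E}.
Hypothesis hf : density_flow mu P kappa f.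
Hypothesis hd : forall t, 0 < t -> has_density mu (X t) (f t).

Lemma TV_tv t : 0 < t -> TV mu (X t) = (tv mu f t)%:E.
Proof.
move=> t0; have ifs := L2_intg (fL hf t0); have i1 := intg_cst mu 1.
have iB := intgB ifs i1; have ie := intg_excess hf t0.
have [mf _ hA] := hd t0.
have iA A : measurable A -> intg mu (fun x => \1_A x * (f t x - 1)).
  move=> mA; apply: (le_intg _ _ (intg_norm iB)).
    by apply: measurable_funM => //; exact: intg_meas iB.
  move=> x; rewrite normrM ler_piMl// indicE.
  by case: (_ \in _); rewrite ?normr1 ?normr0.
have hE A : measurable A -> (distribution Pr (X t) A - mu A = (\int[mu]_x (\1_A x * (f t x - 1)))%:E)%E.
  move=> mA; rewrite hA//.
  have -> : (mu A = \int[mu]_(x in A) (1 : R)%:E)%E by rewrite integral_cst// mul1e.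
  have sub (u : E -> R) : intg mu u -> mu.-integrable A (EFin \o u).
    by move=> iu; apply: (integrableS measurableT).
  rewrite -integralB//; [|exact: sub ifs|exact: (sub (fun=> 1))].
  rewrite EFin_Rint; last exact: iA.
  rewrite integral_mkcond; apply: eq_integral => x _.
  rewrite /patch indicE; case: (_ \in _); first by rewrite mul1r EFinB.
  by rewrite mul0r.
apply/eqP; rewrite eq_le; apply/andP; split.
  apply: ge_ereal_sup => _ [A mA <-]; rewrite hE// lee_fin ler_norml; apply/andP; split.
    have i0 : \int[mu]_x (f t x - 1) = 0.
      by rewrite RintB// (df_int hf t0) Rint_cst subrr.
    have iAe := intgD ie (iA _ mA).
    have : 0 <= \int[mu]_x (excess f t x + \1_A x * (f t x - 1) - (f t x - 1)).
      apply: Rintegral_ge0 => x _; rewrite /excess indicE.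
      case: (_ \in _); rewrite ?mul1r ?mul0r.
        by rewrite addrK le_max lexx orbT.
      by rewrite addr0 subr_ge0 le_max lexx.
    rewrite RintB// i0 RintD//; last exact: iA.
    rewrite -/(tv mu f t); lra.
  apply: Rint_le => //; first exact: iA.
  move=> x; rewrite /excess indicE; case: (_ \in _); rewrite ?mul1r ?mul0r le_max lexx//.
  by rewrite orbT.
(* The supremum is attained on the set where the density is at least 1. *)
pose B := f t @^-1` `[1, +oo[.
have mB : measurable B by rewrite -[B]setTI; exact: mf.
apply: ereal_sup_ge; exists (tv mu f t)%:E => //; exists B => //.
rewrite hE//; have -> : \int[mu]_x (\1_B x * (f t x - 1)) = tv mu f t.
  apply: eq_Rintegral => x _; rewrite /excess indicE.
  have [xB|xB] := boolP (x \in B).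
    by rewrite mul1r max_l// subr_ge0; move: xB; rewrite inE /B /= in_itv/= andbT.
  rewrite mul0r max_r// subr_le0 leNgt; apply/negP => /ltW h.
  by move/negP: xB; apply; rewrite inE /B /= in_itv/= h.
rewrite /= ger0_norm// /tv; apply: Rintegral_ge0 => x _; exact: excess_ge0.
Qed.

End total_variation_distance.

(** What remains of the diffusion for the study of mixing times: a real function of time. Its third
    property makes these times finite. *)
Lemma pcd_window (R : realType) (D : positively_curved_diffusion R) :
  exists v : R -> R, [/\ forall t, 0 < t -> TV (pcd_mu D) (pcd_X D t) = (v t)%:E,
    forall s t, 0 < s -> s <= t -> v t <= v s,
    forall eps, 0 < eps -> exists2 t, 0 < t & v t <= eps &
    forall eps s0 s, 0 < eps -> eps < 2^-1 -> 0 <= s0 -> s0 < s ->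
      (forall t, s0 < t -> v t <= 1 - eps) ->
      v (s + 3 / (pcd_kappa D * eps ^+ 2)) <= eps].
Proof.
have [f hd hf] := pcd_flow D; have hP := pcd_semigroup D.
have zero_one := fun t w C => @blumenthal _ _ _ _ _ _ _ _ _ _ _ hP
  (@pcd_markov R D) hd (@pcd_start R D) (fun t => fL hf (t := t)) t w C.
exists (tv (pcd_mu D) f); split.
- by move=> t t0; exact: TV_tv hf hd _ t0.
- exact: tv_mono hP hf.
- move=> eps e0; have e2 : 0 < eps ^+ 2 by rewrite exprn_gt0.
  have [T T0 hT] := flow_ergodic hP hf zero_one e2.
  exists T => //; apply: (tv_pinsker hf T0 e0); apply: le_trans hT.
  exact: ent_leN hf _ T0.
- move=> eps s0 s; apply: (tv_window hP hf).
    by move=> t; exact: varentropy.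
  by move=> t; exact: log_sobolev.
Qed.

Lemma t_mix_window (R : realType) (D : positively_curved_diffusion R) :
  exists tau : R -> R, [/\ forall eps, 0 < eps -> t_mix D eps = (tau eps)%:E,
    forall eps del, 0 < eps -> eps <= del -> tau del <= tau eps &
    forall eps, 0 < eps -> eps < 2^-1 ->
      tau eps <= tau (1 - eps) + 3 / (pcd_kappa D * eps ^+ 2)].
Proof.
have [v [vE v_mono v_le v_win]] := pcd_window D.
pose S eps := [set t : R | 0 < t /\ v t <= eps].
have S_inf eps : 0 < eps -> has_inf (S eps).
  by move=> e0; split; [have [t t0 vt] := v_le _ e0; exists t|exists 0 => t [/ltW]].
have tauP eps t : 0 < eps -> S eps t -> inf (S eps) <= t.
  by move=> e0 St; apply: ge_inf => //; case: (S_inf _ e0).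
have tau_ge0 eps : 0 < eps -> 0 <= inf (S eps).
  by move=> e0; apply: lb_le_inf; [case: (S_inf _ e0)|move=> t [/ltW]].
have tau_lt eps t : 0 < eps -> inf (S eps) < t -> v t <= eps.
  move=> e0 lt; have d0 : 0 < t - inf (S eps) by rewrite subr_gt0.
  have [s [s0 vs]] := inf_adherent d0 (S_inf _ e0); rewrite addrC subrK => /ltW st.
  exact: le_trans (v_mono _ _ s0 st) vs.
exists (fun eps => inf (S eps)); split.
- move=> eps e0; rewrite /t_mix.
  have -> : [set t | 0 < t /\ (TV (pcd_mu D) (pcd_X D t) <= eps%:E)%E] = S eps.
    by apply/seteqP; split => t [t0 h]; split => //; move: h; rewrite vE// lee_fin.
  by rewrite ereal_inf_EFin//; case: (S_inf _ e0).
- move=> eps del e0 le; apply: lb_le_inf; first by case: (S_inf _ e0).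
  move=> t [t0 vt]; apply: tauP; first exact: lt_le_trans le.
  by split=> //; exact: le_trans le.
- move=> eps e0 e2; have e1 : 0 < 1 - eps by lra.
  (* The infimum may be 0 and need not be attained, so the window is started a time [h] later. *)
  apply/ler_addgt0Pr => h h0; rewrite addrAC; apply: tauP => //.
  have lt : inf (S (1 - eps)) < inf (S (1 - eps)) + h by rewrite ltrDl.
  have k0 : 0 < 3 / (pcd_kappa D * eps ^+ 2).
    by rewrite divr_gt0// mulr_gt0 ?exprn_gt0// pcd_kappa_gt0.
  split; first by rewrite addr_gt0//; exact: le_lt_trans (tau_ge0 _ e1) lt.
  by apply: (v_win _ _ _ e0 e2 (tau_ge0 _ e1) lt) => t; exact: tau_lt.
Qed.

Theorem theorem2 (R : realType) :
  (forall (D : positively_curved_diffusion R) (eps : R),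
     0 < eps -> eps < 2^-1 ->
     (w_mix D eps <= (3 / (pcd_kappa D * eps ^+ 2))%:E)%E)
  /\
  (forall (D : nat -> positively_curved_diffusion R) (eps0 : R),
     0 < eps0 -> eps0 < 1 ->
     ((pcd_kappa (D n))%:E * t_mix (D n) eps0)%E @[n --> \oo] --> +oo%E ->
     forall eps : R, 0 < eps -> eps < 1 ->
       (t_mix (D n) (1 - eps)%R / t_mix (D n) eps)%E @[n --> \oo] --> 1%E).
Proof.
split=> [D eps e0 e2|D eps0 e00 e01 hD eps e0 e1].
  have [tau [tauE _ win]] := t_mix_window D.
  rewrite /w_mix !tauE//; last lra.
  by rewrite -EFinB lee_fin lerBlDl; exact: win.
have /choice[tau htau] := fun n => t_mix_window (D n).
pose k n := pcd_kappa (D n); have k0 n : 0 < k n := pcd_kappa_gt0 (D n).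
have ce0 : 0 < 1 - eps by lra.
(* All four levels lie between [del] and [1 - del], with [del < 1 / 2]; by monotonicity their mixing
   times differ by at most one window of level [del]. *)
pose del := Num.min (Num.min eps (1 - eps)) (Num.min eps0 (1 - eps0)) / 2.
have [d0 d1 d2 d3 d4] : [/\ 0 < del, del < 2^-1, del <= eps <= 1 - del,
    del <= 1 - eps <= 1 - del & del <= eps0 <= 1 - del].
  have m1 : del * 2 <= eps by rewrite divfK// !ge_min lexx.
  have m2 : del * 2 <= 1 - eps by rewrite divfK// !ge_min lexx orbT.
  have m3 : del * 2 <= eps0 by rewrite divfK// !ge_min lexx !orbT.
  have m4 : del * 2 <= 1 - eps0 by rewrite divfK// !ge_min lexx !orbT.
  have dp : 0 < del by rewrite divr_gt0// !lt_min e0 ce0 e00 subr_gt0 e01.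
  by split => //; try (apply/andP; split); lra.
pose C := 3 / del ^+ 2; have C0 : 0 < C by rewrite divr_gt0// exprn_gt0.
have win n a b : del <= a <= 1 - del -> del <= b <= 1 - del ->
    k n * tau n a <= k n * tau n b + C.
  move=> /andP[da ad] /andP[db bd]; have [_ mono /(_ _ d0 d1) w] := htau n.
  have h1 := mono _ _ d0 da; have h2 := mono _ _ (lt_le_trans d0 db) bd.
  have -> : k n * tau n b + C = k n * (tau n b + 3 / (k n * del ^+ 2)).
    by rewrite /C; field; rewrite !gt_eqF.
  by rewrite ler_pM2l//; rewrite -/(k n) in w; lra.
have hinf : (k n * tau n eps0)%:E @[n --> \oo] --> +oo%E.
  apply: cvg_trans hD; apply: near_eq_cvg; apply: nearW => n.
  by have [-> // _ _] := htau n.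
have big A : \forall n \near \oo, A <= k n * tau n eps0.
  by move/cvgeyPge : hinf => /(_ A); apply: filterS => n; rewrite lee_fin.
have tpos n : C + 1 <= k n * tau n eps0 -> 0 < tau n eps.
  move=> h; rewrite -(pmulr_rgt0 _ (k0 n)).
  have := win n eps0 eps d4 d2; lra.
have hr : tau n (1 - eps) / tau n eps @[n --> \oo] --> (1 : R).
  apply/cvgrPdist_le => e ep; near=> n.
  have b1 : C + 1 <= k n * tau n eps0 by near: n; exact: big.
  (* Passing from [eps0] to [eps] costs at most [C], so [k n * tau n eps >= C / e], and the ratio
     differs from 1 by at most [C / (k n * tau n eps) <= e]. *)
  have b2 : C + C / e <= k n * tau n eps0 by near: n; exact: big.
  have tp := tpos _ b1.
  have ktp : 0 < k n * tau n eps by rewrite mulr_gt0.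
  have -> : 1 - tau n (1 - eps) / tau n eps =
      (k n * tau n eps - k n * tau n (1 - eps)) / (k n * tau n eps).
    by field; rewrite !gt_eqF.
  rewrite normrM normfV (gtr0_norm ktp) ler_pdivrMr//.
  apply: (@le_trans _ _ C).
    have := win n _ _ d2 d3; have := win n _ _ d3 d2.
    by rewrite ler_norml; move=> h1 h2; apply/andP; split; lra.
  rewrite -ler_pdivrMl// mulrC.
  have := win n _ _ d4 d2; lra.
have hr' : (tau n (1 - eps) / tau n eps)%:E @[n --> \oo] --> 1%E.
  by apply: cvg_EFin => //; exact: nearW.
apply: cvg_trans hr'; apply: near_eq_cvg; apply: filterS (big (C + 1)) => n /tpos tp.
by have [tE _ _] := htau n; rewrite !tE// inver gt_eqF// -EFinM.
Unshelve. all: by end_near. Qed.
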